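(* Let $G$ be a Lie group with Lie algebra $\{\mathfrak{g},[\cdot,\cdot]_{\mathfrak{g}}\}$ acting transitively from the left on a manifold $\mathcal{M}$, let $o\in\mathcal{M}$ be an arbitrary point and let $H=\{h\in G\mid h\cdot o=o\}$ be the isotropy subgroup at $o$. Let $$\Omega^0_H(G,\mathfrak{g})=\{x\in\Omega^0(G,\mathfrak{g})\mid x(gh)=\operatorname{Ad}_{h^{-1}}x(g)\ \text{for all } g\in G,\ h\in H\}.$$ For $x,y\in\Omega^0_H(G,\mathfrak{g})$ define $x\blacktriangleright y:=\rho_*(x)(y)$ (the Lie derivative of $y$ along the vector field $\rho_*(x)$) and $[x,y](g):=[x(g),y(g)]_{\mathfrak{g}}$. Then $\{\Omega^0_H(G,\mathfrak{g}),-[\cdot,\cdot],\blacktriangleright\}$ is a post-Lie algebra.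
   Context: $\Omega^0(G,\mathfrak{g})$ is the space of $\mathfrak{g}$-valued $0$-forms on $G$, i.e. of (smooth) maps from $G$ to $\mathfrak{g}$. For $x\in\Omega^0(G,\mathfrak{g})$, $\rho_*(x)$ is the vector field on $G$ given by $\rho_*(x)(g)=\left.\frac{\partial}{\partial t}\right|_{t=0}g\exp(t\,x(g))$. Post-Lie algebra: a Lie algebra $\{\mathcal{A},\{\cdot,\cdot\}\}$ together with a bilinear product $\triangleright\colon\mathcal{A}\times\mathcal{A}\to\mathcal{A}$ such that for all $x,y,z\in\mathcal{A}$: $x\triangleright\{y,z\}=\{x\triangleright y,z\}+\{y,x\triangleright z\}$ and $\{x,y\}\triangleright z=a_\triangleright(x,y,z)-a_\triangleright(y,x,z)$, where $a_\triangleright(x,y,z):=x\triangleright(y\triangleright z)-(x\triangleright y)\triangleright z$. In the claim the Lie bracket $\{\cdot,\cdot\}$ is $-[\cdot,\cdot]$ and the product is $\blacktriangleright$.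
   Formalization: The bracket on the Lie algebra is taken to be that of right-invariant vector fields (the negative of the usual left-invariant one), because with the usual bracket the sign in -[.,.] makes the second post-Lie axiom fail for non-abelian G with trivial H. *)

(* Defs.v *)
From HB Require Import structures.
From mathcomp Require Import all_boot all_order all_algebra.
From mathcomp Require Import all_classical all_reals all_analysis.

Set Implicit Arguments.
Unset Strict Implicit.
Unset Printing Implicit Defensive.

Import Order.TTheory GRing.Theory Num.Theory.
Import numFieldNormedType.Exports.

Local Open Scope classical_set_scope.
Local Open Scope ring_scope.

Section Smooth.
Context {R : realType} {E F : normedModType R}.

(* C^k on an open set of a finite-dimensional space: the derivative exists and
   each of its evaluations u |-> 'd f u v is C^(k-1). *)
Fixpoint Ck (k : nat) (U : set E) (f : E -> F) : Prop :=
  if k is k'.+1 then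
    (forall u, U u -> differentiable f u) /\
    (forall v, Ck k' U (fun u => 'd f u v))
  else forall u, U u -> {for u, continuous f}.

Definition smooth_on (U : set E) (f : E -> F) : Prop := forall k, Ck k U f.

End Smooth.

Section SmoothCst.
Context {R : realType} {E F : normedModType R}.

Lemma smooth_on_cst (U : set E) (a : F) : smooth_on U (fun=> a).
Proof.
move=> k; elim: k a => [|k IH] a /=; first by move=> u _; exact: cvg_cst.
split=> [u _|v]; first exact: differentiable_cst.
rewrite (_ : (fun _ => _) = fun=> 0); first exact: IH.
by apply/funext => u; rewrite diff_cst.
Qed.

End SmoothCst.

Lemma smooth_on_id (R : realType) (E : normedModType R) (U : set E) : smooth_on U (fun u : E => u).
Proof.
move=> [|k] /=; first by move=> u _; exact: cvg_id.
split=> [u _|v]; first by have [] := is_diff_id u.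
rewrite (_ : (fun _ => _) = fun=> v); first exact: smooth_on_cst.
by apply/funext => u; rewrite diff_val.
Qed.

Section Atlas.
Context {R : realType}.

(* [cmap] and [cinv] are total; only their values on [cdom] and on its image
   are meaningful. *)
Record chart (E : normedModType R) (M : topologicalType) := Chart {
  cdom : set M;
  cmap : M -> E;
  cinv : E -> M;
  cdom_open : open cdom;
  cimg_open : open (cmap @` cdom);
  cmapK : {in cdom, cancel cmap cinv};
  cmap_continuous : {within cdom, continuous cmap};
  cinv_continuous : {within cmap @` cdom, continuous cinv}
}.

(* [chart_at p] is a preferred chart around p.  It is used only to represent
   the tangent space at p: a tangent vector at p is its coordinate vector
   (an element of E) in the chart [chart_at p]. *)
Record atlas (E : normedModType R) (M : topologicalType) := Atlas {
  charts : set (chart E M);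
  chart_at : M -> chart E M;
  chart_at_charts : forall p, charts (chart_at p);
  chart_at_dom : forall p, cdom (chart_at p) p;
  charts_compat : forall c c', charts c -> charts c' ->
    smooth_on (cmap c @` (cdom c `&` cdom c')) (cmap c' \o cinv c)
}.

Fact id_chart_subproof1 (E : normedModType R) : open (idfun @` [set: E]).
Proof. by rewrite image_id; exact: openT. Qed.

Fact id_chart_subproof2 (E : normedModType R) (A : set E) :
  {within A, continuous (idfun : E -> E)}.
Proof. by apply: continuous_subspaceT => x; exact: cvg_id. Qed.

Definition id_chart (E : normedModType R) : chart E E :=
  @Chart E E setT idfun idfun openT (@id_chart_subproof1 E)
    (fun _ _ => erefl) (@id_chart_subproof2 E _) (@id_chart_subproof2 E _).

Fact vec_atlas_subproof (E : normedModType R) (c c' : chart E E) :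
  [set id_chart E] c -> [set id_chart E] c' ->
  smooth_on (cmap c @` (cdom c `&` cdom c')) (cmap c' \o cinv c).
Proof. by move=> -> ->; exact: smooth_on_id. Qed.

Definition vec_atlas (E : normedModType R) : atlas E E :=
  @Atlas E E [set id_chart E] (fun=> id_chart E) (fun=> erefl) (fun=> I)
    (@vec_atlas_subproof E).

End Atlas.

Section SmoothMaps.
Context {R : realType} {E F K : normedModType R} {M N P : topologicalType}.
Variables (a : atlas E M) (b : atlas F N) (c : atlas K P).

Definition smooth_map (f : M -> N) : Prop :=
  continuous f /\
  forall s t, charts a s -> charts b t ->
    smooth_on (cmap s @` (cdom s `&` f @^-1` cdom t))
              (cmap t \o f \o cinv s).

(* smoothness of a map M * N -> P, read in the product charts s x t of M * N *)
Definition smooth_map2 (f : M -> N -> P) : Prop :=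
  continuous (fun x : M * N => f x.1 x.2) /\
  forall s t r, charts a s -> charts b t -> charts c r ->
    smooth_on
      [set u : E * F | exists2 x : M * N,
         [/\ cdom s x.1, cdom t x.2 & cdom r (f x.1 x.2)] &
         u = (cmap s x.1, cmap t x.2)]
      (fun u : E * F => cmap r (f (cinv s u.1) (cinv t u.2))).

(* the tangent map T_p f : T_p M -> T_(f p) N *)
Definition tangent_map (f : M -> N) (p : M) : E -> F :=
  'd (cmap (chart_at b (f p)) \o f \o cinv (chart_at a p))
     (cmap (chart_at a p) p).

End SmoothMaps.

Section VectorFields.
Context {R : realType} {E : normedModType R} {M : topologicalType}.
Variable a : atlas E M.

(* A vector field is a map V : M -> E with V p read as an element of T_p M,
   i.e. in the coordinates of [chart_at a p]. *)

Definition lie_derivative (F : normedModType R) (V : M -> E) (y : M -> F) :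
    M -> F :=
  fun p => tangent_map a (vec_atlas F) y p (V p).

Definition velocity (gamma : R -> M) (t : R) : E :=
  tangent_map (vec_atlas R) a gamma t (1 : R).

(* the expression of the vector field V in the coordinates of the chart c *)
Definition vf_in_chart (c : chart E M) (V : M -> E) : E -> E :=
  lie_derivative V (cmap c) \o cinv c.

(* in coordinates, [V, W] = DW(V) - DV(W) *)
Definition vf_bracket (V W : M -> E) : M -> E := fun p =>
  let c := chart_at a p in
  'd (vf_in_chart c W) (cmap c p) (V p) - 'd (vf_in_chart c V) (cmap c p) (W p).

End VectorFields.

HB.mixin Record isManifold (R : realType) (n : nat) M of Topological M := {
  manifold_atlas : atlas 'rV[R]_n M;
  manifold_hausdorff : hausdorff_space M;
  manifold_second_countable : @second_countable M
}.

#[short(type="manifoldType")]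
HB.structure Definition Manifold (R : realType) (n : nat) :=
  {M of Topological M & isManifold R n M}.

HB.mixin Record isLieGroup (R : realType) (n : nat) G
    of Group G & Manifold R n G := {
  mul_smooth :
    smooth_map2 (manifold_atlas : atlas 'rV[R]_n G) manifold_atlas
      manifold_atlas (fun g h : G => (g * h)%g);
  inv_smooth :
    smooth_map (manifold_atlas : atlas 'rV[R]_n G) manifold_atlas
      (fun g : G => (g^-1)%g)
}.

#[short(type="lieGroupType")]
HB.structure Definition LieGroup (R : realType) (n : nat) :=
  {G of Group G & Manifold R n G & isLieGroup R n G}.

Section LieGroupTheory.
Context {R : realType} {n : nat} {G : lieGroupType R n}.

Local Notation aG := (manifold_atlas : atlas 'rV[R]_n G).

(* The Lie algebra of G is T_1 G, i.e. 'rV[R]_n. *)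
Local Notation lieAlg := 'rV[R]_n.

Definition right_invariant (X : lieAlg) : G -> lieAlg :=
  fun g => tangent_map aG aG (fun k : G => (k * g)%g) 1%g X.

(* Sign convention: the bracket is the one of right-invariant vector fields,
   so that left actions of G differentiate to Lie algebra homomorphisms into
   vector fields.  It is the opposite of the bracket of left-invariant vector
   fields; for matrix groups it is YX - XY.  With it, the fields
   L_X(g) = d/dt g exp(tX) satisfy [L_X, L_Y] = - L_[X, Y]. *)
Definition lie_bracket (X Y : lieAlg) : lieAlg :=
  vf_bracket aG (right_invariant X) (right_invariant Y) 1%g.

Definition Ad (h : G) : lieAlg -> lieAlg :=
  tangent_map aG aG (fun k : G => (h * k * h^-1)%g) 1%g.

Definition one_param_subgroup (X : lieAlg) (gamma : R -> G) : Prop :=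
  [/\ smooth_map (vec_atlas R) aG gamma,
      forall s t, gamma (s + t) = (gamma s * gamma t)%g &
      velocity aG gamma 0 = X].

(* The default value is never used: every X generates a unique one-parameter
   subgroup. *)
Definition lie_exp (X : lieAlg) : G :=
  xget (fun=> 1%g) [set gamma | one_param_subgroup X gamma] 1.

Definition rho (x : G -> lieAlg) : G -> lieAlg :=
  fun g => velocity aG (fun t => (g * lie_exp (t *: x g))%g) 0.

Definition blacktriangleright (x y : G -> lieAlg) : G -> lieAlg :=
  lie_derivative aG (rho x) y.

Definition pointwise_bracket (x y : G -> lieAlg) : G -> lieAlg :=
  fun g => lie_bracket (x g) (y g).

Definition Omega0 (H : set G) : set (G -> lieAlg) :=
  [set x | smooth_map aG (vec_atlas 'rV[R]_n) x /\
           forall g h : G, H h -> x (g * h)%g = Ad (h^-1)%g (x g)].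

End LieGroupTheory.

Section Actions.
Context {R : realType} {n m : nat}.
Context {G : lieGroupType R n} {M : manifoldType R m}.

Definition lie_group_action (act : G -> M -> M) : Prop :=
  [/\ smooth_map2 (manifold_atlas : atlas 'rV[R]_n G)
        (manifold_atlas : atlas 'rV[R]_m M) manifold_atlas act,
      forall p, act 1%g p = p &
      forall g h p, act (g * h)%g p = act g (act h p)].

Definition transitive_action (act : G -> M -> M) : Prop :=
  forall p q, exists g, act g p = q.

Definition isotropy (act : G -> M -> M) (o : M) : set G :=
  [set h | act h o = o].

End Actions.

Section PostLie.
Context {R : realType} {V : lmodType R}.

(* Structures on a subset A of an ambient vector space V whose linear structure
   is the one induced by V; the operations need only be meaningful on A. *)

Definition subspace (A : set V) : Prop :=
  A 0 /\ forall (k : R) x y, A x -> A y -> A (k *: x + y).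

Definition bilinear_on (A : set V) (op : V -> V -> V) : Prop :=
  [/\ forall x y, A x -> A y -> A (op x y),
      forall (k : R) x x' y, A x -> A x' -> A y ->
        op (k *: x + x') y = k *: op x y + op x' y &
      forall (k : R) x y y', A x -> A y -> A y' ->
        op x (k *: y + y') = k *: op x y + op x y'].

Definition lie_algebra_on (A : set V) (br : V -> V -> V) : Prop :=
  [/\ subspace A,
      bilinear_on A br,
      forall x, A x -> br x x = 0 &
      forall x y z, A x -> A y -> A z ->
        br x (br y z) + br y (br z x) + br z (br x y) = 0].

Definition associator (tri : V -> V -> V) (x y z : V) : V :=
  tri x (tri y z) - tri (tri x y) z.

Definition post_lie_algebra_on (A : set V) (br tri : V -> V -> V) : Prop :=
  [/\ lie_algebra_on A br,
      bilinear_on A tri,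
      forall x y z, A x -> A y -> A z ->
        tri x (br y z) = br (tri x y) z + br y (tri x z) &
      forall x y z, A x -> A y -> A z ->
        tri (br x y) z = associator tri x y z - associator tri y x z].

End PostLie.

(* Main.v *)
(* Let D_X be the derivation of vector-valued functions on G given by
   (D_X y)(g) = d/du y (g c(u)) (X) at u = 0, where c is the inverse of the
   chart at the unit, centred at 0.  Then (x |> y)(g) = (D_{x(g)} y)(g), and by symmetry of second
   derivatives [D_X, D_Y] = - D_[X, Y].  The product rule makes the derivatives
   of the coefficients cancel in the associator: a(x, y, z)(g) is
   (D_X D_Y z)(g) with X = x(g) and Y = y(g) frozen, so antisymmetrizing it
   gives the bracket.  The Jacobi identity and the Ad-invariance of the bracket
   follow by applying these derivations to the chart itself.

   The point which is not formal is d/dt g exp(t X) = dL_g X, that is, existence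
   and uniqueness of one-parameter subgroups.  No differential equation is
   solved: in the chart, exp(t X) is the limit of the 2^k-th powers of t X / 2^k.
   Squaring doubles an error up to a factor close to 1, while halving t divides
   an error O(t^2) by 4, so the iteration converges geometrically, and two curves
   with F(t) = F(t/2)^2 and the same tangent vector at 0 are equal. *)
Require Import Defs.
From HB Require Import structures.
From mathcomp Require Import all_boot all_order all_algebra.
From mathcomp Require Import all_classical all_reals all_analysis.
From mathcomp Require Import ring lra.
Import Order.TTheory GRing.Theory Num.Theory.
Import numFieldNormedType.Exports.

Set Implicit Arguments.
Unset Strict Implicit.
Unset Printing Implicit Defensive.

Local Open Scope classical_set_scope.
Local Open Scope ring_scope.

(** [Ck] differentiates in fixed directions only, while the chain rule produces
    ['d g (f u) ('d f u v)], where the direction moves with the point. Finite dimension is therefore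
    carried as data, a basis with continuous coordinate forms, and such expressions are turned into
    scalar coefficients times derivatives in fixed directions.

    Charts are kept out of the algebra: a function y on G is studied at g through u |-> y (g * uexp
    u), a germ at 0 of a map between vector spaces. The only second-order datum of the group is then
    the mixed second derivative of [umul], whose antisymmetrization is the bracket.

    [lie_exp] is a choice among one-parameter subgroups, so its values are known only from existence
    together with uniqueness. Iterated squaring yields a curve with F(t) = F(t/2)^2, which is not
    yet a homomorphism: integer multiples come from uniqueness, inverses from a separate
    contraction, sums from continuity. Smoothness comes last, from the equation obtained by
    differentiating the homomorphism property. *)

(** * Differentials: locality and the product rule for scalar multiplication *)

Section Differential.
Context {R : realType} {E F : normedModType R}.

Lemma is_diff_eps (f : E -> F) (L : {linear E -> F}) x :
  continuous L ->
  (forall e, 0 < e -> \forall h \near (0 : E),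
      `|f (h + x) - f x - L h| <= e * `|h|) ->
  is_diff x f L.
Proof.
move=> cL fL.
have fo : f \o shift x = cst (f x) + L +o_ 0 id.
  apply/eqaddoP => e e0; apply: filterS (fL e e0) => h.
  by rewrite /= !fctE opprD addrA.
have dE := diff_unique cL fo.
by split=> //; apply/diff_locallyP; rewrite dE.
Qed.

Lemma diff_eps (f : E -> F) x : differentiable f x ->
  forall e, 0 < e -> \forall h \near (0 : E),
      `|f (h + x) - f x - 'd f x h| <= e * `|h|.
Proof.
move=> /diff_locally/eqaddoP fx e /fx; apply: filterS => h.
by rewrite /= !fctE opprD addrA.
Qed.

(** The differential depends only on the germ. Chart expressions are rarely equal everywhere, so
    this is the form in which one is replaced by another. *)
Lemma is_diff_near (f g : E -> F) x (df : E -> F) :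
  (\forall u \near x, f u = g u) -> is_diff x f df -> is_diff x g df.
Proof.
move=> fg [fx <-]; apply: (is_diff_eps (L := 'd f x)) => [|e e0].
  exact: diff_continuous.
have fgx : f x = g x by exact: nbhs_singleton fg.
move: fg; rewrite (near_shift 0) /= => fg.
near=> h.
have -> : g (h + x) = f (h + x) by near: h; apply: filterS fg => h; rewrite subr0.
by rewrite -fgx; near: h; exact: diff_eps.
Unshelve. all: by end_near. Qed.

Lemma near_diff_eq (f g : E -> F) x : differentiable f x ->
  (\forall u \near x, f u = g u) -> 'd f x = 'd g x :> (E -> F).
Proof.
by move=> fx fg; have [_ ->] := is_diff_near fg (differentiableP fx).
Qed.

Lemma near_differentiable (f g : E -> F) x : differentiable f x ->
  (\forall u \near x, f u = g u) -> differentiable g x.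
Proof. by move=> fx fg; have [] := is_diff_near fg (differentiableP fx). Qed.

End Differential.

Lemma bilin_scale_continuous (R : realType) (F : normedModType R) :
  continuous (fun p : R * F => p.1 *: p.2).
Proof. by move=> p; exact: scale_continuous. Qed.

(** Scalar multiplication is packed as a continuous bilinear map on R x F, whose differential is
    then composed with that of the pair (s, f). *)
Lemma is_diff_scale (R : realType) (E F : normedModType R)
  (s : E -> R) (f : E -> F) x (ds : E -> R) (df : E -> F) :
  is_diff x s ds -> is_diff x f df ->
  is_diff x (fun u => s u *: f u) (fun v => s x *: df v + ds v *: f x).
Proof.
move=> sx fx.
pose b (r : R) (v : F) := r *: v.
have lb : bilinear_for
    (GRing.Scale.Law.clone _ _ *:%R _) (GRing.Scale.Law.clone _ _ *:%R _) b.
  split=> [u'|u] a y z /=; rewrite /b.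
    by rewrite scalerDl scalerA.
  by rewrite scalerDr !scalerA mulrC.
pose bM := bilinear_isBilinear.Build R R F F _ _ b lb.
pose bL : {bilinear R -> F -> F} := HB.pack b bM.
have bc : continuous (fun p : R * F => bL p.1 p.2) by exact: bilin_scale_continuous.
have db := diff_bilin (s x, f x) bc.
have dfb := differentiable_bilin (s x, f x) bc.
have ib : is_diff (s x, f x) (fun p => bL p.1 p.2)
   (fun q => s x *: q.2 + q.1 *: f x) by split.
exact: (is_diff_comp (is_diff_pair sx fx) ib).
Qed.

(** * Stability of C^k functions under the linear operations and products *)

Section CkTheory.
Context {R : realType}.
Implicit Types E F K : normedModType R.

(** Continuity and differentials in [Ck] refer to f on the whole space, not to its restriction to U,
    so U only selects the points at which the conditions are imposed. This makes a germ version of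
    smoothness possible. *)
Lemma Ck_pointwise E F k (U : set E) (f : E -> F) :
  Ck k U f <-> forall u, U u -> Ck k [set u] f.
Proof.
elim: k f => [|k IH] f /=.
  by split=> [fU u Uu _ ->|fU u /fU]; [exact: fU | exact].
split=> [[df Cf] u Uu|fU].
  split=> [_ -> //|v]; first exact: df.
  by have /IH := Cf v; exact.
split=> [u /fU [+ _]|v]; first exact.
by apply/IH => u /fU [_]; exact.
Qed.

Lemma Ck_sub E F k (U V : set E) (f : E -> F) :
  V `<=` U -> Ck k U f -> Ck k V f.
Proof. by move=> VU /Ck_pointwise fU; apply/Ck_pointwise => u /VU; exact: fU. Qed.

(** Openness of U turns equality on U into equality of germs at each of its points, which is what
    derivatives see. *)
Lemma Ck_eq E F k (U : set E) (f g : E -> F) : open U ->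
  (forall u, U u -> f u = g u) -> Ck k U f -> Ck k U g.
Proof.
move=> oU; elim: k f g => [|k IH] f g fg.
  move=> fU u Uu; have := fU u Uu; rewrite /prop_for /continuous_at -(fg u Uu).
  apply: cvg_trans; apply: near_eq_cvg.
  by near=> w; apply: fg; near: w; exact: open_nbhs_nbhs.
have fgn u : U u -> \forall w \near u, f w = g w.
  by move=> Uu; near=> w; apply: fg; near: w; exact: open_nbhs_nbhs.
move=> [df Cf]; split=> [u Uu|v].
  exact: near_differentiable (df u Uu) (fgn u Uu).
apply: IH (Cf v) => u Uu.
by rewrite (near_diff_eq (df u Uu) (fgn u Uu)).
Unshelve. all: by end_near. Qed.

Lemma CkW E F k (U : set E) (f : E -> F) : Ck k.+1 U f -> Ck k U f.
Proof.
elim: k f => [|k IH] f [df Cf].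
  by move=> u Uu; exact: differentiable_continuous (df u Uu).
by split=> // v; exact: IH.
Qed.

Lemma Ck_lin E F K k (U : set E) (L : {linear F -> K}) (f : E -> F) :
  continuous L -> open U -> Ck k U f -> Ck k U (fun u => L (f u)).
Proof.
move=> cL oU; elim: k f => [|k IH] f.
  by move=> fU u Uu; apply: continuous_comp; [exact: fU | exact: cL].
move=> [df Cf].
have dLf u : U u -> is_diff u (L \o f) (L \o 'd f u).
  move=> Uu.
  have dL : is_diff (f u) L L.
    by split; [exact: linear_differentiable | exact: diff_lin].
  exact: (is_diff_comp (differentiableP (df u Uu)) dL).
split=> [u Uu|v]; first by have [] := dLf u Uu.
apply: Ck_eq (IH _ (Cf v)) => // u Uu.
by have [_] := dLf u Uu; rewrite /comp => ->.
Qed.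

Lemma CkD E F k (U : set E) (f g : E -> F) :
  open U -> Ck k U f -> Ck k U g -> Ck k U (fun u => f u + g u).
Proof.
move=> oU; elim: k f g => [|k IH] f g.
  by move=> fU gU u Uu; apply: cvgD; [exact: fU | exact: gU].
move=> [df Cf] [dg Cg].
have dfg u : U u -> is_diff u (fun u => f u + g u) (fun v => 'd f u v + 'd g u v).
  by move=> Uu; exact: (is_diffD (differentiableP (df u Uu)) (differentiableP (dg u Uu))).
split=> [u Uu|v]; first by have [] := dfg u Uu.
apply: Ck_eq (IH _ _ (Cf v) (Cg v)) => // u Uu.
by have [_ ->] := dfg u Uu.
Qed.

Lemma Ck_cst E F k (U : set E) (a : F) : Ck k U (fun _ : E => a).
Proof. exact: smooth_on_cst. Qed.

Lemma Ck_sum E F k (U : set E) (I : Type) (r : seq I) (f : I -> E -> F) :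
  open U -> (forall i, Ck k U (f i)) -> Ck k U (fun u => \sum_(i <- r) f i u).
Proof.
move=> oU Cf; elim: r => [|i r IH].
  apply: Ck_eq (@Ck_cst E F k U 0) => // u _; by rewrite big_nil.
apply: Ck_eq (CkD oU (Cf i) IH) => // u _; by rewrite big_cons.
Qed.

Lemma Ck_scale E F k (U : set E) (s : E -> R) (f : E -> F) :
  open U -> Ck k U s -> Ck k U f -> Ck k U (fun u => s u *: f u).
Proof.
move=> oU; elim: k s f => [|k IH] s f.
  by move=> sU fU u Uu; apply: cvgZ; [exact: sU | exact: fU].
move=> Cs Cf; have [ds Cds] := Cs; have [df Cdf] := Cf.
have dsf u : U u -> is_diff u (fun u => s u *: f u)
   (fun v => s u *: 'd f u v + 'd s u v *: f u).
  by move=> Uu; apply: is_diff_scale; apply: differentiableP; auto.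
split=> [u Uu|v]; first by have [] := dsf u Uu.
apply: (Ck_eq oU _ (CkD oU (IH _ _ (CkW Cs) (Cdf v)) (IH _ _ (Cds v) (CkW Cf)))).
by move=> u Uu; have [_ ->] := dsf u Uu.
Qed.

Lemma Ck_pair E F K k (U : set E) (f : E -> F) (g : E -> K) :
  open U -> Ck k U f -> Ck k U g -> Ck k U (fun u => (f u, g u)).
Proof.
move=> oU; elim: k f g => [|k IH] f g.
  by move=> fU gU u Uu; apply: cvg_pair; [exact: fU | exact: gU].
move=> [df Cf] [dg Cg].
have dfg u : U u -> is_diff u (fun u => (f u, g u)) (fun v => ('d f u v, 'd g u v)).
  by move=> Uu; apply: is_diff_pair; apply: differentiableP; auto.
split=> [u Uu|v]; first by have [] := dfg u Uu.
apply: Ck_eq (IH _ _ (Cf v) (Cg v)) => // u Uu.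
by have [_ ->] := dfg u Uu.
Qed.

End CkTheory.

(* A finite-dimensional space, presented by a basis e and its (continuous)
   coordinate forms c. *)
Record coords (R : realType) (E : normedModType R) := Coords {
  cdim : nat;
  cbase : 'I_cdim -> E;
  cform : 'I_cdim -> {linear E -> R};
  cform_continuous : forall i, continuous (cform i);
  coordsE : forall v, v = \sum_i cform i v *: cbase i
}.

(** * Finite-dimensional spaces and the chain rule for C^k functions *)

Section Coords.
Context {R : realType}.

Lemma coord_is_linear n (i : 'I_n) : linear (fun v : 'rV[R]_n => v ord0 i).
Proof. by move=> a u v; rewrite !mxE. Qed.

Definition rV_form n (i : 'I_n) : {linear 'rV[R]_n -> R} :=
  HB.pack (fun v : 'rV[R]_n => v ord0 i)
    (GRing.isLinear.Build R 'rV[R]_n R *:%R _ (coord_is_linear i)).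

Definition rV_coords n : coords 'rV[R]_n.
Proof.
refine (@Coords _ _ n (fun i => delta_mx ord0 i) (@rV_form n) _ _).
  by move=> i; exact: coord_continuous.
by move=> v; rewrite {1}(row_sum_delta v).
Defined.

Lemma R_form_linear : linear (fun v : R => v).
Proof. by []. Qed.

Definition R_form (i : 'I_1) : {linear R -> R} :=
  HB.pack (fun v : R => v)
    (GRing.isLinear.Build R R R *:%R _ R_form_linear).

Definition R_coords : coords (R : normedModType R).
Proof.
refine (@Coords R R 1 (fun _ => (1 : R)) R_form _ _).
  by move=> i v; exact: cvg_id.
by move=> v; rewrite big_ord1 /= [RHS]mulr1.
Defined.

Section Prod.
Context (E F : normedModType R) (cE : coords E) (cF : coords F).

Definition prod_base (i : 'I_(cdim cE + cdim cF)) : E * F :=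
  match fintype.split i with inl j => (cbase j, 0) | inr j => (0, cbase j) end.

Definition prod_form_fun (i : 'I_(cdim cE + cdim cF)) (p : E * F) : R :=
  match fintype.split i with inl j => cform j p.1 | inr j => cform j p.2 end.

Lemma prod_form_linear i : linear (prod_form_fun i).
Proof.
move=> a u v; rewrite /prod_form_fun; case: fintype.split => j /=; exact: linearP.
Qed.

Definition prod_form i : {linear (E * F)%type -> R} :=
  HB.pack (prod_form_fun i)
    (GRing.isLinear.Build R (E * F)%type R *:%R _ (prod_form_linear i)).

Definition prod_coords : coords (E * F)%type.
Proof.
refine (@Coords _ _ _ prod_base prod_form _ _).
  move=> i; rewrite /= /prod_form_fun; case: fintype.split => j p.
    by apply: (@continuous_comp _ _ _ fst (cform j));
      [exact: cvg_fst | exact: cform_continuous].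
  by apply: (@continuous_comp _ _ _ snd (cform j));
    [exact: cvg_snd | exact: cform_continuous].
move=> [u v]; rewrite big_split_ord /= /prod_form_fun /prod_base.
under eq_bigr do rewrite (unsplitK (inl _)) /=.
under [X in _ = _ + X]eq_bigr do rewrite (unsplitK (inr _)) /=.
have s1 I (r : seq I) (g : I -> R) (h : I -> E) :
    \sum_(i <- r) g i *: ((h i, 0) : (E * F)%type) = (\sum_(i <- r) g i *: h i, 0).
  elim: r => [|i r IH]; first by rewrite !big_nil.
  by rewrite !big_cons IH; congr (_, _); rewrite /= scaler0 addr0.
have s2 I (r : seq I) (g : I -> R) (h : I -> F) :
    \sum_(i <- r) g i *: ((0, h i) : (E * F)%type) = (0, \sum_(i <- r) g i *: h i).
  elim: r => [|i r IH]; first by rewrite !big_nil.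
  by rewrite !big_cons IH; congr (_, _); rewrite /= scaler0 addr0.
by rewrite s1 s2 -!coordsE /=; congr (_, _); rewrite /= ?addr0 ?add0r.
Defined.

End Prod.

(** Expanding ['d f u v] in the basis of F writes the derivative of the composite as a sum of scalar
    functions times ['d g (f u) (cbase i)]. The directions are now fixed, and the induction
    hypothesis applies to each composite ['d g _ (cbase i)] after f. *)
Lemma Ck_comp (E F K : normedModType R) (cF : coords F) k
  (U : set E) (V : set F) (f : E -> F) (g : F -> K) : open U -> open V ->
  (forall u, U u -> V (f u)) ->
  Ck k U f -> Ck k V g -> Ck k U (fun u => g (f u)).
Proof.
move=> oU oV; elim: k f g => [|k IH] f g UV.
  move=> fU gV u Uu; apply: (@continuous_comp _ _ _ f g); first exact: fU.
  by apply: gV; exact: UV.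
move=> Cf Cg; have [df Cdf] := Cf; have [dg Cdg] := Cg.
have dgf u : U u -> is_diff u (g \o f) ('d g (f u) \o 'd f u).
  by move=> Uu; apply: is_diff_comp; apply: differentiableP; auto.
split=> [u Uu|v]; first by have [] := dgf u Uu.
apply: (@Ck_eq _ _ _ _ _
  (fun u => \sum_i cform i ('d f u v) *: 'd g (f u) (cbase (c:=cF) i))) => //.
- move=> u Uu; have [_] := dgf u Uu; rewrite /comp => -> /=.
  rewrite [in RHS](coordsE cF ('d f u v)) linear_sum.
  by apply: eq_bigr => i _; rewrite linearZ.
- apply: Ck_sum => // i; apply: Ck_scale => //.
    by apply: (Ck_lin (L := cform i)); [exact: cform_continuous | | exact: Cdf].
  apply: (IH f (fun w => 'd g w (cbase (c:=cF) i))) => //.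
    exact: CkW.
  exact: Cdg.
Qed.

End Coords.

(** * Germs of smooth maps *)

Definition smooth_at (R : realType) (E F : normedModType R) (f : E -> F) (p : E) :=
  \forall u \near p, smooth_on [set u] f.

Section SmoothAt.
Context {R : realType}.
Implicit Types E F K : normedModType R.

(** Using the singletons [[set u]] makes smoothness near p a plain filter statement, with one
    neighbourhood for all orders k; the open set is recovered as the interior. *)
Lemma smooth_atP E F (f : E -> F) p :
  smooth_at f p <-> exists U : set E, [/\ open U, U p & smooth_on U f].
Proof.
split=> [fp|[U [oU Up fU]]].
  exists (interior (fun u => smooth_on [set u] f)).
  split=> //; first exact: open_interior.
  by move=> k; apply/Ck_pointwise => u /nbhs_singleton; exact.
near=> u; move=> k; apply: Ck_sub (fU k) => _ ->.
by near: u; exact: open_nbhs_nbhs.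
Unshelve. all: by end_near. Qed.

Lemma smooth_at_near E F (f : E -> F) p :
  smooth_at f p -> \forall u \near p, smooth_at f u.
Proof. exact: nbhs_interior. Qed.

Lemma smooth_on_at E F (U : set E) (f : E -> F) p :
  open U -> U p -> smooth_on U f -> smooth_at f p.
Proof. by move=> oU Up fU; apply/smooth_atP; exists U. Qed.

Lemma smooth_at_on E F (U : set E) (f : E -> F) :
  (forall u, U u -> smooth_at f u) -> smooth_on U f.
Proof.
by move=> fU k; apply/Ck_pointwise => u /fU /nbhs_singleton; exact.
Qed.

Lemma smooth_at_eq E F (f g : E -> F) p :
  (\forall u \near p, f u = g u) -> smooth_at f p -> smooth_at g p.
Proof.
move=> fg /smooth_atP[U [oU Up fU]]; apply/smooth_atP.
exists (U `&` interior (fun u => f u = g u)); split.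
- by apply: openI => //; exact: open_interior.
- by split.
- move=> k; apply: (@Ck_eq _ _ _ _ _ f).
  + by apply: openI => //; exact: open_interior.
  + by move=> u [_ /nbhs_singleton].
  + by apply: Ck_sub (fU k) => u [].
Qed.

Lemma smooth_at_lift2 E F K (L : normedModType R) (f : E -> F) (g : E -> K) (h : E -> L) p :
  (forall k (U : set E), open U -> Ck k U f -> Ck k U g -> Ck k U h) ->
  smooth_at f p -> smooth_at g p -> smooth_at h p.
Proof.
move=> fgh /smooth_atP[U [oU Up fU]] /smooth_atP[V [oV Vp gV]].
apply/smooth_atP; exists (U `&` V); split=> // [|k]; first exact: openI.
apply: fgh; first exact: openI.
  by apply: Ck_sub (fU k) => u [].
by apply: Ck_sub (gV k) => u [].
Qed.

Lemma smooth_at_cst E F (a : F) (p : E) : smooth_at (fun=> a) p.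
Proof. by apply: (@smooth_on_at _ _ setT) => //; [exact: openT | exact: smooth_on_cst]. Qed.

Lemma smooth_at_id E (p : E) : smooth_at (fun u => u) p.
Proof. by apply: (@smooth_on_at _ _ setT) => //; [exact: openT | exact: smooth_on_id]. Qed.

Lemma smooth_at_lin E F K (L : {linear F -> K}) (f : E -> F) p :
  continuous L -> smooth_at f p -> smooth_at (fun u => L (f u)) p.
Proof.
move=> cL fp; apply: (smooth_at_lift2 _ fp fp) => k U oU fU _; exact: Ck_lin.
Qed.

Lemma smooth_atD E F (f g : E -> F) p :
  smooth_at f p -> smooth_at g p -> smooth_at (fun u => f u + g u) p.
Proof. by apply: smooth_at_lift2 => k U; exact: CkD. Qed.

Lemma smooth_at_scale E F (s : E -> R) (f : E -> F) p :
  smooth_at s p -> smooth_at f p -> smooth_at (fun u => s u *: f u) p.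
Proof. by apply: smooth_at_lift2 => k U; exact: Ck_scale. Qed.

Lemma smooth_atZ E F (k : R) (f : E -> F) p :
  smooth_at f p -> smooth_at (fun u => k *: f u) p.
Proof. exact/smooth_at_scale/smooth_at_cst. Qed.

Lemma smooth_atN E F (f : E -> F) p :
  smooth_at f p -> smooth_at (fun u => - f u) p.
Proof.
move=> /(smooth_atZ (-1)); apply: smooth_at_eq.
by near=> u; rewrite scaleN1r.
Unshelve. all: by end_near. Qed.

Lemma smooth_atB E F (f g : E -> F) p :
  smooth_at f p -> smooth_at g p -> smooth_at (fun u => f u - g u) p.
Proof. by move=> fp /smooth_atN; exact: smooth_atD. Qed.

Lemma smooth_at_pair E F K (f : E -> F) (g : E -> K) p :
  smooth_at f p -> smooth_at g p -> smooth_at (fun u => (f u, g u)) p.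
Proof. by apply: smooth_at_lift2 => k U; exact: Ck_pair. Qed.

Lemma smooth_at_sum E F (I : Type) (r : seq I) (f : I -> E -> F) p :
  (forall i, smooth_at (f i) p) -> smooth_at (fun u => \sum_(i <- r) f i u) p.
Proof.
move=> fp; elim: r => [|i r IH].
  apply: smooth_at_eq (smooth_at_cst 0 p).
  by near=> u; rewrite big_nil.
apply: smooth_at_eq (smooth_atD (fp i) IH).
by near=> u; rewrite big_cons.
Unshelve. all: by end_near. Qed.

Lemma smooth_at_continuous E F (f : E -> F) p :
  smooth_at f p -> {for p, continuous f}.
Proof. by move=> /nbhs_singleton/(_ 0%N); exact. Qed.

Lemma smooth_at_differentiable E F (f : E -> F) p :
  smooth_at f p -> differentiable f p.
Proof. by move=> /nbhs_singleton/(_ 1%N)[+ _]; exact. Qed.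

Lemma smooth_at_is_diff E F (f : E -> F) p :
  smooth_at f p -> is_diff p f ('d f p).
Proof. by move=> /smooth_at_differentiable/differentiableP. Qed.

Lemma smooth_at_diff E F (f : E -> F) p v :
  smooth_at f p -> smooth_at (fun u => 'd f u v) p.
Proof. by apply: filterS => u fu k; have [_] := fu k.+1; exact. Qed.

Lemma smooth_at_comp E F K (cF : coords F) (f : E -> F) (g : F -> K) p :
  smooth_at f p -> smooth_at g (f p) -> smooth_at (fun u => g (f u)) p.
Proof.
move=> fp /smooth_atP[V [oV Vp gV]].
have := smooth_at_continuous fp => fc.
have fV : \forall u \near p, V (f u) by apply: fc; exact: open_nbhs_nbhs.
move: fp => /smooth_atP[U [oU Up fU]].
have oW : open (U `&` interior (fun u => V (f u))).
  by apply: openI => //; exact: open_interior.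
apply/smooth_atP; exists (U `&` interior (fun u => V (f u))); split=> // k.
apply: (Ck_comp cF oW oV) (gV k) => [u [_ /nbhs_singleton]//|].
by apply: Ck_sub (fU k) => u [].
Qed.

Lemma diff_compE E F K (f : E -> F) (g : F -> K) p v :
  differentiable f p -> differentiable g (f p) ->
  'd (fun u => g (f u)) p v = 'd g (f p) ('d f p v).
Proof. by move=> fp gp; rewrite -[LHS]/('d (g \o f) p v) diff_comp. Qed.

Lemma diff_linE E F K (L : {linear F -> K}) (f : E -> F) p v :
  continuous L -> differentiable f p ->
  'd (fun u => L (f u)) p v = L ('d f p v).
Proof.
move=> cL fp; rewrite diff_compE ?diff_lin//.
exact: linear_differentiable.
Qed.

Lemma diff_sumE E F (I : Type) (r : seq I) (f : I -> E -> F) p v :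
  (forall i, differentiable (f i) p) ->
  differentiable (fun u => \sum_(i <- r) f i u) p /\
  'd (fun u => \sum_(i <- r) f i u) p v = \sum_(i <- r) 'd (f i) p v.
Proof.
move=> fp; elim: r => [|i r [IH1 IH2]].
  rewrite (_ : (fun _ => _) = cst 0); last by apply/funext => u; rewrite big_nil.
  by rewrite diff_cst big_nil; split => //; exact: differentiable_cst.
rewrite (_ : (fun _ => _) = f i + fun u => \sum_(i <- r) f i u); last first.
  by apply/funext => u; rewrite big_cons.
have [d1 d2] := is_diffD (differentiableP (fp i)) (differentiableP IH1).
by split=> //; rewrite d2 big_cons -IH2.
Qed.

Lemma diff_scaleE E F (s : E -> R) (f : E -> F) p v :
  differentiable s p -> differentiable f p ->
  'd (fun u => s u *: f u) p v = s p *: 'd f p v + 'd s p v *: f p.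
Proof.
move=> sp fp.
by have [_ ->] := is_diff_scale (differentiableP sp) (differentiableP fp).
Qed.

Lemma diff_eqE E F (f g : E -> F) p v : differentiable f p ->
  (\forall u \near p, f u = g u) -> 'd f p v = 'd g p v.
Proof. by move=> fp fg; rewrite (near_diff_eq fp fg). Qed.

Lemma diff_pairlE E F K (f : E * F -> K) p q v : differentiable f (p, q) ->
  'd (fun u => f (u, q)) p v = 'd f (p, q) (v, 0).
Proof.
move=> fpq; have d1 : is_diff p (fun u : E => (u, q)) (fun v : E => (v, 0)).
  exact: (is_diff_pair (is_diff_id p) (is_diff_cst q p)).
have [d1p d1E] := d1.
by rewrite (diff_compE v d1p fpq) d1E.
Qed.

Lemma diff_pairrE E F K (f : E * F -> K) p q v : differentiable f (p, q) ->
  'd (fun u => f (p, u)) q v = 'd f (p, q) (0, v).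
Proof.
move=> fpq; have d1 : is_diff q (fun u : F => (p, u)) (fun v : F => (0, v)).
  exact: (is_diff_pair (is_diff_cst p q) (is_diff_id q)).
have [d1p d1E] := d1.
by rewrite (diff_compE v d1p fpq) d1E.
Qed.

End SmoothAt.

(** * Second derivatives: symmetry and the second-order chain rule *)

Definition hess (R : realType) (E F : normedModType R) (f : E -> F) (p a b : E) :=
  'd (fun u => 'd f u a) p b.

Section SecondOrder.
Context {R : realType}.
Implicit Types E F K : normedModType R.

Lemma line_MVT E (f : E -> R) x a (t : R) : 0 < t ->
  (forall s, 0 <= s <= t -> differentiable f (x + s *: a)) ->
  exists2 c, 0 <= c <= t & f (x + t *: a) - f x = t * 'd f (x + c *: a) a.
Proof.
move=> t0 fx.
have dl (s : R) : is_diff s (fun s : R => x + s *: a) (fun v : R => v *: a).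
  have := is_diffD (is_diff_cst x s) (is_diff_scalel s a).
  by rewrite add0r.
have gd s : 0 <= s <= t -> is_derive s 1 (fun s : R => f (x + s *: a)) ('d f (x + s
  *: a) a).
  move=> st.
  have dg := is_diff_comp (dl s) (differentiableP (fx s st)).
  have dgs : differentiable (fun s : R => f (x + s *: a)) s by have [] := dg.
  apply: DeriveDef; first exact: diff_derivable.
  by rewrite deriveE//; have [_] := dg => -> /=; rewrite scale1r.
have [c|//|c ct] := @MVT R (fun s : R => f (x + s *: a)) (fun s : R => 'd f (x + s *:
  a) a) 0 t t0.
  by rewrite in_itv/= => /andP[c0 ct]; apply: gd; rewrite !ltW.
  apply: continuous_in_subspaceT => s; rewrite inE/= in_itv/= => st.
  by apply/differentiable_continuous/derivable1_diffP; have [] := gd s st.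
rewrite /= scale0r addr0 subr0 mulrC => E1; exists c => //.
by move: ct; rewrite in_itv/= => /andP[c0 ct]; rewrite !ltW.
Qed.

(* The left-hand side is symmetric in a and b, whence the symmetry of hess. *)
Lemma hess_mean E (f : E -> R) p a b (V : set E) :
  smooth_at f p -> nbhs p V ->
  \forall t \near (0 : R)^'+, exists2 w, V w &
  f (p + t *: a + t *: b) - f (p + t *: a) - (f (p + t *: b) - f p) =
    t * (t * hess f w a b).
Proof.
move=> fp Vp.
have : nbhs p (V `&` (fun u => smooth_at f u)).
  by apply: filterI => //; exact: smooth_at_near.
move=> /nbhs_ballP[r /= r0 rV].
(* The summand 1 keeps the divisor of r positive when a = b = 0. *)
have K0 : 0 < `|a| + `|b| + 1 by rewrite ltr_wpDl// addr_ge0.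
have inr t s s' : 0 <= s <= t -> 0 <= s' <= t -> t < r / (`|a| + `|b| + 1) ->
    ball p r (p + s *: a + s' *: b).
  move=> /andP[s0 st] /andP[s'0 s't] tr.
  rewrite -ball_normE /= opprD addrA opprD addrA subrr add0r -opprD normrN.
  apply: (le_lt_trans (ler_normD _ _)); rewrite !normrZ !ger0_norm//.
  apply: (@le_lt_trans _ _ (t * (`|a| + `|b| + 1))); last by rewrite -ltr_pdivlMr.
  rewrite !mulrDr mulr1 -[leLHS]addr0 lerD//; last by rewrite (le_trans s0).
  by rewrite lerD// ler_wpM2r.
near=> t.
have t0 : 0 < t by near: t; exact: nbhs_right_gt.
have tr : t < r / (`|a| + `|b| + 1).
  by near: t; apply: nbhs_right_lt; rewrite divr_gt0.
have tt : 0 <= t <= t by rewrite ltW/=.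
have t00 : (0 : R) <= 0 <= t by rewrite lexx ltW.
have sm s s' : 0 <= s <= t -> 0 <= s' <= t ->
    smooth_at f (p + s *: a + s' *: b) /\ V (p + s *: a + s' *: b).
  by move=> st s't; have [] := rV _ (inr _ _ _ st s't tr).
(* The second difference is h (p + t a) - h p. The mean value theorem is applied to h along a, then
   to ['d f _ a] along b. *)
pose h (u : E) := f (u + t *: b) - f u.
have dh s : 0 <= s <= t -> is_diff (p + s *: a) h
    (fun v => 'd f (p + s *: a + t *: b) v - 'd f (p + s *: a) v).
  move=> st.
  have d1 : is_diff (p + s *: a) (fun u => u + t *: b) (fun u => u).
    have := is_diffD (is_diff_id (p + s *: a)) (is_diff_cst (t *: b) (p + s *: a)).
    by rewrite addr0.
  have [f1 _] := sm _ _ st tt; have [f2 _] := sm _ _ st t00.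
  move: f2; rewrite scale0r addr0 => f2.
  exact: (is_diffB (is_diff_comp d1 (smooth_at_is_diff f1)) (smooth_at_is_diff f2)).
have [|c ct] := @line_MVT E h p a t t0; first by move=> s /dh[].
rewrite {1 2}/h => ->; have [_ ->] := dh _ ct.
have [|c' c't E2] := @line_MVT E (fun u => 'd f u a) (p + c *: a) b t t0.
  by move=> s st; have [f1 _] := sm _ _ ct st;
    exact/smooth_at_differentiable/smooth_at_diff.
by rewrite E2; exists (p + c *: a + c' *: b) => //; have [] := sm _ _ ct c't.
Unshelve. all: by end_near. Qed.

(** The two mean values are taken at different points w1 and w2; continuity of both second
    derivatives at p brings them together as these points approach p. *)
Lemma hess_symR E (f : E -> R) p a b :
  smooth_at f p -> hess f p a b = hess f p b a.
Proof.
move=> fp; apply/eqP; rewrite -subr_eq0 -normr_le0; apply/ler_addgt0Pl => e e0.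
rewrite addr0.
have e20 : 0 < e / 2 by rewrite divr_gt0.
have c1 : {for p, continuous (fun u => hess f u a b)}.
  exact: (smooth_at_continuous (smooth_at_diff b (smooth_at_diff a fp))).
have c2 : {for p, continuous (fun u => hess f u b a)}.
  exact: (smooth_at_continuous (smooth_at_diff a (smooth_at_diff b fp))).
have n1 : \forall u \near p, `|hess f p a b - hess f u a b| < e / 2.
  by move/cvgr_dist_lt: c1; exact.
have n2 : \forall u \near p, `|hess f p b a - hess f u b a| < e / 2.
  by move/cvgr_dist_lt: c2; exact.
have m1 := hess_mean a b fp n1; have m2 := hess_mean b a fp n2.
near (0 : R)^'+ => t.
have t0 : t != 0 by rewrite gt_eqF//; near: t; exact: nbhs_right_gt.
have [w1 lt1 E1] : exists2 w, `|hess f p a b - hess f w a b| < e / 2 &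
  f (p + t *: a + t *: b) - f (p + t *: a) - (f (p + t *: b) - f p) =
    t * (t * hess f w a b) by near: t.
have [w2 lt2 E2] : exists2 w, `|hess f p b a - hess f w b a| < e / 2 &
  f (p + t *: b + t *: a) - f (p + t *: b) - (f (p + t *: a) - f p) =
    t * (t * hess f w b a) by near: t.
have : t * (t * hess f w1 a b) = t * (t * hess f w2 b a).
  rewrite -E1 -E2 -!addrA [t *: b + _]addrC !addrA.
  ring.
move=> /(mulfI t0)/(mulfI t0) w12.
move: lt1 lt2; rewrite w12 !ltr_norml ler_norml.
by move=> /andP[? ?] /andP[? ?]; apply/andP; split; lra.
Unshelve. all: by end_near. Qed.

Lemma hess_lin E F K (L : {linear F -> K}) (f : E -> F) p a b :
  continuous L -> smooth_at f p ->
  hess (fun u => L (f u)) p a b = L (hess f p a b).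
Proof.
move=> cL fp; rewrite -diff_linE//; last exact/smooth_at_differentiable/smooth_at_diff.
symmetry; apply: diff_eqE.
  by apply/smooth_at_differentiable/smooth_at_lin => //; exact: smooth_at_diff.
apply: filterS (smooth_at_near fp) => u fu.
by rewrite diff_linE//; exact: smooth_at_differentiable.
Qed.

(** The mean value theorem is scalar, so a vector-valued f is treated through its coordinate
    forms. *)
Lemma hess_sym E F (cF : coords F) (f : E -> F) p a b :
  smooth_at f p -> hess f p a b = hess f p b a.
Proof.
move=> fp; rewrite [LHS](coordsE cF) [RHS](coordsE cF).
apply: eq_bigr => i _; congr (_ *: _).
rewrite -!hess_lin//; try exact: cform_continuous.
by apply: hess_symR; apply: smooth_at_lin => //; exact: cform_continuous.
Qed.

Lemma hess_linearl E F (f : E -> F) p k a a' b : smooth_at f p ->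
  hess f p (k *: a + a') b = k *: hess f p a b + hess f p a' b.
Proof.
move=> fp; rewrite /hess.
rewrite (_ : (fun u => 'd f u (k *: a + a')) =
   (fun u => k *: 'd f u a + 'd f u a')); last by apply/funext => u; rewrite linearP.
have d1 := smooth_at_is_diff (smooth_at_diff a fp).
have d2 := smooth_at_is_diff (smooth_at_diff a' fp).
by have [_ ->] := is_diffD (is_diffZ k d1) d2.
Qed.

Lemma hess_linearr E F (f : E -> F) p k a b b' :
  hess f p a (k *: b + b') = k *: hess f p a b + hess f p a b'.
Proof. exact: linearP. Qed.

(** After expansion in the basis of F, the product rule separates two effects: the base point of
    ['d g] moves, giving the term in [hess g], and the direction ['d f u a] moves, giving the term
    in [hess f]. *)
Lemma hess_comp E F K (cF : coords F) (f : E -> F) (g : F -> K) p a b :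
  smooth_at f p -> smooth_at g (f p) ->
  hess (fun u => g (f u)) p a b =
  hess g (f p) ('d f p a) ('d f p b) + 'd g (f p) (hess f p a b).
Proof.
move=> fp gp.
have dgE (A : F) y : 'd g y A = \sum_i cform i A *: 'd g y (cbase (c:=cF) i).
  by rewrite {1}(coordsE cF A) linear_sum; apply: eq_bigr => i _; rewrite linearZ.
have s1 i : smooth_at (fun u => cform (c:=cF) i ('d f u a)) p.
  by apply: smooth_at_lin; [exact: cform_continuous | exact: smooth_at_diff].
have s2 i : smooth_at (fun u => 'd g (f u) (cbase (c:=cF) i)) p.
  apply: (@smooth_at_comp _ _ _ _ cF f (fun y => 'd g y (cbase i))) => //.
  exact: smooth_at_diff.
rewrite /hess.
have dsum i : differentiable
    (fun u => cform (c:=cF) i ('d f u a) *: 'd g (f u) (cbase i)) p.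
  by apply/smooth_at_differentiable/smooth_at_scale.
have [D1 D2] := diff_sumE (index_enum 'I_(cdim cF)) b dsum.
rewrite -(diff_eqE _ D1); last first.
  have gf : \forall u \near p, smooth_at g (f u).
    by apply: smooth_at_continuous fp _ _; exact: smooth_at_near.
  apply: filterS2 gf (smooth_at_near fp) => u gu fu.
  by rewrite (@diff_compE _ _ _ _ f g) ?dgE//; exact: smooth_at_differentiable.
rewrite D2 [in RHS]dgE.
have dsum' i : differentiable
    (fun y => cform (c:=cF) i ('d f p a) *: 'd g y (cbase i)) (f p).
  by apply/smooth_at_differentiable/smooth_atZ/smooth_at_diff.
have [_ D3] := diff_sumE (index_enum 'I_(cdim cF)) ('d f p b) dsum'.
rewrite (_ : (fun y => 'd g y ('d f p a)) = fun y => \sum_i cform (c:=cF) i ('d f p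
  a) *: 'd g y (cbase i)); last first.
  by apply/funext => y.
rewrite D3 -big_split/=; apply: eq_bigr => i _.
rewrite diff_scaleE; [|exact: smooth_at_differentiable..].
rewrite diff_linE; [|exact: cform_continuous|exact/smooth_at_differentiable/smooth_at_diff].
rewrite (@diff_compE _ _ _ _ f (fun y => 'd g y (cbase i))); last 2 first.
- exact: smooth_at_differentiable.
- exact/smooth_at_differentiable/smooth_at_diff.
rewrite diff_scaleE;
  [|exact: differentiable_cst|exact/smooth_at_differentiable/smooth_at_diff].
by rewrite diff_cst scale0r addr0.
Qed.

End SecondOrder.

(** * Quadratic estimates for smooth maps *)

Section Quadratic.
Context {R : realType}.
Implicit Types E F K : normedModType R.

Lemma rV_norm_le n (v : 'rV[R]_n) (B : R) : 0 <= B ->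
  (forall j, `|v ord0 j| <= B) -> `|v| <= B.
Proof.
move=> B0 vB; rewrite [`|v|]mx_normrE.
by apply/bigmax_leP; split=> // -[i j] _ /=; rewrite (ord1 i).
Qed.

Lemma differentiable_lipschitz E F (g : E -> F) p : differentiable g p ->
  exists2 C, 0 < C & \forall z \near p, `|g z - g p| <= C * `|z - p|.
Proof.
move=> gp; have [k k0 kP] := linear_lipschitz (diff_continuous gp).
(* k bounds the differential at p, and 1 absorbs the remainder taken with e = 1. *)
exists (k + 1); first by rewrite addr_gt0.
have := diff_eps gp ltr01; rewrite (near_shift p) => H.
near=> z; have : `|g (z - p + p) - g p - 'd g p (z - p)| <= 1 * `|z - p|.
  by near: z; apply: filterS H => z; rewrite /= sub0r.
rewrite subrK mul1r => gz.
have -> : g z - g p = (g z - g p - 'd g p (z - p)) + 'd g p (z - p) by rewrite subrK.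
by rewrite (le_trans (ler_normD _ _))// mulrDl mul1r addrC lerD.
Unshelve. all: by end_near. Qed.

(** The derivatives along the finitely many basis vectors are Lipschitz at p and the coordinate
    forms are bounded, which makes the estimate uniform in the direction v. *)
Lemma diff_lipschitz_near E (cE : coords E) F (f : E -> F) p : smooth_at f p ->
  exists r C, [/\ 0 < r, 0 < C & forall z, `|z - p| <= r ->
    smooth_at f z /\ forall v, `|'d f z v - 'd f p v| <= C * `|z - p| * `|v|].
Proof.
move=> fp.
have H1 (i : 'I_(cdim cE)) : exists C, 0 < C /\
    \forall z \near p, `|'d f z (cbase i) - 'd f p (cbase i)| <= C * `|z - p|.
  have [C C0 H] := differentiable_lipschitz
    (smooth_at_differentiable (smooth_at_diff (cbase i) fp)).
  by exists C.
have H2 (i : 'I_(cdim cE)) : exists C, 0 < C /\ forall v, `|cform i v| <= C * `|v|.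
  by have [C C0 H] := linear_lipschitz (@cform_continuous _ _ _ i); exists C.
have [C1 C1P] := fin_all_exists H1; have [C2 C2P] := fin_all_exists H2.
have : nbhs p (fun z => smooth_at f z /\
   forall i, `|'d f z (cbase (c:=cE) i) - 'd f p (cbase i)| <= C1 i * `|z - p|).
  apply: filterI; first exact: smooth_at_near.
  by apply: filter_forall => i; have [] := C1P i.
move=> /nbhs_ballP[r /= r0 rP].
(* Halving r fits the closed ball inside the open one; adding 1 makes the constant positive even for
   an empty basis. *)
exists (r / 2), (\sum_i C2 i * C1 i + 1).
have S0 : 0 <= \sum_i C2 i * C1 i.
  apply: sumr_ge0 => i _; have [? _] := C1P i; have [? _] := C2P i.
  by rewrite mulr_ge0// ltW.
split; [by rewrite divr_gt0|by rewrite ltr_wpDl|] => z zr.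
have [|fz zP] := rP z.
  by rewrite -ball_normE /= distrC (le_lt_trans zr)// ltr_pdivrMr// ltr_pMr// ltr1n.
split=> // v.
have dE y : 'd f y v = \sum_i cform i v *: 'd f y (cbase (c:=cE) i).
  by rewrite {1}(coordsE cE v) linear_sum; apply: eq_bigr => i _; rewrite linearZ.
rewrite (dE z) (dE p) -sumrB (le_trans (ler_norm_sum _ _ _))//.
apply: (@le_trans _ _ (\sum_i C2 i * C1 i * `|z - p| * `|v|)); last first.
  by rewrite -!mulr_suml !ler_wpM2r// lerDl.
apply: ler_sum => i _; rewrite -scalerBr normrZ.
have [? ?] := C1P i; have [? H] := C2P i.
apply: (@le_trans _ _ ((C2 i * `|v|) * (C1 i * `|z - p|))); first exact: ler_pM.
by rewrite le_eqVlt; apply/orP; left; apply/eqP; ring.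
Qed.

(** Along the segment from x' to x, each coordinate of the left-hand side is that of the
    differential at an intermediate point minus the differential at p. The intermediate point
    depends on the coordinate, which is harmless for the sup norm. Both endpoints vary because the
    group law will be compared at two pairs of arguments. *)
Lemma quadratic_estimate E (cE : coords E) n (f : E -> 'rV[R]_n) p : smooth_at f p ->
  exists r C, [/\ 0 < r, 0 < C & forall x x' rho, rho <= r ->
    `|x - p| <= rho -> `|x' - p| <= rho ->
    `|f x - f x' - 'd f p (x - x')| <= C * rho * `|x - x'|].
Proof.
move=> /(diff_lipschitz_near cE)[r [C [r0 C0 H]]].
exists r, C; split=> // x x' rho rhor xr x'r.
have rho0 : 0 <= rho by apply: le_trans x'r.
apply: rV_norm_le => [|j]; first by rewrite !mulr_ge0// ltW.
pose L := rV_form (R := R) j.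
have Lc : continuous L by exact: coord_continuous.
have in_ball s : 0 <= s <= 1 -> `|x' + s *: (x - x') - p| <= rho.
  move=> /andP[s0 s1].
  have -> : x' + s *: (x - x') - p = (1 - s) *: (x' - p) + s *: (x - p).
    have -> : x - x' = (x - p) - (x' - p) by rewrite opprB addrA subrK.
    by rewrite addrAC scalerBr scalerBl scale1r addrA addrAC.
  rewrite (le_trans (ler_normD _ _))// !normrZ (ger0_norm s0) ger0_norm ?subr_ge0//.
  have -> : rho = (1 - s) * rho + s * rho by ring.
  by rewrite lerD// ler_wpM2l// subr_ge0.
have sm s : 0 <= s <= 1 -> smooth_at f (x' + s *: (x - x')).
  by move=> /in_ball sr; have [] := H _ (le_trans sr rhor).
have [|c c01] := @line_MVT R E (fun u => L (f u)) x' (x - x') 1 ltr01.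
  by move=> s /sm ?; apply/smooth_at_differentiable/smooth_at_lin.
rewrite scale1r [x' + (x - x')]addrC subrK mul1r diff_linE//;
  last exact/smooth_at_differentiable/sm.
move=> E1.
have -> : (f x - f x' - 'd f p (x - x')) ord0 j =
   L ('d f (x' + c *: (x - x')) (x - x') - 'd f p (x - x')).
  by rewrite (linearB L) -E1 !mxE.
apply: (@le_trans _ _ (`|'d f (x' + c *: (x - x')) (x - x') - 'd f p (x - x')|)).
  rewrite [in leRHS]/Num.Def.normr/= mx_normrE.
  exact: (le_bigmax _ (fun ij => `|('d f (x' + c *: (x - x')) (x - x') - 'd f p (x -
    x')) ij.1 ij.2|) (ord0, j)).
have cr := in_ball _ c01.
have [_ Hc] := H _ (le_trans cr rhor).
by apply: (le_trans (Hc _)); rewrite ler_wpM2r// ler_wpM2l// ltW.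
Qed.

End Quadratic.

(** * Geometric decay and limits *)

Section Geometric.
Context {R : realType}.

Lemma geometric_le0 (q a b : R) : 0 <= q < 1 ->
  (forall k : nat, a <= q ^+ k * b) -> a <= 0.
Proof.
move=> /andP[q0 q1] ab.
have qc : GRing.exp q @ \oo --> (0 : R) by apply: cvg_expr; rewrite ger0_norm.
have qb : (fun k => q ^+ k * b) @ \oo --> (0 : R).
  by rewrite -[0](mul0r b); apply: cvgMl.
rewrite -(cvg_lim _ qb)//; apply: limr_ge; first by apply/cvg_ex; exists 0.
by near=> k; exact: ab.
Unshelve. all: by end_near. Qed.

Lemma geometric_limit n (q A : R) (u : nat -> 'rV[R]_n) : 0 <= q < 1 ->
  (forall k, `|u k.+1 - u k| <= q ^+ k * A) ->
  exists l, forall k, `|l - u k| <= q ^+ k * (A / (1 - q)).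
Proof.
move=> /andP[q0 q1] uq.
have q1' : 0 < 1 - q by rewrite subr_gt0.
have A0 : 0 <= A by have := uq 0%N; rewrite expr0 mul1r; apply: le_trans.
have uD k j : `|u (k + j)%N - u k| <= q ^+ k * (A / (1 - q)).
  (* The induction on j runs on the exact partial sum of the geometric series, which is stronger
     than the bound by its limit. *)
  suff : `|u (k + j)%N - u k| <= q ^+ k * (A / (1 - q)) - q ^+ (k + j) * (A / (1 - q)).
    move=> /le_trans; apply; rewrite gerBl; apply: mulr_ge0; first exact: exprn_ge0.
    by rewrite divr_ge0// ltW.
  elim: j => [|j IH]; first by rewrite addn0 !subrr normr0.
  rewrite addnS; set k' := (k + j)%N in IH *.
  have -> : u k'.+1 - u k = (u k'.+1 - u k') + (u k' - u k) by rewrite addrA subrK.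
  apply: (le_trans (ler_normD _ _)); apply: (le_trans (lerD (uq k') IH)).
  rewrite exprS le_eqVlt; apply/orP; left; apply/eqP; field.
  by rewrite gt_eqF.
have qc : GRing.exp q @ \oo --> (0 : R) by apply: cvg_expr; rewrite ger0_norm.
have qb : (fun k => q ^+ k * (A / (1 - q))) @ \oo --> (0 : R).
  by rewrite -[0](mul0r (A / (1 - q))); apply: cvgMl.
have uc : cvgn u.
  apply/cauchy_cvgP; apply: cauchy_exP => e e0.
  have [N _ /(_ N (leqnn N)) Ne] : \forall k \near \oo, q ^+ k * (A / (1 - q)) < e.
    move/cvgr0_norm_lt: qb => /(_ _ e0); apply: filterS => k.
    by apply: le_lt_trans; exact: ler_norm.
  exists (u N); exists N => // k /= Nk.
  rewrite -ball_normE /= distrC -(subnKC Nk).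
  exact: le_lt_trans (uD _ _) Ne.
exists (limn u) => k.
have dc : (fun j => `|u j - u k|) @ \oo --> `|limn u - u k|.
  by apply: cvg_norm; apply: cvgB => //; exact: cvg_cst.
rewrite -(cvg_lim _ dc)//; apply: limr_le; first by apply/cvg_ex; eexists; exact: dc.
near=> j; rewrite -[j](@subnKC k) ?uD//.
by near: j; exact: nbhs_infty_ge.
Unshelve. all: by end_near. Qed.

End Geometric.

(* A group law read in a chart lc around the unit: lc u * lc v = lc (m u v) near
   the origin, with m (u, v) = u + v up to a quadratic error. *)
Record local_law (R : realType) (n : nat) (G : groupType) (lc : 'rV[R]_n -> G)
  (m : 'rV[R]_n -> 'rV[R]_n -> 'rV[R]_n) (r C : R) : Prop := LocalLaw {
  law_r : 0 < r;
  law_C : 0 < C;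
  law_Cr : C * r <= 1 / 4;
  law_lc0 : lc 0 = 1%g;
  law_m0 : m 0 0 = 0;
  law_M : forall u v, `|u| <= r -> `|v| <= r -> (lc u * lc v)%g = lc (m u v);
  law_inj : forall u v, `|u| <= 4 * r -> `|v| <= 4 * r -> lc u = lc v -> u = v;
  law_m : forall rho u v u' v', rho <= r -> `|u| <= rho -> `|v| <= rho ->
    `|u'| <= rho -> `|v'| <= rho ->
    `|m u v - m u' v' - ((u - u') + (v - v'))| <= C * rho * (`|u - u'| + `|v - v'|)
}.

(** * Local group laws: uniqueness of a doubling curve with given tangent *)

Section LocalLaw.
Context {R : realType} {n : nat} {G : groupType} (lc : 'rV[R]_n -> G)
  (m : 'rV[R]_n -> 'rV[R]_n -> 'rV[R]_n) (r C : R) (H : local_law lc m r C).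
Local Notation E := 'rV[R]_n.
Implicit Types (u v : E) (F : R -> E) (X : E) (d t : R).

Let r0 : 0 < r := law_r H.
Let C0 : 0 < C := law_C H.

(** At radius r the error in [law_m] is at most C r <= 1/4 of the main term, whence 5/4 = 1 +
    1/4. *)
Lemma law_lipschitz u v u' v' : `|u| <= r -> `|v| <= r -> `|u'| <= r -> `|v'| <= r ->
  `|m u v - m u' v'| <= 5 / 4 * (`|u - u'| + `|v - v'|).
Proof.
move=> ur vr u'r v'r; have := law_m H (lexx r) ur vr u'r v'r.
set w := (u - u') + (v - v') => mw.
have -> : m u v - m u' v' = (m u v - m u' v' - w) + w by rewrite subrK.
apply: (le_trans (ler_normD _ _)).
have -> : 5 / 4 * (`|u - u'| + `|v - v'|) =
  1 / 4 * (`|u - u'| + `|v - v'|) + (`|u - u'| + `|v - v'|) by field.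
apply: lerD; last exact: ler_normD.
apply: (le_trans mw); rewrite ler_wpM2r ?addr_ge0//; exact: law_Cr H.
Qed.

Lemma law_near u v rho : rho <= r -> `|u| <= rho -> `|v| <= rho ->
  `|m u v - (u + v)| <= 2 * C * rho ^+ 2.
Proof.
move=> rr ur vr; have rho0 : 0 <= rho by apply: le_trans ur.
have := law_m H rr ur vr; move=> /(_ 0 0);
  rewrite normr0 (law_m0 H) !subr0 => /(_ rho0 rho0).
move=> /le_trans; apply.
have -> : 2 * C * rho ^+ 2 = C * rho * (rho + rho) by ring.
by rewrite ler_wpM2l// ?lerD// mulr_ge0// ltW.
Qed.

Lemma law_norm u v : `|u| <= r -> `|v| <= r -> `|m u v| <= 5 / 4 * (`|u| + `|v|).
Proof.
move=> ur vr; have := law_lipschitz ur vr.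
by move=> /(_ 0 0); rewrite normr0 (law_m0 H) !subr0; apply; exact: ltW.
Qed.

(** The norm is in fact at most 5/2 r; the radius 4 r is the one on which [law_inj] can be applied
    to a product. *)
Lemma law_m_in u v : `|u| <= r -> `|v| <= r -> `|m u v| <= 4 * r.
Proof.
move=> ur vr; apply: (le_trans (law_norm ur vr)).
have : `|u| + `|v| <= r + r by rewrite lerD.
move: r0; lra.
Qed.

Lemma law_mr0 u : `|u| <= r -> m u 0 = u.
Proof.
move=> ur; have z0 : `|0 : E| <= r by rewrite normr0 ltW.
apply: (law_inj H); first exact: law_m_in.
  by apply: (le_trans ur); rewrite ler_peMl ?ltW// ltr1n.
by rewrite -(law_M H)// (law_lc0 H) mulg1.
Qed.

(* The two properties that characterize the curve t |-> exp (t X) in the chart. *)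
Definition doubling d F := forall t, `|t| <= d ->
  `|F t| <= r /\ F t = m (F (t / 2)) (F (t / 2)).
Definition tangent_to d F X := exists2 K, 0 <= K &
  forall t, `|t| <= d -> `|F t - t *: X| <= K * t ^+ 2.

Lemma half_le d t : `|t| <= d -> `|t / 2| <= d.
Proof.
move=> td; rewrite normrM normfV (ger0_norm (_ : 0 <= 2))//.
have := normr_ge0 t; lra.
Qed.

Lemma doubling_unique d F F' X : doubling d F -> doubling d F' ->
  tangent_to d F X -> tangent_to d F' X -> forall t, `|t| <= d -> F t = F' t.
Proof.
move=> dF dF' [K K0 KF] [K' K'0 KF'].
(* One doubling costs 5/4 for each of the two equal factors, and (t/2)^2 gains 1/4: the ratio is 2
   (5/4) (1/4) = 5/8. *)
have step k t : `|t| <= d -> `|F t - F' t| <= (5 / 8) ^+ k * ((K + K') * t ^+ 2).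
  elim: k t => [|k IH] t td.
    have -> : F t - F' t = (F t - t *: X) - (F' t - t *: X).
      by rewrite opprB addrA subrK.
    rewrite expr0 mul1r mulrDl (le_trans (ler_normB _ _))// lerD//; [exact: KF|exact: KF'].
  have [_ ->] := dF t td; have [_ ->] := dF' t td.
  have t2 := half_le td; have [a1 _] := dF _ t2; have [a2 _] := dF' _ t2.
  apply: (le_trans (law_lipschitz a1 a1 a2 a2)).
  have := IH _ t2; rewrite (exprS _ k).
  have -> : 5 / 8 * (5 / 8) ^+ k * ((K + K') * t ^+ 2) =
    5 / 4 * ((5 / 8) ^+ k * ((K + K') * (t / 2) ^+ 2) + (5 / 8) ^+ k * ((K + K') * (t
      / 2) ^+ 2)).
    by field.
  by move=> ?; rewrite ler_pM2l// lerD.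
move=> t td; apply/eqP; rewrite -subr_eq0 -normr_le0.
apply: (@geometric_le0 _ (5 / 8) _ ((K + K') * t ^+ 2)) => [|k]; last exact: step.
by apply/andP; split; lra.
Qed.

Lemma tangent_to_bound d F X : tangent_to d F X -> exists2 B, 0 <= B &
  forall t, `|t| <= d -> `|F t| <= B * `|t|.
Proof.
move=> [K K0 KF]; exists (`|X| + K * `|d|) => [|t td]; first by rewrite addr_ge0// mulr_ge0.
have -> : F t = t *: X + (F t - t *: X) by rewrite addrC subrK.
rewrite (le_trans (ler_normD _ _))// mulrDl normrZ mulrC lerD// (le_trans (KF _ td))//.
rewrite -mulrA ler_wpM2l// -real_normK ?num_real// expr2 ler_wpM2r//.
by rewrite (le_trans td) ?ler_norm.
Qed.

(** m agrees with addition up to second order at the origin, so tangent vectors add and the error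
    stays quadratic in t. *)
Lemma tangent_to_law d F F' X X' :
  (forall t, `|t| <= d -> `|F t| <= r /\ `|F' t| <= r) ->
  tangent_to d F X -> tangent_to d F' X' ->
  tangent_to d (fun t => m (F t) (F' t)) (X + X').
Proof.
move=> Fr TF TF'; have [B B0 FB] := tangent_to_bound TF.
have [B' B'0 FB'] := tangent_to_bound TF'.
case: TF TF' => [K K0 KF] [K' K'0 KF'].
pose D := B + B'.
have D0 : 0 <= D by rewrite addr_ge0.
exists (2 * C * D ^+ 2 + (K + K')).
  by rewrite !addr_ge0// !mulr_ge0 ?exprn_ge0//; apply: ltW.
move=> t td.
have -> : m (F t) (F' t) - t *: (X + X') =
   (m (F t) (F' t) - (F t + F' t)) + ((F t - t *: X) + (F' t - t *: X')).
  by rewrite scalerDr [X in _ = _ + X]addrACA -opprD addrA subrK.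
rewrite mulrDl (le_trans (ler_normD _ _))// lerD//; last first.
  by rewrite mulrDl (le_trans (ler_normD _ _))// lerD//; [exact: KF|exact: KF'].
have [Fr1 Fr2] := Fr t td.
(* [law_near] wants a radius that is at most r, while the conclusion wants one proportional to
   [|t|]; the minimum serves both. *)
have F1 : `|F t| <= Num.min r (D * `|t|).
  rewrite le_min Fr1 /= (le_trans (FB t td))// ler_wpM2r// lerDl//.
have F2 : `|F' t| <= Num.min r (D * `|t|).
  rewrite le_min Fr2 /= (le_trans (FB' t td))// ler_wpM2r// lerDr//.
have mr : Num.min r (D * `|t|) <= r by rewrite ge_min lexx.
apply: (le_trans (law_near mr F1 F2)).
have -> : 2 * C * D ^+ 2 * t ^+ 2 = 2 * C * (D * `|t|) ^+ 2.
  by rewrite -[t ^+ 2]real_normK ?num_real//; ring.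
have C2 : 0 <= 2 * C by rewrite mulr_ge0// ltW.
rewrite ler_wpM2l//.
rewrite lerXn2r ?nnegrE ?mulr_ge0//; last by rewrite ge_min lexx orbT.
by rewrite le_min (ltW r0) mulr_ge0.
Qed.

End LocalLaw.

(** * Existence of a doubling curve with given tangent *)

Section CurveExistence.
Context {R : realType} {n : nat} {G : groupType} (lc : 'rV[R]_n -> G)
  (m : 'rV[R]_n -> 'rV[R]_n -> 'rV[R]_n) (r C : R) (H : local_law lc m r C).
Local Notation E := 'rV[R]_n.
Implicit Types (u v : E) (F : R -> E) (X : E) (d t : R).

Let r0 : 0 < r := law_r H.
Let C0 : 0 < C := law_C H.

(** As long as the iterates stay in the ball of radius r, [lc (square_iter X k t)] is the 2^k-th
    power of [lc] of t X / 2^k. *)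
Fixpoint square_iter X k t : E :=
  if k is k'.+1 then m (square_iter X k' (t / 2)) (square_iter X k' (t / 2))
  else t *: X.

(** The bound r / 8 leaves room for products of several values of F to remain where [law_M] and
    [law_inj] apply. The last clause, uniform continuity, is what later allows approximation by
    multiples of a small step. *)
Lemma law_curve X : exists d F, [/\ 0 < d,
  forall t, `|t| <= d -> `|F t| <= r / 8,
  doubling m r d F, tangent_to d F X &
  forall e, 0 < e -> exists2 h, 0 < h & forall s t, `|s| <= d -> `|t| <= d ->
    `|s - t| <= h -> `|F s - F t| <= e].
Proof.
(* By [law_near], the first squaring moves t X by at most 2 C [|t X / 2|]^2 = K t^2 / 4. *)
pose K := 2 * C * `|X| ^+ 2.
have K0 : 0 <= K by rewrite !mulr_ge0 ?exprn_ge0// ltW.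
have Kt t : 0 <= K * t ^+ 2 by rewrite mulr_ge0 ?sqr_ge0.
(* With this d, both t X and the total correction 3 K t^2 have norm at most r / 16, which together
   give r / 8. *)
pose d := r / 16 / (`|X| + 1).
have X1 : 0 < `|X| + 1 by rewrite ltr_wpDl.
have d0 : 0 < d by rewrite !divr_gt0.
have dX t : `|t| <= d -> `|t| * `|X| <= r / 16.
  rewrite ler_pdivlMr// => /(le_trans _); apply.
  by rewrite ler_wpM2l// lerDl.
have Kd t : `|t| <= d -> 3 * (K * t ^+ 2) <= r / 16.
  move=> /dX tX.
  have -> : 3 * (K * t ^+ 2) = 6 * C * (`|t| * `|X|) ^+ 2.
    by rewrite /K exprMn real_normK ?num_real//; ring.
  apply: (@le_trans _ _ (6 * C * (r / 16) ^+ 2)).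
    have C2 : 0 <= 6 * C by rewrite mulr_ge0// ltW.
    have r16 : 0 <= r / 16 by move: r0; lra.
    by rewrite ler_wpM2l// lerXn2r// nnegrE mulr_ge0.
  have -> : 6 * C * (r / 16) ^+ 2 = 6 / 256 * (C * r) * r by field.
  have := law_Cr H; move: r0; nra.
pose f := square_iter X; pose q : R := 5 / 8.
have q0 k : 0 <= q ^+ k by rewrite exprn_ge0// /q; lra.
(* The factor 3 rounds up 1 / (1 - q) = 8/3, so 3 (1 - q^k) dominates the sum of the first k powers
   of q. *)
have fb k t : `|t| <= d -> `|f k t - t *: X| <= 3 * (1 - q ^+ k) * (K * t ^+ 2) ->
    `|f k t| <= r / 8.
  move=> td fX.
  have -> : f k t = t *: X + (f k t - t *: X) by rewrite addrC subrK.
  rewrite (le_trans (ler_normD _ _))// normrZ.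
  have -> : r / 8 = r / 16 + r / 16 by field.
  rewrite lerD ?dX// (le_trans fX)// (le_trans _ (Kd _ td))//.
  by rewrite -mulrA ler_wpM2l// ler_piMl// gerBl.
have r8 u : `|u| <= r / 8 -> `|u| <= r.
  by move=> /le_trans; apply; move: r0; lra.
(* The two bounds are proved together: closeness to t X keeps the iterates where m is Lipschitz, and
   the decay of the increments preserves this closeness. *)
have P k : forall t, `|t| <= d -> `|f k t - t *: X| <= 3 * (1 - q ^+ k) * (K * t ^+ 2) /\
    `|f k.+1 t - f k t| <= q ^+ k * (K * t ^+ 2).
  elim: k => [|k IH] t td.
    rewrite expr0 !subrr mulr0 mul0r mul1r normr0; split=> //.
    rewrite /f /=.
    have -> : t *: X = (t / 2) *: X + (t / 2) *: X by rewrite -scalerDl -splitr.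
    have tr : `|(t / 2) *: X| <= r.
      by apply: r8; rewrite normrZ (le_trans (dX _ (half_le td)))//; move: r0; lra.
    apply: (le_trans (law_near H tr (lexx _) (lexx _))).
    rewrite normrZ normrM exprMn exprMn !real_normK ?num_real//.
    have -> : 2 * C * (t ^+ 2 * 2^-1 ^+ 2 * `|X| ^+ 2) = (1 / 4) * (K * t ^+ 2).
      by rewrite /K; field.
    by rewrite ler_piMl//; lra.
  have [IH1 IH2] := IH t td.
  have S1 s : `|s| <= d -> `|f k.+1 s - s *: X| <= 3 * (1 - q ^+ k.+1) * (K * s ^+ 2).
    move=> /IH[J1 J2].
    have -> : f k.+1 s - s *: X = (f k.+1 s - f k s) + (f k s - s *: X) by rewrite
      addrA subrK.
    rewrite (le_trans (ler_normD _ _))// (le_trans (lerD J2 J1))//.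
    rewrite -mulrDl ler_wpM2r// exprS.
    have := q0 k; set z := q ^+ k; rewrite /q; lra.
  split; first exact: S1.
  have t2 := half_le td; have [J1 J2] := IH _ t2.
  have b1 := r8 _ (fb _ _ t2 J1); have b2 := r8 _ (fb _ _ t2 (S1 _ t2)).
  rewrite -[f k.+2 t]/(m (f k.+1 (t / 2)) (f k.+1 (t / 2))).
  rewrite -[f k.+1 t]/(m (f k (t / 2)) (f k (t / 2))).
  apply: (le_trans (law_lipschitz H b2 b2 b1 b1)).
  have -> : q ^+ k.+1 * (K * t ^+ 2) = 5 / 4 *
     (q ^+ k * (K * (t / 2) ^+ 2) + q ^+ k * (K * (t / 2) ^+ 2)).
    by rewrite exprS; set z := q ^+ k; rewrite /q; field.
  by rewrite ler_pM2l ?lerD//; lra.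
have q01 : 0 <= q < 1 by rewrite /q; apply/andP; split; lra.
have fr k t : `|t| <= d -> `|f k t| <= r / 8.
  by move=> td; have [J _] := P k t td; exact: fb J.
(* Outside [|t| <= d] the value is 0, which no later statement looks at. *)
have /choice[F FP] : forall t, exists y, `|t| <= d ->
    forall k, `|y - f k t| <= q ^+ k * (K * t ^+ 2 / (1 - q)).
  move=> t; have [td|nd] := boolP (`|t| <= d); last by exists 0.
  have [|l lP] := @geometric_limit R n q (K * t ^+ 2) (f ^~ t) q01.
    by move=> k; have [_] := P k t td.
  by exists l.
have Fle (a : R) (t : R) (B : R) : `|t| <= d ->
    (forall k, a <= B + q ^+ k * (K * t ^+ 2 / (1 - q))) -> a <= B.
  move=> td aB; rewrite -subr_le0.
  by apply: (geometric_le0 q01 (b := K * t ^+ 2 / (1 - q))) => k; rewrite lerBlDl.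
exists d, F; split=> //.
- move=> t td; apply: (Fle _ t) => // k.
  have -> : F t = f k t + (F t - f k t) by rewrite addrC subrK.
  by rewrite (le_trans (ler_normD _ _))// lerD ?fr//; exact: FP.
- have Fr t : `|t| <= d -> `|F t| <= r.
    move=> td; apply: (Fle _ t) => // k.
    have -> : F t = f k t + (F t - f k t) by rewrite addrC subrK.
    by rewrite (le_trans (ler_normD _ _))// lerD ?(r8 _ (fr _ _ _))//; exact: FP.
  move=> t td; split; first exact: Fr.
  apply/eqP; rewrite -subr_eq0 -normr_le0.
  (* With A = K t^2 / (1 - q), the two errors are 5/8 q^k A each, the second being 2 (5/4) q^k A /
     4; their sum is rounded up to 2 q^k A. *)
  apply: (geometric_le0 q01 (b := 2 * (K * t ^+ 2 / (1 - q)))) => k.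
  have t2 := half_le td.
  have -> : F t - m (F (t / 2)) (F (t / 2)) =
     (F t - f k.+1 t) + (f k.+1 t - m (F (t / 2)) (F (t / 2))) by rewrite addrA subrK.
  apply: (le_trans (ler_normD _ _)).
  apply: (le_trans (lerD (FP _ td k.+1) (law_lipschitz H (r8 _ (fr _ _ t2)) (r8 _ (fr
    _ _ t2)) (Fr _ t2) (Fr _ t2)))).
  rewrite distrC -/(f k (t / 2)).
  set A := K * t ^+ 2 / (1 - q).
  have A0 : 0 <= A.
    by rewrite divr_ge0// subr_ge0 ltW//; case/andP: q01.
  have := FP _ t2 k.
  have -> : K * (t / 2) ^+ 2 / (1 - q) = A / 4.
    by rewrite /A; field; rewrite gt_eqF// subr_gt0; case/andP: q01.
  rewrite exprS; set z := q ^+ k * A.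
  have z0 : 0 <= z by rewrite mulr_ge0.
  have -> : q ^+ k * (A / 4) = z / 4 by rewrite /z; field.
  have -> : q * q ^+ k * A = q * z by rewrite /z; ring.
  have -> : q ^+ k * (2 * A) = 2 * z by rewrite /z; ring.
  rewrite /q; lra.
- exists (3 * K); first by rewrite mulr_ge0.
  move=> t td; apply: (Fle _ t) => // k.
  have -> : F t - t *: X = (f k t - t *: X) + (F t - f k t).
    by rewrite [RHS]addrC addrA subrK.
  rewrite (le_trans (ler_normD _ _))// lerD//; last exact: FP.
  have [J _] := P k t td; apply: (le_trans J).
  have -> : 3 * K * t ^+ 2 = 3 * (K * t ^+ 2) by ring.
  by rewrite -mulrA ler_wpM2l// ler_piMl// gerBl.
- move=> e e0.
  (* The Lipschitz constants of the iterates grow like (5/4)^k, so only uniform continuity passes to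
     the uniform limit. *)
  have fL k : exists2 L, 0 < L & forall s t, `|s| <= d -> `|t| <= d ->
      `|f k s - f k t| <= L * `|s - t|.
    elim: k => [|k [L L0 IH]].
      exists (`|X| + 1) => // s t _ _; rewrite /f /= -scalerBl normrZ mulrC.
      by rewrite ler_wpM2r// lerDl.
    exists (5 / 4 * L); first by rewrite mulr_gt0.
    move=> s t sd td; have s2 := half_le sd; have t2 := half_le td.
    rewrite /= -/(f k _) -/(f k _).
    have fs := r8 _ (fr k _ s2); have ft := r8 _ (fr k _ t2).
    apply: (le_trans (law_lipschitz H fs fs ft ft)).
    rewrite -[leRHS]mulrA ler_pM2l; last by lra.
    have := IH _ _ s2 t2; rewrite -mulrBl normrM normfV (ger0_norm (_ : 0 <= 2))//.
    lra.
  have A0 : 0 <= K * d ^+ 2 / (1 - q).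
    by rewrite divr_ge0// subr_ge0 ltW//; case/andP: q01.
  have [k qk] : exists k : nat, q ^+ k * (K * d ^+ 2 / (1 - q)) <= e / 3.
    apply: contrapT => /forallNP nk.
    suff : e / 3 <= 0 by move: e0; lra.
    apply: (geometric_le0 q01 (b := K * d ^+ 2 / (1 - q))) => k.
    by have /negP := nk k; rewrite -ltNge => /ltW.
  have Fk t : `|t| <= d -> `|F t - f k t| <= e / 3.
    move=> td; apply: (le_trans (FP _ td k)); apply: le_trans qk.
    rewrite ler_wpM2l// ler_wpM2r//.
      by rewrite invr_ge0 subr_ge0 ltW//; case/andP: q01.
    by rewrite ler_wpM2l// -real_normK ?num_real// lerXn2r ?nnegrE// ltW.
  have [L L0 LP] := fL k.
  exists (e / 3 / L); first by rewrite !divr_gt0.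
  move=> s t sd td; rewrite ler_pdivlMr// => st.
  have -> : F s - F t = (F s - f k s) + (f k s - f k t) - (F t - f k t).
    by rewrite addrA subrK opprB addrA subrK.
  have -> : e = e / 3 + e / 3 + e / 3 by field.
  rewrite (le_trans (ler_normB _ _))// lerD ?Fk// (le_trans (ler_normD _ _))// lerD ?Fk//.
  by rewrite (le_trans (LP _ _ sd td))// mulrC.
Qed.

End CurveExistence.

(** * Extension of a local homomorphism to the whole real line *)

Section GlobalHom.
Context {R : realType} {G : groupType}.
Implicit Types (g gamma : R -> G) (d t : R).

Lemma hom_half_pow gamma k t : (forall s t, gamma (s + t) = (gamma s * gamma t)%g) ->
  gamma t = (gamma (t / 2 ^+ k)%R ^+ (2 ^ k)%N)%g.
Proof.
move=> gD; elim: k t => [|k IH] t; first by rewrite expr0 divr1 expn0 expg1.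
rewrite [LHS]IH expnS expgnA expg2 -gD.
by congr ((gamma _) ^+ _)%g; rewrite exprS; field; rewrite expf_neq0.
Qed.

Lemma exists_half_pow d t : 0 < d -> exists k : nat, `|t / 2 ^+ k| <= d.
Proof.
move=> d0; exists (Num.truncn (`|t| / d)); set k := Num.truncn _.
have tk : `|t| / d <= 2 ^+ k.
  rewrite (le_trans (ltW (truncnS_gt _)))// -/k -natrX ler_nat.
  exact: ltn_expl.
rewrite normrM normfV (ger0_norm (_ : 0 <= 2 ^+ k))// ler_pdivrMr ?exprn_gt0//.
by rewrite mulrC -ler_pdivrMr.
Qed.

(** The value at t is g (t / 2^k) ^ (2^k) for any k that brings t / 2^k into the interval; local
    additivity makes it independent of k. *)
Lemma local_hom_extend g d : 0 < d ->
  (forall s t, `|s| <= d -> `|t| <= d -> g (s + t) = (g s * g t)%g) ->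
  exists gamma, (forall s t, gamma (s + t) = (gamma s * gamma t)%g) /\
    forall t, `|t| <= d -> gamma t = g t.
Proof.
move=> d0 gD.
pose h k t : G := (g (t / 2 ^+ k)%R ^+ (2 ^ k)%N)%g.
have half t k : `|t / 2 ^+ k| <= d -> `|t / 2 ^+ k.+1| <= d.
  have -> : t / 2 ^+ k.+1 = t / 2 ^+ k / 2 by rewrite exprS; field; rewrite expf_neq0.
  exact: half_le.
have hS k t : `|t / 2 ^+ k| <= d -> h k.+1 t = h k t.
  move=> tk; have tk' := half _ _ tk; rewrite /h expnS expgnA expg2 -gD//.
  by congr ((g _) ^+ _)%g; rewrite exprS; field; rewrite expf_neq0.
have hk k j t : `|t / 2 ^+ k| <= d -> `|t / 2 ^+ (k + j)| <= d /\ h (k + j)%N t = h k t.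
  move=> tk; elim: j => [|j [IH1 IH2]]; first by rewrite addn0.
  by rewrite addnS hS// half.
have /choice[k kP] : forall t, exists k : nat, `|t / 2 ^+ k| <= d.
  by move=> t; exact: exists_half_pow.
exists (fun t => h (k t) t); split=> [s t|t td]; last first.
  have [|_] := hk 0%N (k t) t; first by rewrite expr0 divr1.
  by rewrite add0n => ->; rewrite /h expr0 divr1 expn0 expg1.
(* K exceeds the exponents chosen for s, t and s + t, so the three values can be computed at the
   same scale. *)
pose K := (k s + k t + k (s + t)%R)%N.
have [sK hs] := hk _ (k t + k (s + t)%R)%N _ (kP s).
have [tK ht] := hk _ (k s + k (s + t)%R)%N _ (kP t).
have [stK hst] := hk _ (k s + k t)%N _ (kP (s + t)).
rewrite -hs -ht -hst.
have -> : (k t + (k s + k (s + t)%R) = K)%N by rewrite /K addnA (addnC (k t)).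
have -> : (k (s + t)%R + (k s + k t) = K)%N by rewrite /K addnC.
have E1 : (k s + (k t + k (s + t)%R) = K)%N by rewrite /K addnA.
have E2 : (k t + (k s + k (s + t)%R) = K)%N by rewrite /K addnA (addnC (k t)).
rewrite E1 in sK *; rewrite E2 in tK.
(* The power of the product splits because the factors commute: both orders give g of the same
   sum. *)
rewrite /h mulrDl gD// expgMn//.
by rewrite /commute -!gD// addrC.
Qed.

End GlobalHom.

(** * From doubling to additivity *)

Section CurveHomomorphism.
Context {R : realType} {n : nat} {G : groupType} (lc : 'rV[R]_n -> G)
  (m : 'rV[R]_n -> 'rV[R]_n -> 'rV[R]_n) (r C : R) (H : local_law lc m r C).
Local Notation E := 'rV[R]_n.
Implicit Types (u v : E) (F : R -> E) (X : E) (d t : R).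

Let r0 : 0 < r := law_r H.

Lemma doubling_scale d d' (c : R) F : `|c| * d' <= d -> doubling m r d F ->
  doubling m r d' (fun t => F (c * t)).
Proof.
move=> cd dF t td.
have ct : `|c * t| <= d by rewrite normrM (le_trans _ cd)// ler_wpM2l.
by have [Fr E1] := dF _ ct; split=> //; rewrite {1}E1 -!mulrA.
Qed.

Lemma tangent_to_scale d d' (c : R) F X : `|c| * d' <= d -> tangent_to d F X ->
  tangent_to d' (fun t => F (c * t)) (c *: X).
Proof.
move=> cd [K K0 KF]; exists (K * c ^+ 2); first by rewrite mulr_ge0 ?sqr_ge0.
move=> t td.
have ct : `|c * t| <= d by rewrite normrM (le_trans _ cd)// ler_wpM2l.
by rewrite scalerA [t * c]mulrC (le_trans (KF _ ct))// exprMn mulrA.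
Qed.

Lemma doubling_lc d F t : doubling m r d F -> `|t| <= d ->
  lc (F t) = (lc (F (t / 2)%R) * lc (F (t / 2)%R))%g.
Proof.
move=> dF td; have [_ E1] := dF _ td; have [Fr _] := dF _ (half_le td).
by rewrite {1}E1 (law_M H).
Qed.

Lemma doubling_of_lc d F : (forall t, `|t| <= d -> `|F t| <= r) ->
  (forall t, `|t| <= d -> lc (F t) = (lc (F (t / 2)%R) * lc (F (t / 2)%R))%g) ->
  doubling m r d F.
Proof.
move=> Fr FF t td; have Ft := Fr _ (half_le td); split; first exact: Fr.
apply: (law_inj H).
- by rewrite (le_trans (Fr _ td))// ler_peMl ?ltW// ltr1n.
- exact: (law_m_in H).
- by rewrite FF// (law_M H).
Qed.

Section Curve.
Context (X : E) (d : R) (F : R -> E) (d0 : 0 < d)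
  (Fr8 : forall t, `|t| <= d -> `|F t| <= r / 8)
  (dF : doubling m r d F) (tF : tangent_to d F X)
  (cF : forall e, 0 < e -> exists2 h, 0 < h & forall s t, `|s| <= d -> `|t| <= d ->
     `|s - t| <= h -> `|F s - F t| <= e).

Let Fr t : `|t| <= d -> `|F t| <= r.
Proof. by move=> td; have [] := dF td. Qed.

Let law8 u v : `|u| <= r / 8 -> `|v| <= r / 8 -> `|m u v| <= 5 / 16 * r.
Proof.
move=> ur vr; have := law_norm H (u := u) (v := v).
have r8 : r / 8 <= r by move: r0; lra.
move=> /(_ (le_trans ur r8) (le_trans vr r8)) /le_trans; apply; lra.
Qed.

Lemma curve_lc0 : lc (F 0) = 1%g.
Proof.
have [K _ KF] := tF; have := KF 0; rewrite normr0 expr0n/= mulr0 scale0r subr0.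
by move=> /(_ (ltW d0)); rewrite normr_le0 => /eqP ->; exact: law_lc0 H.
Qed.

(** In the group, F ((a + 1) s) F (s) is a power of F (s), so this product again satisfies the
    doubling relation. Its tangent is (a + 2) X, as for s |-> F ((a + 2) s), and [doubling_unique]
    identifies the two. *)
Lemma curve_mulSn a t : `|a.+1%:R * t| <= d ->
  lc (F (a.+1%:R * t)) = (lc (F t) ^+ a.+1)%g.
Proof.
elim: a t => [|a IH] t td; first by rewrite mul1r expg1.
have a0 k : 0 < k.+1%:R :> R by rewrite ltr0n.
(* On this smaller interval all multiples up to a + 2 stay in the domain of F. *)
pose d' := d / a.+2%:R.
have td' : `|t| <= d'.
  by rewrite ler_pdivlMr ?a0// mulrC -[a.+2%:R]ger0_norm// -normrM.
have d1 : `|1 : R| * d' <= d.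
  by rewrite normr1 mul1r /d' ler_pdivrMr ?a0// ler_peMr ?(ltW d0)// ler1n.
have d2 : `|a.+1%:R : R| * d' <= d.
  by rewrite ger0_norm// mulrA ler_pdivrMr ?a0// mulrC ler_wpM2l ?(ltW d0)// ler_nat.
have d3 : `|a.+2%:R : R| * d' <= d.
  by rewrite ger0_norm// /d' mulrC divfK// gt_eqF.
have in1 (s : R) : `|s| <= d' -> `|s| <= d.
  by move=> sd; rewrite (le_trans sd)//; move: d1; rewrite normr1 mul1r.
have in2 (s : R) : `|s| <= d' -> `|a.+1%:R * s| <= d.
  by move=> sd; rewrite normrM (le_trans _ d2)// ler_wpM2l.
pose b s := m (F (a.+1%:R * s)) (F s).
have lcb s : `|s| <= d' -> lc (b s) = (lc (F s) ^+ a.+2)%g.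
  move=> sd; have s1 := in1 _ sd; have s2 := in2 _ sd.
  rewrite /b -(law_M H); [|exact: Fr..].
  by rewrite (IH _ s2) [RHS]expgSr.
have bd : doubling m r d' b.
  apply: doubling_of_lc => s sd.
    rewrite (le_trans (law8 (Fr8 (in2 _ sd)) (Fr8 (in1 _ sd))))//.
    by move: r0; lra.
  have s2 := half_le sd; rewrite !lcb// (doubling_lc dF (in1 _ sd)).
  by rewrite expgMn.
have bt : tangent_to d' b (a.+2%:R *: X).
  have -> : a.+2%:R *: X = a.+1%:R *: X + X by rewrite -{3}[X]scale1r -scalerDl natr1.
  apply: (tangent_to_law H); first by move=> s sd; split; apply: Fr;
    [exact: in2|exact: in1].
    exact: tangent_to_scale tF.
  have [K K0 KF] := tF; exists K => // s sd; exact/KF/in1.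
rewrite -lcb//; congr lc.
by rewrite -(doubling_unique H bd (doubling_scale d3 dF) bt (tangent_to_scale d3 tF) td').
Qed.

Lemma curve_muln a t : `|a%:R * t| <= d -> lc (F (a%:R * t)) = (lc (F t) ^+ a)%g.
Proof.
case: a => [|a]; last exact: curve_mulSn.
by rewrite mul0r curve_lc0 expg0.
Qed.

(* With w s = m (F s) (F (- s)), associativity gives
   w s = m (m (F (s / 2)) (w (s / 2))) (F (- s / 2)), whence
   `|w s| <= (1 + (5 / 4) ^ 2) `|w (s / 2)|, and 1 + (5 / 4) ^ 2 < 4. *)
Lemma curve_opp t : `|t| <= d -> lc (F (- t)) = (lc (F t))^-1%g.
Proof.
move=> td; have nd (s : R) : `|s| <= d -> `|- s| <= d by rewrite normrN.
(* F s and F (- s) are not yet known to commute, so w is not known to satisfy the doubling relation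
   and [doubling_unique] does not apply. Its tangent X - X vanishes, so w is quadratically small. *)
pose w s := m (F s) (F (- s)).
have d1 : `|-1 : R| * d <= d by rewrite normrN1 mul1r.
have [K K0 KF] : tangent_to d w (X + -1 *: X).
  apply: (tangent_to_law H) => //; first by move=> s sd; rewrite !Fr// nd.
  have [K K0 KF] := tangent_to_scale d1 tF; exists K => // s sd.
  by have := KF s sd; rewrite mulN1r.
rewrite scaleN1r subrr in KF.
have wr s : `|s| <= d -> `|w s| <= 5 / 16 * r.
  by move=> sd; apply: law8; apply: Fr8 => //; exact: nd.
have ws s : `|s| <= d -> `|w s| <= 41 / 16 * `|w (s / 2)|.
  move=> sd; have s2 := half_le sd.
  set a := F (s / 2); set b := F (- (s / 2)); set w' := w (s / 2).
  have ar : `|a| <= r / 8 by exact: Fr8.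
  have br : `|b| <= r / 8 by apply/Fr8/nd.
  have wr' : `|w'| <= 5 / 16 * r by exact: wr.
  have ar1 : `|a| <= r by move: r0; lra.
  have br1 : `|b| <= r by move: r0; lra.
  have wr1 : `|w'| <= r by move: r0; lra.
  have awr : `|m a w'| <= r.
    by apply: (le_trans (law_norm H ar1 wr1)); move: r0; lra.
  have E1 : w s = m (m a w') b.
    apply: (law_inj H); first by rewrite (le_trans (wr _ sd))//; move: r0; lra.
      exact: (law_m_in H).
    rewrite -!(law_M H)//; [|exact: Fr|exact/Fr/nd].
    rewrite (doubling_lc dF sd) (doubling_lc dF (nd _ sd)) mulNr -/a -/b.
    by rewrite !mulgA.
  have E2 : w' = m a b by [].
  have z0 : `|0 : E| <= r by rewrite normr0 ltW.
  have -> : w s = (m (m a w') b - m a b) + w' by rewrite E1 E2 subrK.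
  apply: (le_trans (ler_normD _ _)).
  have L1 := law_lipschitz H awr br1 ar1 br1.
  have := law_lipschitz H ar1 wr1 ar1 z0; rewrite (law_mr0 H)// => L2.
  move: L1 L2; rewrite !subrr !normr0 addr0 add0r subr0; lra.
have w0 : w t = 0.
  apply/eqP; rewrite -normr_le0.
  (* Here 41/16 = 1 + (5/4)^2, and the quadratic bound on w contributes the factor 1/4. *)
  apply: (@geometric_le0 _ (41 / 64) _ (K * t ^+ 2)) => [|k].
    by apply/andP; split; lra.
  elim: k t td => [|k IH] t td.
    by rewrite expr0 mul1r; have := KF _ td; rewrite scaler0 subr0.
  apply: (le_trans (ws _ td)); have := IH _ (half_le td).
  have -> : (41 / 64) ^+ k.+1 * (K * t ^+ 2) =
    41 / 16 * ((41 / 64) ^+ k * (K * (t / 2) ^+ 2)) by rewrite exprS; field.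
  by move=> ?; rewrite ler_pM2l//; lra.
have : (lc (F t) * lc (F (- t)))%g = 1%g.
  by rewrite (law_M H) ?Fr ?nd// -/(w t) w0; exact: law_lc0 H.
by move=> /mulg1_eq.
Qed.

(* s and t are approximated by integer multiples of a common step tau, for which
   both sides are powers of lc (F tau). *)
Lemma curve_add_ge0 s t : 0 <= s -> 0 <= t -> s + t <= d ->
  lc (F (s + t)) = (lc (F s) * lc (F t))%g.
Proof.
move=> s0 t0 std.
have in1 (u : R) : 0 <= u -> u <= s + t -> `|u| <= d.
  by move=> u0 ust; rewrite ger0_norm// (le_trans ust).
have sd : `|s| <= d by apply: in1 => //; rewrite lerDl.
have td : `|t| <= d by apply: in1 => //; rewrite lerDr.
have std' : `|s + t| <= d by apply: in1 => //; rewrite addr_ge0.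
rewrite (law_M H) ?Fr//; congr lc.
apply/eqP; rewrite -subr_eq0 -normr_le0; apply/ler_addgt0Pl => e e0; rewrite addr0.
(* The final error is e/4 + (5/4) (e/4 + e/4) = 7 e / 8. *)
have e'0 : 0 < e / 4 by rewrite divr_gt0.
have [h h0 hP] := cF e'0.
(* The step satisfies 2 tau <= h because rounding s and t separately displaces s + t by up to 2
   tau. *)
pose N := Num.truncn (2 * d / h); pose tau := d / N.+1%:R.
have N0 : 0 < N.+1%:R :> R by rewrite ltr0n.
have tau0 : 0 < tau by rewrite divr_gt0.
have tauh : 2 * tau <= h.
  rewrite mulrA ler_pdivrMr// [h * _]mulrC -ler_pdivrMr// ltW//.
  exact: truncnS_gt.
pose a := Num.truncn (s / tau); pose b := Num.truncn (t / tau).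
have trn (u : R) : 0 <= u -> let k := Num.truncn (u / tau) in
    0 <= k%:R * tau <= u /\ u - k%:R * tau <= tau.
  move=> u0 k; have /andP[k1 k2] : k%:R <= u / tau < k.+1%:R.
    by apply: truncn_itv; rewrite divr_ge0// ltW.
  split; first by rewrite mulr_ge0 ?(ltW tau0)//= -ler_pdivlMr.
  rewrite lerBlDr; move: k2; rewrite ltr_pdivrMr// => /ltW /le_trans; apply.
  by rewrite -natr1 mulrDl mul1r addrC.
have [/andP[a1 a2] a3] := trn _ s0; have [/andP[b1 b2] b3] := trn _ t0.
rewrite -/a in a1 a2 a3; rewrite -/b in b1 b2 b3.
have ad : `|a%:R * tau| <= d by apply: in1 => //; rewrite (le_trans a2)// lerDl.
have bd : `|b%:R * tau| <= d by apply: in1 => //; rewrite (le_trans b2)// lerDr.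
have abd : `|(a + b)%:R * tau| <= d.
  by rewrite natrD mulrDl; apply: in1; [rewrite addr_ge0|rewrite lerD].
have Fab : F ((a + b)%:R * tau) = m (F (a%:R * tau)) (F (b%:R * tau)).
  apply: (law_inj H); first by rewrite (le_trans (Fr abd))// ler_peMl ?ltW// ltr1n.
    by apply: (law_m_in H); exact: Fr.
  by rewrite -(law_M H) ?Fr// !curve_muln// expgnDr.
have D1 : `|F (s + t) - F ((a + b)%:R * tau)| <= e / 4.
  apply: hP => //; rewrite natrD mulrDl ger0_norm.
    by move: a3 b3 tauh; lra.
  by move: a2 b2; lra.
have D2 : `|F (a%:R * tau) - F s| <= e / 4.
  apply: hP => //; rewrite distrC ger0_norm; move: a2 a3 tauh tau0; lra.
have D3 : `|F (b%:R * tau) - F t| <= e / 4.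
  apply: hP => //; rewrite distrC ger0_norm; move: b2 b3 tauh tau0; lra.
have -> : F (s + t) - m (F s) (F t) = (F (s + t) - F ((a + b)%:R * tau)) +
    (m (F (a%:R * tau)) (F (b%:R * tau)) - m (F s) (F t)).
  by rewrite Fab addrA subrK.
apply: (le_trans (ler_normD _ _)).
have := law_lipschitz H (Fr ad) (Fr bd) (Fr sd) (Fr td).
by move: D1 D2 D3; lra.
Qed.

(** Signs are removed with [curve_opp]; for opposite signs, the identity is rearranged into a sum of
    nonnegative arguments. The bound d / 2 keeps all these sums within d. *)
Lemma curve_add s t : `|s| <= d / 2 -> `|t| <= d / 2 ->
  lc (F (s + t)) = (lc (F s) * lc (F t))%g.
Proof.
have posn (u : R) : exists v : R, [/\ 0 <= v, `|u| = v & u = v \/ u = - v].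
  exists `|u|; split => //.
  by have [u0|u0] := leP 0 u; [left; rewrite ger0_norm|right; rewrite ltr0_norm// opprK].
have add0 (u v : R) : 0 <= u -> 0 <= v -> u <= d / 2 -> v <= d / 2 ->
    lc (F (u + v)) = (lc (F u) * lc (F v))%g.
  by move=> u0 v0 ud vd; apply: curve_add_ge0 => //; lra.
have hd (u : R) : u <= d / 2 -> u <= d by move: d0; lra.
have oppd (u : R) : 0 <= u -> u <= d -> lc (F (- u)) = (lc (F u))^-1%g.
  by move=> u0 ud; apply: curve_opp; rewrite ger0_norm.
have comm (u v : R) : 0 <= u -> 0 <= v -> u <= d / 2 -> v <= d / 2 ->
    commute (lc (F u)) (lc (F v)).
  by move=> *; rewrite /commute -!add0// addrC.
have sub (u v : R) : 0 <= u -> 0 <= v -> u <= d / 2 -> v <= d / 2 ->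
    lc (F (u - v)) = (lc (F u) * (lc (F v))^-1)%g.
  move=> u0 v0 ud vd; have [vu|uv] := leP v u.
    apply: (@mulIg _ (lc (F v))); rewrite mulgVK -add0 ?subrK ?subr_ge0//.
    by rewrite lerBlDr (le_trans ud)// lerDl.
  have uv0 : 0 <= v - u by rewrite subr_ge0 ltW.
  have uvd : v - u <= d / 2 by rewrite lerBlDr (le_trans vd)// lerDl.
  rewrite -opprB oppd ?hd//; apply: invg_inj; rewrite invgK invgM invgK.
  by apply: (@mulIg _ (lc (F u))); rewrite mulgVK -add0// subrK.
have [u [u0 -> su]] := posn s; have [v [v0 -> tv]] := posn t => ud vd.
case: su tv => -> [] ->.
- exact: add0.
- by rewrite sub// oppd// hd.
- by rewrite addrC sub// oppd ?hd//; exact/commuteV/comm.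
- rewrite -opprD (oppd (u + v)) ?addr_ge0//; last by lra.
  by rewrite addrC add0// invgM !oppd ?hd.
Qed.

End Curve.
End CurveHomomorphism.

Section LocalOneParam.
Context {R : realType} {n : nat} {G : groupType} (lc : 'rV[R]_n -> G)
  (m : 'rV[R]_n -> 'rV[R]_n -> 'rV[R]_n) (r C : R) (H : local_law lc m r C).

Lemma law_one_param (X : 'rV[R]_n) : exists gamma d F, [/\ 0 < d,
  forall s t, gamma (s + t) = (gamma s * gamma t)%g,
  forall t, `|t| <= d -> gamma t = lc (F t) /\ `|F t| <= r &
  tangent_to d F X].
Proof.
have [d [F [d0 F8 dF tF cF]]] := law_curve H X.
have d2 : 0 < d / 2 by rewrite divr_gt0.
have dd (t : R) : `|t| <= d / 2 -> `|t| <= d by move: d0; lra.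
have [gamma [gD gE]] := local_hom_extend d2 (curve_add H d0 F8 dF tF cF).
exists gamma, (d / 2), F; split=> // [t td|].
  by rewrite gE//; have [] := dF t (dd _ td).
by have [K K0 KF] := tF; exists K => // t /dd; exact: KF.
Qed.

(** Near 0, a homomorphism is a doubling curve, so the tangent determines it there; a global value
    is a 2^k-th power of a value near 0. *)
Lemma law_one_param_unique (X : 'rV[R]_n) (gamma1 gamma2 : R -> G) d F1 F2 : 0 < d ->
  (forall s t, gamma1 (s + t) = (gamma1 s * gamma1 t)%g) ->
  (forall s t, gamma2 (s + t) = (gamma2 s * gamma2 t)%g) ->
  (forall t, `|t| <= d -> gamma1 t = lc (F1 t) /\ `|F1 t| <= r) ->
  (forall t, `|t| <= d -> gamma2 t = lc (F2 t) /\ `|F2 t| <= r) ->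
  tangent_to d F1 X -> tangent_to d F2 X -> gamma1 = gamma2.
Proof.
move=> d0 g1D g2D g1F g2F tF1 tF2.
have dbl gamma F : (forall s t, gamma (s + t) = (gamma s * gamma t)%g) ->
    (forall t, `|t| <= d -> gamma t = lc (F t) /\ `|F t| <= r) -> doubling m r d F.
  move=> gD gF; apply: (doubling_of_lc H) => [t /gF[]//|t td].
  have [<- _] := gF _ td; have [<- _] := gF _ (half_le td).
  by rewrite -gD -splitr.
have FF := doubling_unique H (dbl _ _ g1D g1F) (dbl _ _ g2D g2F) tF1 tF2.
apply/funext => t; have [k tk] := exists_half_pow t d0.
rewrite (hom_half_pow k t g1D) (hom_half_pow k t g2D).
by have [-> _] := g1F _ tk; have [-> _] := g2F _ tk; rewrite FF.
Qed.

End LocalOneParam.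

(** The chart-wise definitions of smoothness use image sets whose openness would need proof; being a
    neighbourhood of p is enough. *)
Lemma smooth_on_near (R : realType) (E F : normedModType R) (U : set E)
  (f : E -> F) p : smooth_on U f -> nbhs p U -> smooth_at f p.
Proof.
move=> fU; apply: filterS => u Uu k.
by apply: Ck_sub (fU k) => _ ->.
Qed.

Lemma smooth_at_shift (R : realType) (E F : normedModType R) (cE : coords E)
  (f : E -> F) a p : smooth_at f (p + a) -> smooth_at (fun u => f (u + a)) p.
Proof.
apply: (smooth_at_comp cE (f := fun u => u + a)).
by apply: smooth_atD; [exact: smooth_at_id|exact: smooth_at_cst].
Qed.

(** * Charts, and the multiplication of G around the unit *)

Section Charts.
Context {R : realType} {E : normedModType R} {M : topologicalType}.
Implicit Types (s : chart E M) (p : M).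

Lemma chartK s p : cdom s p -> cinv s (cmap s p) = p.
Proof. by move=> sp; apply: cmapK; rewrite inE. Qed.

Lemma near_cdom s p : cdom s p -> \forall q \near p, cdom s q.
Proof. by move=> sp; apply: open_nbhs_nbhs; split => //; exact: cdom_open. Qed.

Lemma near_cinv s p : cdom s p ->
  \forall u \near cmap s p, cdom s (cinv s u) /\ cmap s (cinv s u) = u.
Proof.
move=> sp; have : nbhs (cmap s p) (cmap s @` cdom s).
  by apply: open_nbhs_nbhs; split; [exact: cimg_open|exists p].
by apply: filterS => _ [q sq <-]; rewrite chartK.
Qed.

Lemma cmap_continuous_at s p : cdom s p -> {for p, continuous (cmap s)}.
Proof.
move=> sp; have := @cmap_continuous _ _ _ s.
by rewrite continuous_open_subspace; [apply; rewrite inE|exact: cdom_open].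
Qed.

Lemma cinv_continuous_at s p : cdom s p -> {for cmap s p, continuous (cinv s)}.
Proof.
move=> sp; have := @cinv_continuous _ _ _ s.
by rewrite continuous_open_subspace; [apply; rewrite inE; exists p|exact: cimg_open].
Qed.

End Charts.

Section LieGroupCharts.
Context {R : realType} {n : nat} (G : lieGroupType R n).
Local Notation aG := (manifold_atlas : atlas 'rV[R]_n G).
Local Notation E := 'rV[R]_n.
Implicit Types (s t r : chart E G) (g h p : G).
Let cE := rV_coords (R := R) n.

Lemma mul_continuous_at g h :
  {for (g, h), continuous (fun x : G * G => (x.1 * x.2)%g)}.
Proof. by have [+ _] := @mul_smooth R n G; exact. Qed.

Lemma smooth_at_mul s t r g h : charts aG s -> charts aG t -> charts aG r ->
  cdom s g -> cdom t h -> cdom r (g * h)%g ->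
  smooth_at (fun u : E * E => cmap r (cinv s u.1 * cinv t u.2)%g) (cmap s g, cmap t h).
Proof.
move=> As At Ar sg th rgh; have [_ /(_ s t r As At Ar) S] := @mul_smooth R n G.
apply: (smooth_on_near S).
have c1 : (fun u : E * E => (cinv s u.1, cinv t u.2)) @ (cmap s g, cmap t h) --> (g, h).
  have := cinv_continuous_at sg; rewrite /prop_for /continuous_at (chartK sg) => cs.
  have := cinv_continuous_at th; rewrite /prop_for /continuous_at (chartK th) => ct.
  apply: cvg_pair => /=.
    by apply: cvg_comp cs; exact: cvg_fst.
  by apply: cvg_comp ct; exact: cvg_snd.
have c2 := cvg_comp _ _ c1 (mul_continuous_at (g := g) (h := h)).
have n1 := c2 _ (near_cdom rgh).
have n2 : \forall u \near (cmap s g, cmap t h),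
   cdom s (cinv s u.1) /\ cmap s (cinv s u.1) = u.1.
  exact: (cvg_fst (near_cinv sg)).
have n3 : \forall u \near (cmap s g, cmap t h),
   cdom t (cinv t u.2) /\ cmap t (cinv t u.2) = u.2.
  exact: (cvg_snd (near_cinv th)).
near=> u.
have [a1 a2] : cdom s (cinv s u.1) /\ cmap s (cinv s u.1) = u.1 by near: u.
have [b1 b2] : cdom t (cinv t u.2) /\ cmap t (cinv t u.2) = u.2 by near: u.
exists (cinv s u.1, cinv t u.2); last by rewrite /= a2 b2 -surjective_pairing.
by split=> //=; near: u.
Unshelve. all: by end_near. Qed.

Lemma smooth_at_mull t r g h : charts aG t -> charts aG r ->
  cdom t h -> cdom r (g * h)%g ->
  smooth_at (fun u : E => cmap r (g * cinv t u)%g) (cmap t h).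
Proof.
move=> At Ar th rgh.
have As := @chart_at_charts _ _ _ aG g; have sg := @chart_at_dom _ _ _ aG g.
have S := smooth_at_mul As At Ar sg th rgh.
have := smooth_at_comp (prod_coords cE cE) (smooth_at_pair
  (smooth_at_cst (cmap (chart_at aG g) g) _) (smooth_at_id (cmap t h))) S.
by apply: smooth_at_eq; near=> u; rewrite /= chartK.
Unshelve. all: by end_near. Qed.

Lemma smooth_at_mulr s r g h : charts aG s -> charts aG r ->
  cdom s g -> cdom r (g * h)%g ->
  smooth_at (fun u : E => cmap r (cinv s u * h)%g) (cmap s g).
Proof.
move=> As Ar sg rgh.
have At := @chart_at_charts _ _ _ aG h; have th := @chart_at_dom _ _ _ aG h.
have S := smooth_at_mul As At Ar sg th rgh.
have := smooth_at_comp (prod_coords cE cE) (smooth_at_pair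
  (smooth_at_id (cmap s g)) (smooth_at_cst (cmap (chart_at aG h) h) _)) S.
by apply: smooth_at_eq; near=> u; rewrite /= chartK.
Unshelve. all: by end_near. Qed.

(* ulog is the chart at the unit centred at 0 and uexp its inverse; uexp is not
   the exponential map. *)
Definition uchart : chart E G := chart_at aG 1%g.
Definition uexp (u : E) : G := cinv uchart (u + cmap uchart 1%g).
Definition ulog (g : G) : E := cmap uchart g - cmap uchart 1%g.
Definition umul (p : E * E) : E := ulog (uexp p.1 * uexp p.2)%g.

Lemma uchart_charts : charts aG uchart. Proof. exact: chart_at_charts. Qed.
Lemma uchart_dom : cdom uchart 1%g. Proof. exact: chart_at_dom. Qed.

Lemma uexp0 : uexp 0 = 1%g.
Proof. by rewrite /uexp add0r chartK//; exact: uchart_dom. Qed.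

Lemma ulog1 : ulog 1%g = 0. Proof. exact: subrr. Qed.

Lemma near0_shift (P : E -> Prop) (a : E) :
  (\forall u \near a, P u) -> \forall u \near (0 : E), P (u + a).
Proof. by rewrite (near_shift 0); apply: filterS => u; rewrite /= subr0. Qed.

Lemma uexpK : \forall u \near (0 : E), ulog (uexp u) = u.
Proof.
have := near0_shift (near_cinv uchart_dom); apply: filterS => u [_ ue].
by rewrite /ulog /uexp ue addrK.
Qed.

Lemma uexp_dom : \forall u \near (0 : E), cdom uchart (uexp u).
Proof. by have := near0_shift (near_cinv uchart_dom); apply: filterS => u []. Qed.

Lemma ulogK : \forall g \near (1%g : G), uexp (ulog g) = g.
Proof.
apply: filterS (near_cdom uchart_dom) => g sg.
by rewrite /uexp /ulog subrK chartK.
Qed.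

Lemma uexp_continuous : uexp @ (0 : E) --> (1%g : G).
Proof.
have := @cinv_continuous_at _ _ _ uchart 1%g uchart_dom.
rewrite /prop_for /continuous_at chartK; last exact: uchart_dom.
move=> c A /c; exact: near0_shift.
Qed.

Lemma ulog_continuous : ulog @ (1%g : G) --> (0 : E).
Proof.
rewrite -ulog1; apply: cvgB; last exact: cvg_cst.
exact: cmap_continuous_at uchart_dom.
Qed.

Lemma mul_uexp_continuous g : (fun u => (g * uexp u)%g) @ (0 : E) --> g.
Proof.
have c1 : (fun u : E => (g, uexp u)) @ (0 : E) --> (g, 1%g : G).
  exact: (cvg_pair (cvg_cst g) uexp_continuous).
have := cvg_comp _ _ c1 (mul_continuous_at (g := g) (h := 1%g)).
by rewrite /= mulg1.
Qed.

Lemma smooth_at_uexp_shift (F : normedModType R) (f : G -> F) :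
  smooth_at (fun u => f (cinv uchart u)) (cmap uchart 1%g) ->
  smooth_at (fun u => f (uexp u)) 0.
Proof.
move=> S; apply: (smooth_at_shift cE (f := fun u => f (cinv uchart u))).
by rewrite add0r.
Qed.

Lemma smooth_at_cmap_mull s g : charts aG s -> cdom s g ->
  smooth_at (fun u => cmap s (g * uexp u)%g) 0.
Proof.
move=> As sg; apply: (smooth_at_uexp_shift (f := fun h => cmap s (g * h)%g)).
by apply: smooth_at_mull => //; [exact: uchart_charts|exact: uchart_dom|rewrite mulg1].
Qed.

Lemma smooth_at_ulog_mull s g h : charts aG s -> cdom s h -> (g * h)%g = 1%g ->
  smooth_at (fun u => ulog (g * cinv s u)%g) (cmap s h).
Proof.
move=> As sh gh; apply: smooth_atB; last exact: smooth_at_cst.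
by apply: smooth_at_mull => //; [exact: uchart_charts|rewrite gh; exact: uchart_dom].
Qed.

Lemma smooth_at_ulog_mulr s g h : charts aG s -> cdom s g -> (g * h)%g = 1%g ->
  smooth_at (fun u => ulog (cinv s u * h)%g) (cmap s g).
Proof.
move=> As sh gh; apply: smooth_atB; last exact: smooth_at_cst.
by apply: smooth_at_mulr => //; [exact: uchart_charts|rewrite gh; exact: uchart_dom].
Qed.

Lemma smooth_at_umul : smooth_at umul (0, 0).
Proof.
have S := smooth_at_mul uchart_charts uchart_charts uchart_charts uchart_dom uchart_dom.
have /S{}S : cdom uchart (1 * 1)%g by rewrite mulg1; exact: uchart_dom.
pose e := cmap uchart 1%g.
apply: smooth_atB; last exact: smooth_at_cst.
have := @smooth_at_shift _ _ _ (prod_coords cE cE)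
  (fun u : E * E => cmap uchart (cinv uchart u.1 * cinv uchart u.2)%g) (e, e) (0, 0).
by apply; rewrite [_ + _](_ : _ = (e, e))//; congr (_, _); rewrite /= add0r.
Qed.

Lemma umulE : \forall p \near ((0, 0) : E * E), (uexp p.1 * uexp p.2)%g = uexp (umul p).
Proof.
have c1 : (fun u : E * E => (uexp u.1, uexp u.2)) @ ((0 : E), (0 : E)) --> (1%g : G,
  1%g : G).
  have f1 : (fun u : E * E => uexp u.1) @ ((0 : E), (0 : E)) --> (1%g : G).
    by apply: (cvg_comp _ _ _ uexp_continuous); exact: cvg_fst.
  have f2 : (fun u : E * E => uexp u.2) @ ((0 : E), (0 : E)) --> (1%g : G).
    by apply: (cvg_comp _ _ _ uexp_continuous); exact: cvg_snd.
  exact: (cvg_pair f1 f2).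
have := cvg_comp _ _ c1 (mul_continuous_at (g := 1%g) (h := 1%g)); rewrite /= mulg1.
move=> c2; have n2 := c2 _ ulogK; near=> p; apply: esym; near: p; exact: n2.
Unshelve. all: by end_near. Qed.

Lemma umul0 : umul (0, 0) = 0.
Proof. by rewrite /umul /= uexp0 mulg1 ulog1. Qed.

Lemma umulr0 : \forall u \near (0 : E), umul (u, 0) = u.
Proof. by apply: filterS uexpK => u E1; rewrite /umul /= uexp0 mulg1. Qed.

Lemma umul0r : \forall u \near (0 : E), umul (0, u) = u.
Proof. by apply: filterS uexpK => u E1; rewrite /umul /= uexp0 mul1g. Qed.

(** The unit is neutral, so [umul] restricted to either axis is the identity near 0 and both partial
    derivatives are identities. *)
Lemma diff_umul a b : 'd umul (0, 0) (a, b) = a + b.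
Proof.
have dm := smooth_at_differentiable smooth_at_umul.
have [_ d1] : is_diff (0 : E) (fun u => umul (u, 0)) id.
  apply: is_diff_near (is_diff_id _).
  by apply: filterS umulr0 => u ->.
have [_ d2] : is_diff (0 : E) (fun u => umul (0, u)) id.
  apply: is_diff_near (is_diff_id _).
  by apply: filterS umul0r => u ->.
have e1 : 'd umul (0, 0) (a, 0) = a by rewrite -(diff_pairlE a dm) d1.
have e2 : 'd umul (0, 0) (0, b) = b by rewrite -(diff_pairrE b dm) d2.
rewrite -[in RHS]e1 -[in RHS]e2 -linearD; congr ('d umul _ _).
by congr (_, _); rewrite /= ?addr0 ?add0r.
Qed.

Lemma exists_local_law : exists r C : R,
  local_law uexp (fun u v => umul (u, v)) r C.
Proof.
have [r1 [C [r10 C0 H1]]] := quadratic_estimate (prod_coords cE cE) smooth_at_umul.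
have /nbhs_ballP[r2 /= r20 H2] := umulE.
have /nbhs_ballP[r3 /= r30 H3] := uexpK.
(* The four bounds serve, in order, the quadratic estimate, the product formula [umulE], injectivity
   of [uexp] on the ball of radius 4 r, and C r <= 1/4. The factors 1/2 and 1/8 fit closed balls
   into open ones. *)
pose r := Num.min (Num.min r1 (r2 / 2)) (Num.min (r3 / 8) (1 / (4 * C))).
have C4 : 0 < 1 / (4 * C) by rewrite divr_gt0// mulr_gt0.
have r0 : 0 < r by rewrite !lt_min r10 C4 !divr_gt0.
have [rr1 [rr2 [rr3 rC]]] : r <= r1 /\ r <= r2 / 2 /\ r <= r3 / 8 /\ r <= 1 / (4 * C).
  by rewrite !ge_min !lexx !orbT.
exists r, C; split => //.
- move: rC; rewrite ler_pdivlMr ?mulr_gt0//; lra.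
- exact: uexp0.
- exact: umul0.
- move=> u v ur vr; apply: (H2 (u, v)).
  split; rewrite -ball_normE /= sub0r normrN; move: ur vr rr2 r20; lra.
- move=> u v ur vr /(congr1 ulog).
  rewrite (H3 u) ?(H3 v)//; rewrite -ball_normE /= sub0r normrN;
    move: ur vr rr3 r30 r0; lra.
- move=> rho u v u' v' rhor ur vr u'r v'r.
  have pn (a b : E) (B : R) : `|a| <= B -> `|b| <= B -> `|(a, b) : E * E| <= B.
    by move=> aB bB; rewrite [`|_|]/(Num.max `|a| `|b|) ge_max aB.
  have := H1 (u, v) (u', v') rho (le_trans rhor rr1).
  rewrite !subr0 => /(_ (pn _ _ _ ur vr) (pn _ _ _ u'r v'r)).
  rewrite -[X in 'd umul _ X]/(u - u', v - v') diff_umul => /le_trans; apply.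
  rewrite ler_wpM2l//.
    by rewrite mulr_ge0 ?(ltW C0)// (le_trans _ ur).
  by apply: pn; rewrite ?lerDl ?lerDr.
Qed.

End LieGroupCharts.

Lemma near0_norm (R : realType) (d : R) : 0 < d -> \forall h \near (0 : R), `|h| < d.
Proof.
move=> d0; apply/nbhs_ballP; exists d => //= h.
by rewrite -ball_normE /= sub0r normrN.
Qed.

Lemma tangent_is_diff (R : realType) n (F : R -> 'rV[R]_n) d X : 0 < d ->
  tangent_to d F X -> is_diff (0 : R) F (fun v : R => v *: X).
Proof.
move=> d0 [K K0 KF]; have dl := is_diff_scalel (0 : R) X.
have [dl1 dl2] := dl.
have F0 : F 0 = 0.
  have := KF 0; rewrite normr0 expr0n/= mulr0 scale0r subr0.
  by move=> /(_ (ltW d0)); rewrite normr_le0 => /eqP.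
suff : is_diff (0 : R) F ('d ( *:%R^~ X) (0 : R)) by rewrite dl2.
apply: is_diff_eps => [|e e0]; first exact: diff_continuous.
have K1 : 0 < K + 1 by rewrite ltr_wpDl.
near=> h.
have hd : `|h| <= d by apply: ltW; near: h; exact: near0_norm.
have he : `|h| <= e / (K + 1).
  by apply: ltW; near: h; apply: near0_norm; rewrite divr_gt0.
rewrite addr0 F0 subr0 dl2 (le_trans (KF _ hd))//.
rewrite -real_normK ?num_real// expr2 mulrA ler_wpM2r//.
move: he; rewrite ler_pdivlMr// => he; apply: le_trans he.
by rewrite mulrC ler_wpM2l// lerDl.
Unshelve. all: by end_near. Qed.

Lemma hom0 (R : realType) (G : groupType) (gamma : R -> G) :
  (forall s t, gamma (s + t) = (gamma s * gamma t)%g) -> gamma 0 = 1%g.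
Proof.
by move=> gD; apply: (@mulgI _ (gamma 0)); rewrite -gD addr0 mulg1.
Qed.

(** * One-parameter subgroups of G *)

Section OneParam.
Context {R : realType} {n : nat} (G : lieGroupType R n).
Local Notation aG := (manifold_atlas : atlas 'rV[R]_n G).
Local Notation E := 'rV[R]_n.
Let cE := rV_coords (R := R) n.
Context (r C : R)
  (H : local_law (@uexp R n G) (fun u v => umul G (u, v)) r C).

Section Curve.
Context (gamma : R -> G) (d : R) (F : R -> E) (X : E) (d0 : 0 < d)
  (gD : forall s t, gamma (s + t) = (gamma s * gamma t)%g)
  (gF : forall t, `|t| <= d -> gamma t = uexp G (F t) /\ `|F t| <= r)
  (tF : tangent_to d F X).

Let F0 : F 0 = 0.
Proof.
have [K _ KF] := tF; have := KF 0; rewrite normr0 expr0n/= mulr0 scale0r subr0.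
by move=> /(_ (ltW d0)); rewrite normr_le0 => /eqP.
Qed.

Let Fc : F @ (0 : R) --> (0 : E).
Proof.
have [/differentiable_continuous] := tangent_is_diff d0 tF.
by rewrite /prop_for /continuous_at F0.
Qed.

Let FD s t : `|s| <= d -> `|t| <= d -> `|s + t| <= d -> F (s + t) = umul G (F s, F t).
Proof.
move=> sd td std; have [gs Fs] := gF sd; have [gt Ft] := gF td.
have [gst Fst] := gF std; apply: (law_inj H).
- by rewrite (le_trans Fst)// ler_peMl ?(ltW (law_r H))// ler1n.
- exact: (law_m_in H).
- by rewrite -gst gD gs gt (law_M H).
Qed.

Let good t := smooth_at (umul G) (F t, 0) /\
  is_diff t F (fun v : R => v *: 'd (umul G) (F t, 0) (0, X)).

(** F (t + h) = umul (F t, F h), differentiated at h = 0 where F has derivative X, gives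
    differentiability of F at every small t together with its derivative. *)
Lemma near_good : \forall t \near (0 : R), good t.
Proof.
have c1 : (fun t => (F t, 0 : E)) @ (0 : R) --> (0 : E, 0 : E).
  exact: (cvg_pair Fc (cvg_cst _)).
have n1 : \forall t \near (0 : R), smooth_at (umul G) (F t, 0).
  have n0 : nbhs ((0 : E), (0 : E)) (fun p => smooth_at (umul G) p).
    exact: smooth_at_near (smooth_at_umul G).
  exact: (c1 _ n0).
apply: filterS2 n1 (near0_norm d0) => t St td.
split => //.
have d1 : is_diff t (fun s : R => s - t) (fun s => s).
  have := is_diffB (is_diff_id t) (is_diff_cst t t).
  by rewrite subr0.
have d2 : is_diff (t - t) F (fun v : R => v *: X).
  by rewrite subrr; exact: tangent_is_diff d0 tF.
have d3 := is_diff_comp d1 d2.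
have d4 := is_diff_pair (is_diff_cst (F t) t) d3.
have d5 : is_diff (F t, F (t - t)) (umul G) ('d (umul G) (F t, 0)).
  by rewrite subrr F0; exact: smooth_at_is_diff.
have [e1 e2] := is_diff_comp d4 d5.
have near_eq : \forall s \near t, umul G (F t, F (s - t)) = F s.
  have c2 : (fun s : R => s - t) @ t --> (0 : R).
    by rewrite -(subrr t); apply: cvgB; [exact: cvg_id|exact: cvg_cst].
  have n2 : \forall s \near t, `|s - t| < d by exact: (c2 _ (near0_norm d0)).
  have dt : 0 < d - `|t| by rewrite subr_gt0.
  have n3 : \forall s \near t, `|s - t| < d - `|t| by exact: (c2 _ (near0_norm dt)).
  apply: filterS2 n2 n3 => s sd1; rewrite ltrBrDr => sd2.
  have {}sd2 : `|s| <= d.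
    by rewrite -[s](subrK t) (le_trans (ler_normD _ _))// ltW.
  by rewrite -FD ?(ltW td) ?(ltW sd1)//; rewrite addrC subrK.
apply: (is_diff_near near_eq); split; first exact: e1.
rewrite e2; apply/funext => v /=.
by rewrite -linearZ; congr ('d _ _ _); congr (_, _); rewrite /= scaler0.
Qed.

(* F satisfies the autonomous equation F' = V o F, so its regularity bootstraps. *)
Lemma curve_smooth_at : smooth_at F 0.
Proof.
pose V (w : E) := 'd (umul G) (w, 0 : E) (0, X).
pose U := interior good.
have oU : open U by exact: open_interior.
have Ug t : U t -> good t by move=> /nbhs_singleton.
pose W := interior (fun w : E => smooth_at V w).
have oW : open W by exact: open_interior.
have UW t : U t -> W (F t).
  move=> /Ug[St _]; suff S : smooth_at V (F t) by exact: (smooth_at_near S).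
  apply: (@smooth_at_comp _ _ _ _ (prod_coords cE cE) (fun w : E => (w, 0 : E))
    (fun p => 'd (umul G) p (0, X))); last exact: smooth_at_diff.
  by apply: smooth_at_pair; [exact: smooth_at_id|exact: smooth_at_cst].
apply/smooth_atP; exists U; split => //; first exact: near_good.
elim=> [|k IH]; first by move=> t /Ug[_ [/differentiable_continuous]].
split=> [t /Ug[_ []]//|v].
apply: (@Ck_eq _ _ _ _ _ (fun t => v *: V (F t))) => //.
  by move=> t /Ug[_ [_ ->]].
apply: Ck_scale => //; first exact: Ck_cst.
apply: (Ck_comp cE oU oW UW IH).
by apply: smooth_at_on => w /nbhs_singleton.
Qed.

(** Smoothness at 0 spreads to every t through gamma (t + h) = gamma t * uexp (F h), since left
    translations are smooth. *)
Lemma curve_one_param : one_param_subgroup X gamma.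
Proof.
have nd : \forall h \near (0 : R), gamma h = uexp G (F h).
  apply: filterS (near0_norm d0) => h hd.
  by have [] := gF (ltW hd).
have gh t : (fun h => gamma (t + h)) @ (0 : R) --> gamma t.
  have c1 := cvg_comp _ _ Fc (mul_uexp_continuous (g := gamma t)).
  apply: cvg_trans c1; apply: near_eq_cvg.
  by apply: filterS nd => h E1 /=; rewrite gD E1.
have st t : (fun s : R => s - t) @ t --> (0 : R).
  by rewrite -(subrr t); apply: cvgB; [exact: cvg_id|exact: cvg_cst].
split => //.
- split=> [t|_ s -> As].
    have c1 := cvg_comp _ _ (st t) (gh t).
    rewrite /continuous_at; apply: cvg_trans c1; apply: near_eq_cvg.
    by apply: filterE => s /=; rewrite addrC subrK.
  apply: smooth_at_on => _ [t [_ /= gts] <-].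
  have S0 : smooth_at (fun h => cmap s (gamma t * uexp G (F h))%g) 0.
    apply: (smooth_at_comp cE curve_smooth_at (g := fun u => cmap s (gamma t * uexp G
      u)%g)).
    by rewrite F0; exact: smooth_at_cmap_mull.
  have S1 := @smooth_at_shift _ _ _ (R_coords (R := R))
    (fun h => cmap s (gamma t * uexp G (F h))%g) (- t) t.
  rewrite subrr in S1.
  apply: smooth_at_eq (S1 S0).
  have n1 : \forall w \near t, gamma (w - t) = uexp G (F (w - t)) by exact: (st t _ nd).
  by apply: filterS n1 => w E1; rewrite /= -E1 -gD addrC subrK.
- have g0 : gamma 0 = 1%g.
    exact: hom0.
  rewrite /velocity /tangent_map /= g0.
  have [dF1 dF2] := tangent_is_diff d0 tF.
  have near_F : \forall h \near (0 : R), F h + cmap (uchart G) 1%g = cmap (uchart G)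
    (gamma h).
    have n1 : \forall h \near (0 : R), ulog (uexp G (F h)) = F h.
      have n0 : nbhs (0 : E) (fun u => ulog (uexp G u) = u) by exact: uexpK.
      exact: (Fc n0).
    by apply: filterS2 nd n1 => h -> {1}<-; rewrite subrK.
  have dF3 := is_diffD (tangent_is_diff d0 tF) (is_diff_cst (cmap (uchart G) 1%g) (0 : R)).
  have [_ E1] := is_diff_near near_F dF3.
  by rewrite -[LHS]/('d (fun h => cmap (uchart G) (gamma h)) (0 : R) 1) E1 /= addr0 scale1r.
Qed.

End Curve.

(** This converts a one-parameter subgroup back into the data of the local theory, as uniqueness
    requires. *)
Lemma one_param_curve (X : E) (gamma : R -> G) : one_param_subgroup X gamma ->
  exists d, [/\ 0 < d,
    forall t, `|t| <= d -> gamma t = uexp G (ulog (gamma t)) /\ `|ulog (gamma t)| <= r &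
    tangent_to d (fun t => ulog (gamma t)) X].
Proof.
move=> [[gc gS] gD gX].
have g0 : gamma 0 = 1%g.
  exact: hom0.
have gc0 : gamma @ (0 : R) --> (1%g : G) by rewrite -g0; exact: gc.
have n1 : \forall t \near (0 : R), uexp G (ulog (gamma t)) = gamma t.
  exact: (gc0 _ (ulogK G)).
have lc0 : (fun t => ulog (gamma t)) @ (0 : R) --> (0 : E).
  exact: (cvg_comp _ _ gc0 (@ulog_continuous _ _ G)).
have n2 : \forall t \near (0 : R), `|ulog (gamma t)| < r.
  have n0 : \forall u \near (0 : E), `|u| < r.
    apply/nbhs_ballP; exists r; first exact: (law_r H).
    by move=> u; rewrite -ball_normE /= sub0r normrN.
  exact: (lc0 _ n0).
have S : smooth_at (fun t => cmap (uchart G) (gamma t)) (0 : R).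
  have S0 := gS (id_chart R) (uchart G) erefl (uchart_charts G).
  apply: (smooth_on_near S0).
  have : \forall t \near (0 : R), cdom (uchart G) (gamma t).
    exact: (gc0 _ (near_cdom (uchart_dom G))).
  by apply: filterS => t gt; exists t.
have SL : smooth_at (fun t => ulog (gamma t)) (0 : R).
  by apply: smooth_atB => //; exact: smooth_at_cst.
have dX : 'd (fun t => ulog (gamma t)) (0 : R) 1 = X.
  have [_ ->] := is_diffB (smooth_at_is_diff S) (is_diff_cst (cmap (uchart G) 1%g) (0 : R)).
  rewrite subr0 -gX /velocity /tangent_map /= g0.
  by [].
have [r1 [C1 [r10 C10 Q]]] := quadratic_estimate (R_coords (R := R)) SL.
have n3 : nbhs (0 : R) (fun t => uexp G (ulog (gamma t)) = gamma t /\ `|ulog (gamma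
  t)| < r).
  exact: (filterI n1 n2).
have [d1 /= d10 H1] := (nbhs_ballP (0 : R) _).1 n3.
exists (Num.min r1 (d1 / 2)); split.
- by rewrite lt_min r10 divr_gt0.
- move=> t; rewrite le_min => /andP[_ td].
  have [|-> /ltW tr] := H1 t; last by [].
  by rewrite -ball_normE /= sub0r normrN; move: td d10; lra.
- exists C1; first exact: ltW.
  move=> t; rewrite le_min => /andP[tr _].
  (* The radius in the quadratic estimate is [|t|] itself, which produces an error of order t^2. *)
  have := Q t 0 `|t| tr;
    rewrite !subr0 normr0 g0 ulog1 subr0 => /(_ (lexx _) (normr_ge0 _)).
  rewrite -[t in 'd _ _ t]mulr1 -[t * 1]/(t *: 1) linearZ /= dX => /le_trans; apply.
  by rewrite -mulrA -expr2 real_normK ?num_real.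
Qed.

Lemma one_param_subgroup_unique (X : E) (gamma1 gamma2 : R -> G) :
  one_param_subgroup X gamma1 -> one_param_subgroup X gamma2 -> gamma1 = gamma2.
Proof.
move=> g1 g2; have [d1 [d10 H1 T1]] := one_param_curve g1.
have [d2 [d20 H2 T2]] := one_param_curve g2.
case: g1 => _ g1D _; case: g2 => _ g2D _.
have d0 : 0 < Num.min d1 d2 by rewrite lt_min d10.
apply: (law_one_param_unique H d0 g1D g2D _ _ (X := X)).
- by move=> t; rewrite le_min => /andP[td _]; exact: H1.
- by move=> t; rewrite le_min => /andP[_ td]; exact: H2.
- by case: T1 => K K0 KF; exists K => // t; rewrite le_min => /andP[td _]; exact: KF.
- by case: T2 => K K0 KF; exists K => // t; rewrite le_min => /andP[_ td]; exact: KF.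
Qed.

(** For each t, s |-> gamma (t s) is a one-parameter subgroup with velocity t X; by uniqueness it is
    the one selected in [lie_exp (t *: X)], and its value at 1 is gamma t. *)
Lemma lie_exp_curve (X : E) : exists gamma d F, [/\ 0 < d,
  forall t, `|t| <= d -> gamma t = uexp G (F t), tangent_to d F X,
  gamma 0 = 1%g &
  forall t, lie_exp (G := G) (t *: X) = gamma t].
Proof.
have [gamma [d [F [d0 gD gF tF]]]] := law_one_param H X.
exists gamma, d, F; split=> //.
- by move=> t /gF[].
- exact: hom0.
move=> t; rewrite /lie_exp.
have Pt : one_param_subgroup (t *: X) (fun s => gamma (t * s)).
  pose d' := d / (`|t| + 1).
  have t1 : 0 < `|t| + 1 by rewrite ltr_wpDl.
  have d'0 : 0 < d' by rewrite divr_gt0.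
  have td' : `|t| * d' <= d.
    rewrite /d' mulrA ler_pdivrMr// mulrC ler_wpM2l ?(ltW d0)//.
    by rewrite lerDl.
  apply: (curve_one_param (d := d') (F := fun s => F (t * s))) => //.
  + by move=> s u; rewrite mulrDr gD.
  + by move=> s sd; apply: gF; rewrite normrM (le_trans _ td')// ler_wpM2l.
  + exact: tangent_to_scale tF.
case: xgetP => [g -> /= gP|/(_ _ Pt)//].
by rewrite (one_param_subgroup_unique gP Pt) mulr1.
Qed.

End OneParam.

(** * The vector field of a Lie algebra valued map *)

Section Rho.
Context {R : realType} {n : nat} (G : lieGroupType R n).
Local Notation aG := (manifold_atlas : atlas 'rV[R]_n G).
Local Notation E := 'rV[R]_n.

(** The exponential is eliminated here: it enters [rho] only through its tangent vector, so the
    inverse chart [uexp] may take its place in the rest of the proof. *)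
Lemma rhoE (x : G -> E) g :
  rho x g = 'd (fun u => cmap (chart_at aG g) (g * uexp G u)%g) (0 : E) (x g).
Proof.
have [r [C H]] := exists_local_law G.
have [gamma [d [F [d0 gF tF g0 expE]]]] := lie_exp_curve H (x g).
rewrite /rho /velocity /tangent_map.
have -> : (fun t => (g * lie_exp (t *: x g))%g) = fun t => (g * gamma t)%g.
  by apply/funext => t; rewrite expE.
rewrite /= expE g0 mulg1.
have dF := tangent_is_diff d0 tF; have [dF1 dF2] := dF.
have F0 : F 0 = 0.
  have [K _ KF] := tF; have := KF 0; rewrite normr0 expr0n/= mulr0 scale0r subr0.
  by move=> /(_ (ltW d0)); rewrite normr_le0 => /eqP.
have S := smooth_at_cmap_mull (@chart_at_charts _ _ _ aG g) (@chart_at_dom _ _ _ aG g).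
have dS : is_diff (F 0) (fun u => cmap (chart_at aG g) (g * uexp G u)%g)
    ('d (fun u => cmap (chart_at aG g) (g * uexp G u)%g) (0 : E)).
  by rewrite F0; exact: smooth_at_is_diff.
have dSF := is_diff_comp dF dS.
have near_eq : \forall t \near (0 : R),
   cmap (chart_at aG g) (g * uexp G (F t))%g = cmap (chart_at aG g) (g * gamma t)%g.
  by apply: filterS (near0_norm d0) => t /ltW td; rewrite gF.
have [_ E1] := is_diff_near near_eq dSF.
rewrite -[LHS]/('d (fun t => cmap (chart_at aG g) (g * gamma t)%g) (0 : R) 1) E1 /=.
by rewrite scale1r.
Qed.

End Rho.

(** * Linear and bilinear maps in finite dimension *)

Section Linear.
Context {R : realType}.
Implicit Types E F K : normedModType R.

Lemma diff_shiftE E F (f : E -> F) a p v : differentiable f (p + a) ->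
  'd (fun u => f (u + a)) p v = 'd f (p + a) v.
Proof.
move=> fp; have d1 := is_diffD (is_diff_id p) (is_diff_cst a p).
have [_ E1] := is_diff_comp d1 (differentiableP fp).
by rewrite -[LHS]/('d (f \o (id + cst a)) p v) E1 /= addr0.
Qed.

Lemma linear_smooth_at E K (cE : coords E) (L : {linear E -> K}) p : smooth_at L p.
Proof.
have S : smooth_at (fun v => \sum_i cform i v *: L (cbase (c:=cE) i)) p.
  apply: smooth_at_sum => i; apply: smooth_at_scale; last exact: smooth_at_cst.
  by apply: smooth_at_lin; [exact: cform_continuous|exact: smooth_at_id].
apply: smooth_at_eq S; apply: filterE => v.
by rewrite [in RHS](coordsE cE v) linear_sum; apply: eq_bigr => i _; rewrite linearZ.
Qed.

Lemma coords_linear_continuous E K (cE : coords E) (L : {linear E -> K}) : continuous L.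
Proof. by move=> p; exact/smooth_at_continuous/linear_smooth_at. Qed.

Section Bilinear.
Context (E F K L : normedModType R) (cF : coords F) (cK : coords K) (B : F -> K -> L)
  (Bl : forall k a a' b, B (k *: a + a') b = k *: B a b + B a' b)
  (Br : forall k a b b', B a (k *: b + b') = k *: B a b + B a b').

Let Bp (a : F) : {linear K -> L} :=
  HB.pack (B a) (GRing.isLinear.Build R K L *:%R (B a) (fun k b b' => Br k a b b')).
Let Bq (b : K) : {linear F -> L} :=
  HB.pack (B^~ b) (GRing.isLinear.Build R F L *:%R (B^~ b) (fun k a a' => Bl k a a' b)).

Let BE a b : B a b = \sum_i cform i a *: Bp (cbase (c:=cF) i) b.
Proof.
rewrite -[LHS]/(Bq b a) {1}(coordsE cF a) linear_sum.
by apply: eq_bigr => i _; rewrite linearZ.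
Qed.

(** B comes without continuity, as the Lie bracket will; expanding its first argument in a basis
    leaves scalar coefficients times linear maps, which are smooth in finite dimension. *)
Lemma smooth_at_bilinear (f : E -> F) (g : E -> K) p :
  smooth_at f p -> smooth_at g p -> smooth_at (fun u => B (f u) (g u)) p.
Proof.
move=> fp gp.
have S : smooth_at (fun u => \sum_i cform i (f u) *: Bp (cbase (c:=cF) i) (g u)) p.
  apply: smooth_at_sum => i; apply: smooth_at_scale.
    by apply: smooth_at_lin => //; exact: cform_continuous.
  by apply: smooth_at_lin => //; exact: coords_linear_continuous.
by apply: smooth_at_eq S; apply: filterE => u; rewrite BE.
Qed.

Lemma diff_bilinear (f : E -> F) (g : E -> K) p v :
  smooth_at f p -> smooth_at g p ->
  'd (fun u => B (f u) (g u)) p v = B ('d f p v) (g p) + B (f p) ('d g p v).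
Proof.
move=> fp gp.
rewrite (_ : (fun u => _) = fun u => \sum_i cform i (f u) *: Bp (cbase (c:=cF) i) (g
  u)); last first.
  by apply/funext => u; rewrite BE.
have Sf i : smooth_at (fun u => cform (c:=cF) i (f u)) p.
  by apply: smooth_at_lin => //; exact: cform_continuous.
have Sg i : smooth_at (fun u => Bp (cbase (c:=cF) i) (g u)) p.
  by apply: smooth_at_lin => //; exact: coords_linear_continuous.
have S i : differentiable (fun u => cform (c:=cF) i (f u) *: Bp (cbase i) (g u)) p.
  by apply/smooth_at_differentiable/smooth_at_scale.
have [_ ->] := diff_sumE (index_enum 'I_(cdim cF)) v S.
rewrite [X in _ = X + _]BE [X in _ = _ + X]BE -big_split; apply: eq_bigr => i _ /=.
rewrite (diff_scaleE v (smooth_at_differentiable (Sf i)) (smooth_at_differentiable (Sg i))).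
have E1 : 'd (fun u => cform (c:=cF) i (f u)) p v = cform i ('d f p v).
  by apply: diff_linE; [exact: cform_continuous|exact: smooth_at_differentiable].
have E2 : 'd (fun u => Bp (cbase (c:=cF) i) (g u)) p v = Bp (cbase i) ('d g p v).
  by apply: diff_linE; [exact: coords_linear_continuous|exact: smooth_at_differentiable].
rewrite E1 E2.
by rewrite addrC.
Qed.

End Bilinear.
End Linear.

(** * Left-invariant derivations of functions on G *)

Section LeftDerivative.
Context {R : realType} {n : nat} (G : lieGroupType R n).
Local Notation aG := (manifold_atlas : atlas 'rV[R]_n G).
Local Notation E := 'rV[R]_n.
Implicit Types (F : normedModType R) (g h k : G) (X Y Z : E).
Let cE := rV_coords (R := R) n.
Let cEE := prod_coords cE cE.

(** The inverse chart at the unit, translated to g on the left, replaces the charts of the atlas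
    around g. Left-invariant derivations have constant coefficients in this description. *)
Definition smooth_near F (y : G -> F) g := smooth_at (fun u : E => y (g * uexp G u)%g) 0.
Definition lderiv F X (y : G -> F) g : F := 'd (fun u : E => y (g * uexp G u)%g) 0 X.

Lemma smooth_map_near F (y : G -> F) g :
  smooth_map aG (vec_atlas F) y -> smooth_near y g.
Proof.
move=> [_ yS]; pose s := chart_at aG g.
have As : charts aG s by exact: chart_at_charts.
have sg : cdom s g by exact: chart_at_dom.
have S1 : smooth_at (fun w => y (cinv s w)) (cmap s g).
  apply: (smooth_on_near (yS s (id_chart F) As erefl)).
  by apply: filterS (near_cinv sg) => w [sw <-]; exists (cinv s w).
have S2 := smooth_at_cmap_mull As sg.
have S3 : smooth_at (fun u => y (cinv s (cmap s (g * uexp G u)%g))) 0.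
  apply: (smooth_at_comp cE S2 (g := fun w => y (cinv s w))).
  by rewrite uexp0 mulg1.
apply: smooth_at_eq S3.
have n1 : \forall u \near (0 : E), cdom s (g * uexp G u)%g.
  exact: (mul_uexp_continuous (near_cdom sg)).
by apply: filterS n1 => u su; rewrite chartK.
Qed.

(** Near g, a point [cinv s w] is g * uexp (ulog (g^-1 * cinv s w)), so y in the chart s is the
    translated expression of y composed with a smooth change of coordinates. *)
Lemma near_smooth_map F (y : G -> F) :
  (forall g, smooth_near y g) -> smooth_map aG (vec_atlas F) y.
Proof.
move=> yS.
have S s g : charts aG s -> cdom s g -> smooth_at (fun w => y (cinv s w)) (cmap s g).
  move=> As sg.
  have S1 := smooth_at_ulog_mull As sg (mulVg g).
  have S2 : smooth_at (fun w => y (g * uexp G (ulog (g^-1 * cinv s w)))%g) (cmap s g).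
    apply: (smooth_at_comp cE S1 (g := fun u => y (g * uexp G u)%g)).
    by rewrite chartK// mulVg ulog1; exact: yS.
  apply: smooth_at_eq S2.
  have c1 : (fun w => (g^-1 * cinv s w)%g) @ cmap s g --> (1%g : G).
    have c0 := cinv_continuous_at sg; rewrite /prop_for /continuous_at chartK// in c0.
    have c1 : (fun w => ((g^-1)%g, cinv s w)) @ cmap s g --> ((g^-1)%g, g).
      exact: (cvg_pair (cvg_cst _) c0).
    have := cvg_comp _ _ c1 (mul_continuous_at (g := (g^-1)%g) (h := g)).
    by rewrite /= mulVg.
  have n0 : nbhs (1%g : G) (fun h => uexp G (ulog h) = h) by exact: ulogK.
  have n1 : \forall w \near cmap s g,
     uexp G (ulog (g^-1 * cinv s w)%g) = (g^-1 * cinv s w)%g by exact: (c1 _ n0).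
  by apply: filterS n1 => w ->; rewrite mulVKg.
split=> [g|s _ As ->].
  pose s := chart_at aG g.
  have As : charts aG s by exact: chart_at_charts.
  have sg : cdom s g by exact: chart_at_dom.
  have c1 := cvg_comp _ _ (cmap_continuous_at sg) (smooth_at_continuous (S s g As sg)).
  rewrite /continuous_at -[in X in _ --> X](chartK sg); apply: cvg_trans c1.
  apply: near_eq_cvg; apply: filterS (near_cdom sg) => q sq /=.
  by rewrite chartK.
apply: smooth_at_on => _ [g [sg _] <-]; exact: S.
Qed.

(** The first variable moves the base point and the second is the one to be differentiated, so a
    derivative [lderiv X y] along g * uexp u becomes a partial derivative of one smooth function on
    E x E. *)
Lemma smooth_near_mul F (y : G -> F) g : smooth_near y g ->
  smooth_at (fun p : E * E => y (g * uexp G p.1 * uexp G p.2)%g) (0, 0).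
Proof.
move=> yg.
have S : smooth_at (fun p => y (g * uexp G (umul G p))%g) (0, 0).
  apply: (smooth_at_comp cE (smooth_at_umul G) (g := fun u => y (g * uexp G u)%g)).
  by rewrite umul0.
apply: smooth_at_eq S; apply: filterS (umulE G) => p <-.
by rewrite mulgA.
Qed.

Lemma near_pairl (P : E * E -> Prop) :
  (\forall p \near ((0 : E), (0 : E)), P p) -> \forall u \near (0 : E), P (u, 0).
Proof.
have := smooth_at_continuous (smooth_at_pair (smooth_at_id (0 : E)) (smooth_at_cst (0
  : E) _)).
by move=> c1 /c1.
Qed.

Lemma near_pairr (P : E * E -> Prop) :
  (\forall p \near ((0 : E), (0 : E)), P p) -> \forall u \near (0 : E), P (0, u).
Proof.
have := smooth_at_continuous (smooth_at_pair (smooth_at_cst (0 : E) _) (smooth_at_id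
  (0 : E))).
by move=> c1 /c1.
Qed.

Lemma smooth_near_near F (y : G -> F) g : smooth_near y g ->
  \forall u \near (0 : E), smooth_near y (g * uexp G u)%g.
Proof.
move=> /smooth_near_mul/smooth_at_near/near_pairl; apply: filterS => u Su.
apply: (smooth_at_comp cEE (f := fun v : E => (u, v)) _ Su).
by apply: smooth_at_pair; [exact: smooth_at_cst|exact: smooth_at_id].
Qed.

Lemma lderiv_near F (y : G -> F) g X : smooth_near y g ->
  \forall u \near (0 : E), lderiv X y (g * uexp G u)%g =
    'd (fun p : E * E => y (g * uexp G p.1 * uexp G p.2)%g) (u, 0) (0, X).
Proof.
move=> /smooth_near_mul/smooth_at_near/near_pairl.
apply: filterS => u /smooth_at_differentiable du.
by rewrite -diff_pairrE.
Qed.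

Lemma smooth_near_lderiv F (y : G -> F) g X :
  smooth_near y g -> smooth_near (lderiv X y) g.
Proof.
move=> yg; have S := smooth_at_diff (0, X) (smooth_near_mul yg).
have S1 : smooth_at (fun u : E => (u, 0 : E)) (0 : E).
  by apply: smooth_at_pair; [exact: smooth_at_id|exact: smooth_at_cst].
have S2 := smooth_at_comp cEE S1 S.
by apply: smooth_at_eq S2; apply: filterS (lderiv_near X yg) => u ->.
Qed.

(** The iterated derivative is a mixed second derivative at (0, 0) of u |-> y (g * uexp u) composed
    with [umul]. The second-order chain rule splits it into a Hessian, symmetric in X and Y, and a
    first derivative of y along the second-order term of the multiplication. *)
Lemma lderiv_lderiv F (y : G -> F) g X Y : smooth_near y g ->
  lderiv X (lderiv Y y) g =
  hess (fun u => y (g * uexp G u)%g) 0 Y X +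
  lderiv (hess (umul G) (0, 0) (0, Y) (X, 0)) y g.
Proof.
move=> yg; have S := smooth_near_mul yg.
have S1 := smooth_at_diff (0, Y) S.
have S0 : smooth_at (fun u : E => (u, 0 : E)) (0 : E).
  by apply: smooth_at_pair; [exact: smooth_at_id|exact: smooth_at_cst].
have S2 := smooth_at_comp cEE S0 S1.
have -> : lderiv X (lderiv Y y) g =
    hess (fun p : E * E => y (g * uexp G p.1 * uexp G p.2)%g) (0, 0) (0, Y) (X, 0).
  rewrite /hess -(diff_pairlE X (smooth_at_differentiable S1)).
  apply: esym; apply: diff_eqE; first exact: smooth_at_differentiable.
  by apply: filterS (lderiv_near Y yg) => u ->.
have SM : smooth_at (fun p => y (g * uexp G (umul G p))%g) (0, 0).
  apply: (smooth_at_comp cE (smooth_at_umul G) (g := fun u => y (g * uexp G u)%g)).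
  by rewrite umul0.
transitivity (hess (fun p => y (g * uexp G (umul G p))%g) (0, 0) (0, Y) (X, 0)).
  rewrite /hess; apply: diff_eqE; first exact: smooth_at_differentiable.
  have n1 : \forall p \near ((0 : E), (0 : E)),
      y (g * uexp G p.1 * uexp G p.2)%g = y (g * uexp G (umul G p))%g.
    by apply: filterS (umulE G) => p <-; rewrite mulgA.
  (* Replacing a function inside a second derivative requires equality of germs at all points near
     (0, 0), not at (0, 0) alone. *)
  have n2 := nbhs_interior n1.
  apply: filterS2 (smooth_at_near S) n2 => p Sp np.
  by apply: diff_eqE np; exact: smooth_at_differentiable.
have := @hess_comp _ _ _ _ cE (umul G) (fun u => y (g * uexp G u)%g) (0, 0) (0, Y) (X, 0).
rewrite umul0 => ->//; last exact: smooth_at_umul.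
by rewrite !diff_umul add0r addr0.
Qed.

End LeftDerivative.

Lemma diff_shift0E (R : realType) (E F : normedModType R) (f : E -> F) a v :
  differentiable f a -> 'd (fun u => f (u + a)) 0 v = 'd f a v.
Proof.
move=> fa; have := @diff_shiftE R E F f a 0 v; rewrite add0r; exact.
Qed.

Lemma diff_subcstE (R : realType) (E F : normedModType R) (f : E -> F) p a v :
  differentiable f p -> 'd (fun u => f u - a) p v = 'd f p v.
Proof.
move=> fp; have [_ E1] := is_diffB (differentiableP fp) (is_diff_cst a p).
by rewrite -[LHS]/('d (f - cst a) p v) E1 subr0.
Qed.

Lemma diff_center (R : realType) (E F : normedModType R) (f V : E -> F) e v :
  differentiable V 0 -> (\forall u \near (0 : E), f (u + e) = V u) ->
  'd f e v = 'd V 0 v.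
Proof.
move=> dV fV; have d1 := is_diffB (is_diff_id e) (is_diff_cst e e).
have d2 : is_diff (e - e) V ('d V 0) by rewrite subrr; exact: differentiableP.
have near_eq : \forall w \near e, (V \o (fun w => w - e)) w = f w.
  rewrite (near_shift 0); apply: filterS fV => u E1.
  by rewrite /= subr0 addrK E1.
have [_ ->] := is_diff_near near_eq (is_diff_comp d1 d2).
by rewrite subr0.
Qed.

(** * The bracket and the adjoint action in the chart at the unit *)

Section LieAlgebra.
Context {R : realType} {n : nat} (G : lieGroupType R n).
Local Notation aG := (manifold_atlas : atlas 'rV[R]_n G).
Local Notation E := 'rV[R]_n.
Implicit Types (F : normedModType R) (g h k : G) (X Y Z : E).
Let cE := rV_coords (R := R) n.
Let cEE := prod_coords cE cE.

Lemma mulr_uexp_continuous g : (fun u => (uexp G u * g)%g) @ (0 : E) --> g.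
Proof.
have c1 : (fun u : E => (uexp G u, g)) @ (0 : E) --> (1%g : G, g).
  exact: (cvg_pair (@uexp_continuous _ _ G) (cvg_cst g)).
have := cvg_comp _ _ c1 (mul_continuous_at (g := 1%g) (h := g)).
by rewrite /= mul1g.
Qed.

Lemma smooth_at_cmap_mulr s g : charts aG s -> cdom s g ->
  smooth_at (fun u => cmap s (uexp G u * g)%g) 0.
Proof.
move=> As sg; apply: (smooth_at_uexp_shift (f := fun h => cmap s (h * g)%g)).
by apply: smooth_at_mulr => //; [exact: uchart_charts|exact: uchart_dom|rewrite mul1g].
Qed.

Lemma diff_uexp_shift F (f : G -> F) X :
  smooth_at (fun u => f (cinv (uchart G) u)) (cmap (uchart G) 1%g) ->
  'd (fun u => f (cinv (uchart G) u)) (cmap (uchart G) 1%g) X = 'd (fun u => f (uexp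
    G u)) (0 : E) X.
Proof.
move=> /smooth_at_differentiable S.
exact: esym (@diff_shift0E R E F (fun u => f (cinv (uchart G) u)) _ X S).
Qed.

Lemma right_invariantE X g :
  right_invariant X g = 'd (fun u => cmap (chart_at aG g) (uexp G u * g)%g) (0 : E) X.
Proof.
rewrite /right_invariant /tangent_map mul1g.
apply: (diff_uexp_shift X (f := fun h => cmap (chart_at aG g) (h * g)%g)).
apply: smooth_at_mulr; [exact: uchart_charts|exact: chart_at_charts|exact: uchart_dom|].
by rewrite mul1g; exact: chart_at_dom.
Qed.

(** The field is stored in the coordinates of the preferred chart at g; differentiating the unit
    chart map along it changes coordinates, and the chart at g cancels by the chain rule. *)
Lemma right_invariant_chart X g : cdom (uchart G) g ->
  lie_derivative aG (right_invariant X) (cmap (uchart G)) g =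
  'd (fun u => ulog (uexp G u * g)%g) (0 : E) X.
Proof.
move=> cg; rewrite /lie_derivative /tangent_map right_invariantE.
set s := chart_at aG g.
have As : charts aG s by exact: chart_at_charts.
have sg : cdom s g by exact: chart_at_dom.
have S1 := smooth_at_cmap_mulr As sg.
have S2 : smooth_at (fun w => cmap (uchart G) (cinv s w)) (cmap s (uexp G 0 * g)%g).
  rewrite uexp0 mul1g.
  apply: (smooth_on_near (charts_compat As (uchart_charts G))).
  have c0 := cinv_continuous_at sg; rewrite /prop_for /continuous_at chartK// in c0.
  have n1 : \forall w \near cmap s g, cdom (uchart G) (cinv s w) by exact: (c0 _
    (near_cdom cg)).
  apply: filterS2 (near_cinv sg) n1 => w [sw ew] uw.
  by exists (cinv s w).
have S3 := smooth_at_cmap_mulr (uchart_charts G) cg.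
have S4 : 'd (fun u => ulog (uexp G u * g)%g) (0 : E) X =
    'd (fun u => cmap (uchart G) (uexp G u * g)%g) (0 : E) X.
  exact: (@diff_subcstE R E E (fun u => cmap (uchart G) (uexp G u * g)%g) _ _ X
    (smooth_at_differentiable S3)).
have E1 := diff_compE X (smooth_at_differentiable S1) (smooth_at_differentiable S2).
rewrite uexp0 mul1g in E1; apply: etrans (esym E1) _; apply: etrans _ (esym S4).
apply: esym; apply: diff_eqE; first exact: smooth_at_differentiable.
have n1 : \forall u \near (0 : E), cdom s (uexp G u * g)%g.
  exact: (mulr_uexp_continuous (near_cdom sg)).
by apply: filterS n1 => u su; rewrite chartK.
Qed.

(** In the unit chart, the right-invariant field of X is v |-> ['d (umul G) (0, v) (X, 0)]: right
    translation by v varies the first factor. *)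
Lemma diff_vf_in_chart X Y :
  'd (vf_in_chart aG (uchart G) (right_invariant X)) (cmap (uchart G) 1%g) Y =
  hess (umul G) (0, 0) (X, 0) (0, Y).
Proof.
set e := cmap (uchart G) 1%g.
pose V (v : E) := 'd (umul G) (0, v) (X, 0).
have SV : smooth_at V 0.
  apply: (smooth_at_comp cEE (f := fun v : E => (0 : E, v)) (g := fun p => 'd (umul
    G) p (X, 0))).
    by apply: smooth_at_pair; [exact: smooth_at_cst|exact: smooth_at_id].
  exact/smooth_at_diff/smooth_at_umul.
have nV : \forall v \near (0 : E),
    vf_in_chart aG (uchart G) (right_invariant X) (v + e) = V v.
  have n1 := near_pairr (smooth_at_near (smooth_at_umul G)).
  apply: filterS2 (uexp_dom G) n1 => v cv Sv.
  rewrite /vf_in_chart /= -/(uexp G v) right_invariant_chart//.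
  exact: (diff_pairlE X (smooth_at_differentiable Sv)).
rewrite (diff_center Y (smooth_at_differentiable SV) nV).
exact: (diff_pairrE Y (smooth_at_differentiable (smooth_at_diff (X, 0)
  (smooth_at_umul G)))).
Qed.

Lemma right_invariant1 X : right_invariant X (1%g : G) = X.
Proof.
rewrite right_invariantE -/(uchart G).
have d1 := is_diffD (is_diff_id (0 : E)) (is_diff_cst (cmap (uchart G) 1%g) (0 : E)).
have near_eq : \forall u \near (0 : E), u + cmap (uchart G) 1%g = cmap (uchart G)
  (uexp G u * 1)%g.
  by apply: filterS (uexpK G) => u {1}<-; rewrite mulg1 subrK.
have [_ ->] := is_diff_near near_eq d1.
exact: addr0.
Qed.

(** If b (u, v) is the mixed second-order part of [umul], this reads b (Y, X) - b (X, Y); for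
    matrices b (u, v) = u v, which gives YX - XY. *)
Lemma lie_bracketE X Y : lie_bracket (G := G) X Y =
  hess (umul G) (0, 0) (0, X) (Y, 0) - hess (umul G) (0, 0) (0, Y) (X, 0).
Proof.
pose D V W : E := 'd (vf_in_chart aG (uchart G) (right_invariant V)) (cmap (uchart G)
  1%g) W.
have DE V W : D V W = hess (umul G) (0, 0) (0, W) (V, 0).
  apply: etrans (diff_vf_in_chart V W) _.
  exact: (hess_sym cE (V, 0) (0, W) (smooth_at_umul G)).
transitivity (D Y X - D X Y); last by rewrite !DE.
exact: (congr2 (fun a b => D Y a - D X b) (right_invariant1 X) (right_invariant1 Y)).
Qed.

Lemma lie_bracket_linearl (k : R) X X' Y : lie_bracket (G := G) (k *: X + X') Y =
  k *: lie_bracket (G := G) X Y + lie_bracket (G := G) X' Y.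
Proof.
pose B V W : E := hess (umul G) (0, 0) (0, V) (W, 0).
have Bl V V' W : B (k *: V + V') W = k *: B V W + B V' W.
  have E1 : (0, k *: V + V') = k *: (0, V) + (0, V') :> E * E.
    by congr (_, _); rewrite /= scaler0 addr0.
  by rewrite /B E1; exact: (hess_linearl k (0, V) (0, V') (W, 0) (smooth_at_umul G)).
have Br V W W' : B V (k *: W + W') = k *: B V W + B V W'.
  have E1 : (k *: W + W', 0) = k *: (W, 0) + (W', 0) :> E * E.
    by congr (_, _); rewrite /= scaler0 addr0.
  by rewrite /B E1; exact: hess_linearr.
have BE V W : lie_bracket (G := G) V W = B V W - B W V by exact: lie_bracketE.
rewrite !{}BE Bl Br; move: B {Bl Br} => B.
by rewrite scalerBr opprD addrACA.
Qed.

Lemma lie_bracketC X Y : lie_bracket (G := G) X Y = - lie_bracket (G := G) Y X.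
Proof. by rewrite !lie_bracketE opprB. Qed.

Lemma lie_bracketxx X : lie_bracket (G := G) X X = 0.
Proof. by rewrite lie_bracketE subrr. Qed.

Lemma lie_bracket_linearr (k : R) X Y Y' : lie_bracket (G := G) X (k *: Y + Y') =
  k *: lie_bracket (G := G) X Y + lie_bracket (G := G) X Y'.
Proof.
by rewrite !(lie_bracketC X) lie_bracket_linearl opprD scalerN.
Qed.

Lemma lderiv_commutator (y : G -> E) g X Y : smooth_near y g ->
  lderiv X (lderiv Y y) g - lderiv Y (lderiv X y) g = - lderiv (lie_bracket (G := G)
    X Y) y g.
Proof.
move=> yg.
have E3 : hess (fun u : E => y (g * uexp G u)%g) 0 X Y =
    hess (fun u : E => y (g * uexp G u)%g) 0 Y X .
  exact: (hess_sym cE X Y yg).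
rewrite (lderiv_lderiv X Y yg) (lderiv_lderiv Y X yg) E3 opprD addrACA subrr add0r.
have lB V W : lderiv (V - W) y g = lderiv V y g - lderiv W y g.
  exact: linearB.
rewrite (lie_bracketE X Y) lB.
by rewrite opprB.
Qed.

Definition uconj h (u : E) : E := ulog (h * uexp G u * h^-1)%g.

Lemma conj_uexp_continuous h : (fun u => (h * uexp G u * h^-1)%g) @ (0 : E) --> (1%g : G).
Proof.
have c1 : (fun u : E => ((h * uexp G u)%g, (h^-1)%g)) @ (0 : E) --> (h, (h^-1)%g).
  exact: (cvg_pair (mul_uexp_continuous (g := h)) (cvg_cst _)).
have := cvg_comp _ _ c1 (mul_continuous_at (g := h) (h := (h^-1)%g)).
by rewrite /= mulgV.
Qed.

Lemma uconjE h : \forall u \near (0 : E), uexp G (uconj h u) = (h * uexp G u * h^-1)%g.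
Proof.
have n0 : nbhs (1%g : G) (fun g => uexp G (ulog g) = g) by exact: ulogK.
have c1 := @conj_uexp_continuous h; exact: (c1 _ n0).
Qed.

Lemma uconj0 h : uconj h 0 = 0.
Proof. by rewrite /uconj uexp0 mulg1 mulgV ulog1. Qed.

Lemma smooth_at_uconj h : smooth_at (uconj h) 0.
Proof.
pose s := chart_at aG h.
have As : charts aG s by exact: chart_at_charts.
have sh : cdom s h by exact: chart_at_dom.
have S1 := smooth_at_cmap_mull As sh.
have S2 := smooth_at_ulog_mulr As sh (mulgV h).
have S3 : smooth_at (fun u => ulog (cinv s (cmap s (h * uexp G u)%g) * h^-1)%g) 0.
  apply: (smooth_at_comp cE S1 (g := fun w => ulog (cinv s w * h^-1)%g)).
  by rewrite uexp0 mulg1.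
apply: smooth_at_eq S3.
have n1 : \forall u \near (0 : E), cdom s (h * uexp G u)%g.
  exact: (mul_uexp_continuous (near_cdom sh)).
by apply: filterS n1 => u su; rewrite chartK.
Qed.

Lemma AdE h X : Ad h X = 'd (uconj h) 0 X.
Proof.
rewrite /Ad /tangent_map mulg1 mulgV -/(uchart G).
have S : smooth_at (fun w => cmap (uchart G) (h * cinv (uchart G) w * h^-1)%g) (cmap
  (uchart G) 1%g).
  have S1 : smooth_at (fun w => uconj h (w - cmap (uchart G) 1%g) + cmap (uchart G) 1%g)
      (cmap (uchart G) 1%g).
    apply: smooth_atD; last exact: smooth_at_cst.
    apply: (smooth_at_shift cE (f := uconj h)).
    by rewrite subrr; exact: smooth_at_uconj.
  apply: smooth_at_eq S1; apply: filterE => w.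
  by rewrite /uconj /uexp /ulog !subrK.
rewrite -[LHS]/('d (fun w => cmap (uchart G) (h * cinv (uchart G) w * h^-1)%g) (cmap
  (uchart G) 1%g) X).
apply: etrans (diff_uexp_shift X (f := fun g => cmap (uchart G) (h * g * h^-1)%g) S) _.
have S2 : smooth_at (fun u => cmap (uchart G) (h * uexp G u * h^-1)%g) (0 : E).
  exact: (smooth_at_uexp_shift (f := fun g => cmap (uchart G) (h * g * h^-1)%g) S).
exact: esym (@diff_subcstE R E E (fun u => cmap (uchart G) (h * uexp G u * h^-1)%g) _ _ X
  (smooth_at_differentiable S2)).
Qed.

Lemma Ad_linear h (k : R) X Y : Ad h (k *: X + Y) = k *: Ad h X + Ad h Y.
Proof. by rewrite !AdE linearP. Qed.

End LieAlgebra.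

(** * Invariance of the bracket under Ad, and the Jacobi identity *)

Section AdBracket.
Context {R : realType} {n : nat} (G : lieGroupType R n).
Local Notation E := 'rV[R]_n.
Implicit Types (F : normedModType R) (g h k : G) (X Y Z : E).
Let cE := rV_coords (R := R) n.

Lemma AdK h X : Ad h (Ad (h^-1)%g X) = X.
Proof.
rewrite !AdE.
have S1 := smooth_at_differentiable (smooth_at_uconj (h^-1)%g).
have S2 : differentiable (uconj h) (uconj (h^-1)%g 0).
  by rewrite uconj0; apply: smooth_at_differentiable; exact: smooth_at_uconj.
have E1 := diff_compE X S1 S2; rewrite uconj0 in E1; apply: etrans (esym E1) _.
have [_ ->] : is_diff (0 : E) (fun u => uconj h (uconj (h^-1)%g u)) id; last by [].
apply: is_diff_near (is_diff_id _).
apply: filterS2 (uconjE (h^-1)%g) (uexpK G) => u E2 E3.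
by rewrite {1}/uconj E2 invgK !mulgA mulgV mul1g mulgK.
Qed.

(** Conjugation by h sends g * uexp u to (h * g * h^-1) * uexp (uconj h u), so it intertwines the
    derivation along X with the one along [Ad h X]. *)
Lemma smooth_near_conj F (z : G -> F) g h : smooth_near z (h * g * h^-1)%g ->
  smooth_near (fun k => z (h * k * h^-1)%g) g /\
  forall X, lderiv X (fun k => z (h * k * h^-1)%g) g = lderiv (Ad h X) z (h * g * h^-1)%g.
Proof.
move=> zh.
have S : smooth_at (fun u => z (h * g * h^-1 * uexp G (uconj h u))%g) 0.
  apply: (smooth_at_comp cE (smooth_at_uconj h) (g := fun u => z (h * g * h^-1 * uexp
    G u)%g)).
  by rewrite uconj0.
have nE : \forall u \near (0 : E), z (h * g * h^-1 * uexp G (uconj h u))%g =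
    z (h * (g * uexp G u) * h^-1)%g.
  by apply: filterS (uconjE h) => u ->; rewrite !mulgA mulgVK.
split=> [|X]; first exact: smooth_at_eq S.
rewrite /lderiv -(diff_eqE X (smooth_at_differentiable S) nE) AdE.
have S2 : differentiable (fun u => z (h * g * h^-1 * uexp G u)%g) (uconj h 0).
  by rewrite uconj0; exact: smooth_at_differentiable.
rewrite (diff_compE X (smooth_at_differentiable (smooth_at_uconj h)) S2).
by rewrite uconj0.
Qed.

Lemma lderiv_eq_near F (y z : G -> F) g X : smooth_near y g ->
  (\forall u \near (0 : E), y (g * uexp G u)%g = z (g * uexp G u)%g) ->
  lderiv X y g = lderiv X z g.
Proof. by move=> yg; apply: diff_eqE; exact: smooth_at_differentiable. Qed.

Lemma smooth_near_ulog : smooth_near (@ulog _ _ G) 1%g.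
Proof.
apply: smooth_at_eq (smooth_at_id (0 : E)).
by apply: filterS (uexpK G) => u E1; rewrite mul1g.
Qed.

(** An invariant derivation is recovered from its value on [ulog] at the unit, so identities between
    derivations become identities in the Lie algebra. *)
Lemma lderiv_ulog X : lderiv X (@ulog _ _ G) 1%g = X.
Proof.
rewrite /lderiv -(diff_eqE X (smooth_at_differentiable (smooth_at_id (0 : E)))).
  by have [_ ->] := is_diff_id (0 : E).
by apply: filterS (uexpK G) => u E1; rewrite mul1g.
Qed.

(** The commutator of the derivations along X and Y is applied to z, the chart composed with
    conjugation. Directly it gives minus [Ad h] of the bracket; after conjugation it is the
    commutator along [Ad h X] and [Ad h Y] applied to the chart. *)
Lemma Ad_lie_bracket h X Y :
  Ad h (lie_bracket (G := G) X Y) = lie_bracket (G := G) (Ad h X) (Ad h Y).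
Proof.
have c1 : (h * 1 * h^-1)%g = 1%g by rewrite mulg1 mulgV.
pose z k : E := ulog (h * k * h^-1)%g.
have S0 : smooth_near (@ulog _ _ G) (h * 1 * h^-1)%g by rewrite c1; exact: smooth_near_ulog.
have [Sz dz] := smooth_near_conj S0.
have dd V W : lderiv V (lderiv W z) 1%g =
    lderiv (Ad h V) (lderiv (Ad h W) (@ulog _ _ G)) 1%g.
  have S1 := smooth_near_lderiv (Ad h W) S0.
  have [S2 d2] := smooth_near_conj S1.
  rewrite -[in RHS]c1 -d2; apply: lderiv_eq_near; first exact: smooth_near_lderiv.
  have n0 : \forall u \near (0 : E), smooth_near (@ulog _ _ G) (h * 1 * h^-1 * uexp G u)%g.
    exact: smooth_near_near.
  (* The inner derivative must be conjugated at all points near the unit, and [ulog] is known to be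
     smooth only there; continuity of [uconj h] keeps the conjugated points in range. *)
  have n1 : \forall u \near (0 : E), smooth_near (@ulog _ _ G) (h * 1 * h^-1 * uexp G
    (uconj h u))%g.
    have := smooth_at_continuous (smooth_at_uconj h).
    by rewrite /prop_for /continuous_at uconj0; move=> cu; exact: (cu _ n0).
  apply: filterS2 n1 (uconjE h) => u Su Eu.
  rewrite Eu c1 mul1g in Su.
  have E2 : (h * (1 * uexp G u) * h^-1)%g = (h * uexp G u * h^-1)%g by rewrite mul1g.
  have Su' : smooth_near (@ulog _ _ G) (h * (1 * uexp G u) * h^-1)%g by rewrite E2.
  by have [_ ->] := smooth_near_conj Su'.
have dz' W : lderiv W z 1%g = Ad h W.
  apply: etrans (dz W) _; apply: etrans (congr1 (lderiv (Ad h W) (@ulog _ _ G)) c1) _.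
  exact: lderiv_ulog.
have E1 : lderiv X (lderiv Y z) 1%g - lderiv Y (lderiv X z) 1%g =
    - lderiv (lie_bracket (G := G) X Y) z 1%g := lderiv_commutator X Y Sz.
have E2 := lderiv_commutator (Ad h X) (Ad h Y) smooth_near_ulog.
have E3 := etrans (esym E1) (etrans (congr2 (fun a b => a - b) (dd X Y) (dd Y X)) E2).
apply: etrans (esym (dz' _)) _; apply: etrans (oppr_inj E3) _.
exact: lderiv_ulog.
Qed.

Lemma lderivB F (y z : G -> F) g X : smooth_near y g -> smooth_near z g ->
  lderiv X (fun k => y k - z k) g = lderiv X y g - lderiv X z g.
Proof.
move=> yg zg; have [_ E1] := is_diffB (smooth_at_is_diff yg) (smooth_at_is_diff zg).
by rewrite -[LHS]/('d ((fun u => y (g * uexp G u)%g) - (fun u => z (g * uexp G u)%g))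
  0 X) E1.
Qed.

Lemma lderivN F (z : G -> F) g X : smooth_near z g ->
  lderiv X (fun k => - z k) g = - lderiv X z g.
Proof.
move=> zg; have [_ E1] := is_diffN (smooth_at_is_diff zg).
by rewrite -[LHS]/('d (- (fun u => z (g * uexp G u)%g)) 0 X) E1.
Qed.

Lemma lderivP F (y z : G -> F) (a : R) g X : smooth_near y g -> smooth_near z g ->
  lderiv X (fun k => a *: y k + z k) g = a *: lderiv X y g + lderiv X z g.
Proof.
move=> yg zg;
  have [_ E1] := is_diffD (is_diffZ a (smooth_at_is_diff yg)) (smooth_at_is_diff zg).
by rewrite -[LHS]/('d (a *: (fun u => y (g * uexp G u)%g) + (fun u => z (g * uexp G
  u)%g)) 0 X) E1.
Qed.

Definition ulog_lderiv3 X Y Z : E := lderiv X (lderiv Y (lderiv Z (@ulog _ _ G))) 1%g.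

(* The commutator [D_X, [D_Y, D_Z]] of invariant derivations, evaluated on the
   chart at the unit. *)
Lemma lie_bracket_lderiv X Y Z :
  lie_bracket (G := G) X (lie_bracket (G := G) Y Z) =
  (ulog_lderiv3 X Y Z - ulog_lderiv3 X Z Y) - (ulog_lderiv3 Y Z X - ulog_lderiv3 Z Y X).
Proof.
have zS := smooth_near_ulog; set W := lie_bracket (G := G) Y Z.
have E1 := lderiv_commutator X W zS.
have E2 : lderiv W (lderiv X (@ulog _ _ G)) 1%g = - (ulog_lderiv3 Y Z X -
  ulog_lderiv3 Z Y X).
  exact: (canRL opprK (esym (lderiv_commutator Y Z (smooth_near_lderiv X zS)))).
have E3 : lderiv X (lderiv W (@ulog _ _ G)) 1%g = - (ulog_lderiv3 X Y Z -
  ulog_lderiv3 X Z Y).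
  have SYZ : smooth_near (lderiv Y (lderiv Z (@ulog _ _ G))) 1%g.
    exact: (smooth_near_lderiv Y (smooth_near_lderiv Z zS)).
  have SZY : smooth_near (lderiv Z (lderiv Y (@ulog _ _ G))) 1%g.
    exact: (smooth_near_lderiv Z (smooth_near_lderiv Y zS)).
  apply: etrans (congr1 -%R (lderivB X SYZ SZY)).
  apply: etrans (lderivN X (smooth_atB SYZ SZY)).
  apply: lderiv_eq_near; first exact: smooth_near_lderiv.
  (* The commutator identity is about to be differentiated along X, so it is needed at all points
     near the unit. *)
  apply: filterS (smooth_near_near zS) => u Su.
  exact: (canRL opprK (esym (lderiv_commutator Y Z Su))).
have E4 : lderiv (lie_bracket (G := G) X W) (@ulog _ _ G) 1%g = lie_bracket (G := G) X W.
  exact: lderiv_ulog.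
have E5 : - lie_bracket (G := G) X W =
    - (ulog_lderiv3 X Y Z - ulog_lderiv3 X Z Y) - - (ulog_lderiv3 Y Z X -
      ulog_lderiv3 Z Y X).
  apply: etrans (congr1 -%R (esym E4)) _; apply: etrans (esym E1) _.
  exact: (congr2 (fun a b => a - b) E3 E2).
by apply: oppr_inj; rewrite E5 -opprD.
Qed.

(** The cyclic sum has twelve third-order terms: each of the six orders of X, Y, Z occurs once with
    each sign. *)
Lemma lie_bracket_jacobi X Y Z :
  lie_bracket (G := G) X (lie_bracket (G := G) Y Z) +
  lie_bracket (G := G) Y (lie_bracket (G := G) Z X) +
  lie_bracket (G := G) Z (lie_bracket (G := G) X Y) = 0.
Proof.
rewrite !lie_bracket_lderiv; move: ulog_lderiv3 => D.
apply/rowP => i; rewrite !mxE; ring.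
Qed.

End AdBracket.

(** * The product as a derivation with variable coefficients *)

Section Blacktriangleright.
Context {R : realType} {n : nat} (G : lieGroupType R n).
Local Notation aG := (manifold_atlas : atlas 'rV[R]_n G).
Local Notation E := 'rV[R]_n.
Implicit Types (F : normedModType R) (g h k : G) (X Y Z : E) (x y z : G -> E).
Let cE := rV_coords (R := R) n.

(** [rho] and [lie_derivative] both pass through the preferred chart at g, which cancels by the
    chain rule. *)
Lemma blacktrianglerightE x y g :
  smooth_map aG (vec_atlas E) y -> blacktriangleright x y g = lderiv (x g) y g.
Proof.
move=> [_ yS]; rewrite /blacktriangleright /lie_derivative rhoE.
set s := chart_at aG g; set X := x g.
have As : charts aG s by exact: chart_at_charts.
have sg : cdom s g by exact: chart_at_dom.
have S1 := smooth_at_differentiable (smooth_at_cmap_mull As sg).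
have S2 : differentiable (fun w => y (cinv s w)) (cmap s (g * uexp G 0)%g).
  rewrite uexp0 mulg1; apply: smooth_at_differentiable.
  apply: (smooth_on_near (yS s (id_chart E) As erefl)).
  by apply: filterS (near_cinv sg) => w [sw <-]; exists (cinv s w).
transitivity ('d (fun w => y (cinv s w)) (cmap s (g * uexp G 0)%g)
    ('d (fun u => cmap s (g * uexp G u)%g) (0 : E) X)).
  by rewrite uexp0 mulg1.
rewrite -(diff_compE X S1 S2).
apply: diff_eqE; first exact: differentiable_comp S1 S2.
have n1 : \forall u \near (0 : E), cdom s (g * uexp G u)%g.
  exact: (mul_uexp_continuous (near_cdom sg)).
by apply: filterS n1 => u su; rewrite chartK.
Qed.

Lemma lderiv_sum X z g : lderiv X z g =
  \sum_i cform i X *: lderiv (cbase (c:=cE) i) z g.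
Proof.
rewrite {1}(coordsE cE X) /lderiv linear_sum.
by apply: eq_bigr => i _; rewrite linearZ.
Qed.

Lemma smooth_near_lderiv_field x z g : smooth_near x g -> smooth_near z g ->
  smooth_near (fun k => lderiv (x k) z k) g.
Proof.
move=> xg zg.
have S : smooth_at (fun u => \sum_i cform i (x (g * uexp G u)%g) *:
    lderiv (cbase (c:=cE) i) z (g * uexp G u)%g) 0.
  apply: smooth_at_sum => i; apply: smooth_at_scale.
    by apply: smooth_at_lin => //; exact: cform_continuous.
  exact: (smooth_near_lderiv (cbase i) zg).
by apply: smooth_at_eq S; apply: filterE => u; rewrite -lderiv_sum.
Qed.

(** Both the direction x k and the point k vary. The product rule in a basis isolates the derivative
    of the direction, which is the term that the associator subtracts. *)
Lemma lderiv_lderiv_field x z g X : smooth_near x g -> smooth_near z g ->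
  lderiv X (fun k => lderiv (x k) z k) g =
  lderiv (lderiv X x g) z g + lderiv X (lderiv (x g) z) g.
Proof.
move=> xg zg.
have Sz i := smooth_near_lderiv (cbase (c:=cE) i) zg.
have Sx (i : 'I_(cdim cE)) : smooth_at (fun u => cform i (x (g * uexp G u)%g)) 0.
  by apply: smooth_at_lin => //; exact: cform_continuous.
have Sxz i := smooth_at_differentiable (smooth_at_scale (Sx i) (Sz i)).
have Scz i := smooth_at_differentiable (smooth_atZ (cform i (x g)) (Sz i)).
have f1 : (fun u => lderiv (x (g * uexp G u)%g) z (g * uexp G u)%g) = fun u =>
    \sum_i cform i (x (g * uexp G u)%g) *: lderiv (cbase (c:=cE) i) z (g * uexp G u)%g.
  by apply/funext => u; exact: lderiv_sum.
have f2 : (fun u => lderiv (x g) z (g * uexp G u)%g) = fun u =>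
    \sum_i cform i (x g) *: lderiv (cbase (c:=cE) i) z (g * uexp G u)%g.
  by apply/funext => u; exact: lderiv_sum.
have D1 : lderiv X (fun k => lderiv (x k) z k) g =
    'd (fun u => \sum_i cform i (x (g * uexp G u)%g) *:
       lderiv (cbase (c:=cE) i) z (g * uexp G u)%g) 0 X.
  exact: (congr1 (fun f : E -> E => 'd f 0 X) f1).
have D2 : lderiv X (lderiv (x g) z) g =
    'd (fun u => \sum_i cform i (x g) *: lderiv (cbase (c:=cE) i) z (g * uexp G u)%g) 0 X.
  exact: (congr1 (fun f : E -> E => 'd f 0 X) f2).
have [_ E1] := diff_sumE (index_enum 'I_(cdim cE)) X Sxz.
have [_ E2] := diff_sumE (index_enum 'I_(cdim cE)) X Scz.
have D3 := lderiv_sum (lderiv X x g) z g.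
apply: etrans D1 _; apply: etrans E1 _; apply: esym.
apply: etrans (congr2 +%R D3 (etrans D2 E2)) _; rewrite -big_split;
  apply: eq_bigr => i _ /=.
have E3 : 'd (fun u => cform (c:=cE) i (x (g * uexp G u)%g)) 0 X = cform i (lderiv X x g).
  by apply: diff_linE; [exact: cform_continuous|exact: smooth_at_differentiable].
have E4 := diff_scaleE X (smooth_at_differentiable (Sx i)) (smooth_at_differentiable
  (Sz i)).
have E5 := diff_scaleE X (differentiable_cst (cform i (x g)) (0 : E))
  (smooth_at_differentiable (Sz i)).
apply: esym; apply: etrans E4 _; rewrite E3 uexp0 mulg1 addrC; congr (_ + _).
by apply: esym; apply: etrans E5 _; rewrite diff_cst scale0r addr0.
Qed.

End Blacktriangleright.

(** * The post-Lie axioms on equivariant maps *)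

Section PostLie.
Context {R : realType} {n : nat} (G : lieGroupType R n) (H : set G).
Local Notation aG := (manifold_atlas : atlas 'rV[R]_n G).
Local Notation E := 'rV[R]_n.
Implicit Types (g h : G) (X Y Z : E) (x y z : G -> E).
Let cE := rV_coords (R := R) n.
Local Notation A := (Omega0 H).

Lemma smooth_near_lie_bracket x y g : smooth_near x g -> smooth_near y g ->
  smooth_near (pointwise_bracket x y) g.
Proof.
exact: (smooth_at_bilinear cE cE (@lie_bracket_linearl _ _ G) (@lie_bracket_linearr _ _ G)).
Qed.

Lemma lderiv_lie_bracket x y g X : smooth_near x g -> smooth_near y g ->
  lderiv X (pointwise_bracket x y) g =
  lie_bracket (G := G) (lderiv X x g) (y g) + lie_bracket (G := G) (x g) (lderiv X y g).
Proof.
move=> xg yg.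
have := diff_bilinear cE cE (@lie_bracket_linearl _ _ G) (@lie_bracket_linearr _ _ G)
  X xg yg.
by rewrite uexp0 mulg1; exact.
Qed.

(** Since g * h * uexp u = g * (h * uexp u * h^-1) * h, moving h to the right conjugates the
    increment, and equivariance then takes out the linear map [Ad h^-1]. For X = Ad (h^-1) (x g) the
    inner direction is x g again, which makes the product equivariant. *)
Lemma lderiv_equivariant y g h X : smooth_near y g ->
  (forall g, y (g * h)%g = Ad (h^-1)%g (y g)) ->
  lderiv X y (g * h)%g = Ad (h^-1)%g (lderiv (Ad h X) y g).
Proof.
move=> yg yH.
pose f u := y (g * uexp G u)%g.
have Sf : smooth_at f (uconj h 0) by rewrite uconj0.
have S1 : smooth_at (fun u => f (uconj h u)) 0 by exact: (smooth_at_comp cE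
  (smooth_at_uconj h) Sf).
pose L := 'd (uconj (h^-1)%g) (0 : E).
have Lc : continuous L by apply: diff_continuous;
  exact: smooth_at_differentiable (smooth_at_uconj _).
have S2 : smooth_at (fun u => L (f (uconj h u))) 0 by exact: (smooth_at_lin Lc S1).
have E1 : 'd (fun u => L (f (uconj h u))) 0 X = lderiv X y (g * h)%g.
  apply: diff_eqE; first exact: smooth_at_differentiable.
  apply: filterS (uconjE h) => u Eu; rewrite /f Eu.
  apply: etrans (esym (AdE _ _)) _; rewrite -yH; congr y.
  by rewrite !mulgA mulgVK.
apply: etrans (esym E1) _.
apply: etrans (diff_linE X Lc (smooth_at_differentiable S1)) _.
apply: etrans _ (esym (AdE _ _)); congr (L _).
apply: etrans (diff_compE X (smooth_at_differentiable (smooth_at_uconj h))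
  (smooth_at_differentiable Sf)) _.
by rewrite uconj0 /lderiv AdE.
Qed.

Let Asmooth x g : A x -> smooth_near x g.
Proof. by move=> [xS _]; exact: smooth_map_near. Qed.

Let AE x y g : A y -> blacktriangleright x y g = lderiv (x g) y g.
Proof. by move=> [yS _]; exact: blacktrianglerightE. Qed.

Let AE' x y : A y -> blacktriangleright x y = fun g => lderiv (x g) y g.
Proof. by move=> Ay; apply/funext => g; exact: AE. Qed.

Lemma Omega0_subspace : Defs.subspace A.
Proof.
split.
  split=> [|g h _]; first by apply: near_smooth_map => g; exact: smooth_at_cst.
  by rewrite AdE linear0.
move=> k x y Ax Ay; split=> [|g h Hh].
  apply: near_smooth_map => g.
  by apply: smooth_atD; [apply: smooth_atZ|]; exact: Asmooth.
case: Ax => _ xH; case: Ay => _ yH.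
by rewrite /= !fctE xH// yH// Ad_linear.
Qed.

Lemma Omega0_opp_bracket x y : A x -> A y -> A (- pointwise_bracket x y).
Proof.
move=> Ax Ay; split=> [|g h Hh].
  apply: near_smooth_map => g; apply: smooth_atN.
  by apply: smooth_near_lie_bracket; exact: Asmooth.
case: Ax => _ xH; case: Ay => _ yH.
rewrite -[LHS]/(- lie_bracket (x (g * h)%g) (y (g * h)%g)) xH// yH//.
by rewrite -Ad_lie_bracket !AdE -linearN.
Qed.

Lemma Omega0_blacktriangleright x y : A x -> A y -> A (blacktriangleright x y).
Proof.
move=> Ax Ay; rewrite AE'//; split=> [|g h Hh].
  apply: near_smooth_map => g.
  by apply: smooth_near_lderiv_field; exact: Asmooth.
have [_ xH] := Ax; have [_ yH] := Ay.
rewrite (lderiv_equivariant _ (Asmooth g Ay)); last by move=> k; exact: yH.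
by rewrite xH// AdK.
Qed.

Lemma Omega0_lie_algebra : lie_algebra_on A (fun x y => - pointwise_bracket x y).
Proof.
split; first exact: Omega0_subspace.
- split=> [x y|k x x' y _ _ _|k x y y' _ _ _]; first exact: Omega0_opp_bracket.
  + apply/funext => g; rewrite -[LHS]/(- lie_bracket (k *: x g + x' g) (y g)).
    by rewrite lie_bracket_linearl opprD -scalerN.
  + apply/funext => g; rewrite -[LHS]/(- lie_bracket (x g) (k *: y g + y' g)).
    by rewrite lie_bracket_linearr opprD -scalerN.
- move=> x _; apply/funext => g.
  by rewrite -[LHS]/(- lie_bracket (x g) (x g)) lie_bracketxx oppr0.
- move=> x y z _ _ _; apply/funext => g.
  (* The inner bracket carries its own minus sign; the two signs cancel, and the Jacobi identity of
     the original bracket remains. *)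
  have N (V W : E) : - lie_bracket (G := G) V (- W) = lie_bracket (G := G) V W.
    have E0 : lie_bracket (G := G) V 0 = 0.
      have := @lie_bracket_linearr _ _ G (-1) V 0 0.
      by rewrite scaler0 addr0 scaleN1r addNr.
    have := @lie_bracket_linearr _ _ G (-1) V W 0.
    by rewrite addr0 E0 addr0 !scaleN1r => ->; rewrite opprK.
  rewrite -[LHS]/(- lie_bracket (x g) (- lie_bracket (y g) (z g)) +
     - lie_bracket (y g) (- lie_bracket (z g) (x g)) + - lie_bracket (z g) (-
       lie_bracket (x g) (y g))).
  by rewrite !N lie_bracket_jacobi.
Qed.

Lemma Omega0_post_lie : post_lie_algebra_on A
  (fun x y => - pointwise_bracket x y) (fun x y => blacktriangleright x y).
Proof.
split; first exact: Omega0_lie_algebra.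
- split=> [x y|k x x' y Ax Ax' Ay|k x y y' Ax Ay Ay'];
  first exact: Omega0_blacktriangleright.
  + rewrite !AE'//; apply/funext => g.
    rewrite -[LHS]/(lderiv (k *: x g + x' g) y g).
    exact: linearP.
  + have Aky : A (k *: y + y') by apply: Omega0_subspace.2.
    rewrite !AE'//; apply/funext => g.
    exact: lderivP (Asmooth g Ay) (Asmooth g Ay').
- move=> x y z Ax Ay Az; have Ayz := Omega0_opp_bracket Ay Az.
  apply/funext => g; rewrite AE//.
  have Sb := smooth_near_lie_bracket (Asmooth g Ay) (Asmooth g Az).
  apply: etrans (lderivN (x g) Sb) _.
  rewrite lderiv_lie_bracket; [|exact: Asmooth..].
  by rewrite opprD -(AE x g Ay) -(AE x g Az).
- move=> x y z Ax Ay Az.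
  have Ayz := Omega0_blacktriangleright Ay Az; have Axz := Omega0_blacktriangleright Ax Az.
  have Axy := Omega0_blacktriangleright Ax Ay; have Ayx := Omega0_blacktriangleright Ay Ax.
  have assoc v w g : A v -> A w -> A (blacktriangleright w z) ->
      associator blacktriangleright v w z g = lderiv (v g) (lderiv (w g) z) g.
    move=> Av Aw Awz; rewrite /associator.
    rewrite -[LHS]/(blacktriangleright v (blacktriangleright w z) g -
       blacktriangleright (blacktriangleright v w) z g).
    rewrite (AE v g Awz) (AE _ g Az) (AE v g Aw) (AE' w Az).
    rewrite lderiv_lderiv_field; [|exact: Asmooth..].
    by rewrite addrAC subrr add0r.
  apply/funext => g; rewrite AE//.
  rewrite -[RHS]/(associator blacktriangleright x y z g - associator
    blacktriangleright y x z g).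
  (* The minus sign in the post-Lie bracket matches the one in [lderiv_commutator]. *)
  rewrite !assoc//; apply: etrans _ (esym (lderiv_commutator (x g) (y g) (Asmooth g Az))).
  exact: linearN.
Qed.

End PostLie.

Theorem proposition2p16 (R : realType) (n m : nat)
    (G : lieGroupType R n) (M : manifoldType R m)
    (act : G -> M -> M) (act_action : lie_group_action act)
    (act_transitive : transitive_action act) (o : M) :
  post_lie_algebra_on (Omega0 (isotropy act o))
    (fun x y : G -> 'rV[R]_n => - pointwise_bracket x y)
    (fun x y : G -> 'rV[R]_n => blacktriangleright x y).
Proof. exact: Omega0_post_lie. Qed.
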